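(* For each $n\ge 1$, let $\{m_n(t)\}_{t\ge 0}$ be the Curie-Weiss empirical magnetization process at the critical inverse temperature $\beta=1$, i.e. the Markov process on $E_n=\{-1,-1+\tfrac2n,\dots,1-\tfrac2n,1\}$ with generator $$\mathcal{A}_nf(x) = n \frac{1-x}{2} e^{x} \left[f\left(x + \tfrac{2}{n}\right) - f(x)\right] + n \frac{1+x}{2} e^{-x} \left[f\left(x - \tfrac{2}{n}\right) - f(x)\right].$$ Let $\{b_n\}_{n\geq 1}$ be a sequence of positive real numbers such that $b_n \to \infty$ and $b_n^{4} n^{-1} \to 0$. Suppose that $b_n m_n(0)$ satisfies the large deviation principle with speed $n b_n^{-4}$ on $\mathbb{R}$ with rate function $I_0$. Then the trajectories $\left\{b_n m_n(b_n^2 t)\right\}_{t \geq 0}$ satisfy the large deviation principle on $D_{\mathbb{R}}(\mathbb{R}^+)$ with speed $n b_n^{-4}$ and good rate function $$I(\gamma) = \begin{cases} I_0(\gamma(0)) + \int_0^\infty \mathcal{L} (\gamma(s),\dot{\gamma}(s)) \,\mathrm{d}s & \text{if } \gamma \in \mathcal{AC}, \\ \infty & \text{otherwise},\end{cases}$$ where $$\mathcal{L}(x,v) = \frac{1}{8} \left|v + \frac{2}{3}x^3 \right|^2.$$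
   Context: $D_{\mathbb{R}}(\mathbb{R}^+)$ is the Skorohod space of càdlàg functions $\mathbb{R}^+=[0,\infty)\to\mathbb{R}$. $\mathcal{AC}$ is the set of absolutely continuous curves $\gamma:\mathbb{R}^+\to\mathbb{R}$: for every $T\ge 0$ there is $g\in L^1[0,T]$ with $\gamma(t)=\gamma(0)+\int_0^t g(s)\,\mathrm{d}s$ for $t\in[0,T]$; one writes $\dot\gamma=g$. For random variables $X_1,X_2,\dots$ on a Polish space $F$, a function $I:F\to[0,\infty]$ is a good rate function if $\{x : I(x)\le c\}$ is compact for every $c\ge 0$. The sequence $\{X_n\}$ satisfies the large deviation principle with speed (rate) $r(n)$ and good rate function $I$ if for every closed $A\subseteq F$, $\limsup_{n} \frac{1}{r(n)}\log \mathbb{P}[X_n\in A]\le -\inf_{x\in A} I(x)$, and for every open $U\subseteq F$, $\liminf_{n} \frac{1}{r(n)}\log \mathbb{P}[X_n\in U]\ge -\inf_{x\in U} I(x)$. The rate function $I_0$ is a good rate function in this sense. *)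

(* Defs.v *)
From HB Require Import structures.
From mathcomp Require Import all_boot all_order all_algebra.
From mathcomp Require Import all_classical all_reals all_analysis.

Set Implicit Arguments.
Unset Strict Implicit.
Unset Printing Implicit Defensive.

Import Order.TTheory GRing.Theory Num.Theory.
Import numFieldNormedType.Exports.

Local Open Scope classical_set_scope.
Local Open Scope ring_scope.

Section Skorohod.
Variable R : realType.

(* A path on [0, +oo[ is represented by its extension to the whole line that
   is constant on ]-oo, 0], so that equality of paths is Leibniz equality.
   For such an extension, being cadlag on the line and being cadlag on
   [0, +oo[ are the same thing. *)
Definition is_cadlag (x : R -> R) :=
  [/\ forall t, x s @[s --> t^'+] --> x t,
      forall t, cvg (x s @[s --> t^'-])
    & forall t, t < 0 -> x t = x 0].

Record skorohod := Skorohod {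
  path_of :> R -> R;
  path_cadlag : is_cadlag path_of }.

HB.instance Definition _ := gen_eqMixin skorohod.
HB.instance Definition _ := gen_choiceMixin skorohod.

(* Strictly increasing bijections of [0, +oo[; they are automatically
   continuous. *)
Definition time_change (lam : R -> R) :=
  {in `[0, +oo[ &, {homo lam : s t / s < t}} /\
  lam @` `[0, +oo[ = `[0, +oo[%classic.

Definition skorohod_nbhd (x : skorohod) (T e : R) : set skorohod :=
  [set y | exists lam : R -> R,
    [/\ time_change lam,
        forall t, 0 <= t -> `|lam t - t| < e
      & forall t, 0 <= t <= T -> `|y (lam t) - x t| < e]].

(* Skorohod's J1 topology.  The sets [skorohod_nbhd x T e] form a base of
   neighbourhoods of x for a metrizable topology, in which x_n converges to x
   iff there are time changes lam_n with sup_(t >= 0) |lam_n t - t| --> 0 and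
   sup_(t <= T) |x_n (lam_n t) - x t| --> 0 for every T; cf. Jacod-Shiryaev,
   Theorem VI.1.14, and Ethier-Kurtz, Proposition 3.5.3. *)
Definition skorohod_open (A : set skorohod) :=
  forall x, A x -> exists T e : R, 0 < e /\ skorohod_nbhd x T e `<=` A.

Lemma skorohod_nbhdS (x : skorohod) (T T' e e' : R) :
  T' <= T -> e <= e' -> skorohod_nbhd x T e `<=` skorohod_nbhd x T' e'.
Proof.
move=> TT ee y [lam [lamP lam1 lam2]]; exists lam; split=> //.
  by move=> t t0; apply: lt_le_trans (lam1 t t0) ee.
move=> t /andP[t0 tT]; apply: lt_le_trans (lam2 t _) ee.
by rewrite t0 (le_trans tT).
Qed.

Lemma skorohod_openT : skorohod_open setT.
Proof. by move=> x _; exists 0, 1; split. Qed.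

Lemma skorohod_openI : setI_closed skorohod_open.
Proof.
move=> A B oA oB x [/oA[T [e [e0 sA]]] /oB[T' [e' [e'0 sB]]]].
exists (Num.max T T'), (Num.min e e'); split; first by rewrite lt_min e0.
move=> y xy; split; [apply: sA|apply: sB]; apply: skorohod_nbhdS xy.
- by rewrite le_max lexx.
- by rewrite ge_min lexx.
- by rewrite le_max lexx orbT.
- by rewrite ge_min lexx orbT.
Qed.

Lemma skorohod_open_bigcup (I : Type) (f : I -> set skorohod) :
  (forall i, skorohod_open (f i)) -> skorohod_open (\bigcup_i f i).
Proof.
move=> fo x [i _ /fo[T [e [e0 sf]]]]; exists T, e; split=> // y /sf fy.
by exists i.
Qed.

HB.instance Definition _ := isOpenTopological.Build skorohod
  skorohod_openT skorohod_openI skorohod_open_bigcup.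

Lemma rescale_cadlag (b : R) (x : skorohod) :
  is_cadlag (fun t => b * x (b ^+ 2 * t)).
Proof.
case: x => x [xr xl x0] /=.
have [->|b0] := eqVneq b 0.
  have -> : (fun t => 0 * x (0 ^+ 2 * t)) = cst 0.
    by apply/funext => t; rewrite mul0r.
  by split=> // t; [exact: cvg_cst|exact: is_cvg_cst].
have b2 : 0 < b ^+ 2 by rewrite exprn_even_gt0.
have cl t : (b ^+ 2 * s) @[s --> t] --> b ^+ 2 * t.
  by apply: cvgM; [exact: cvg_cst|exact: cvg_id].
have cr t : (b ^+ 2 * s) @[s --> t^'+] --> (b ^+ 2 * t)^'+.
  move=> A /cl; rewrite /nbhs /= /at_right /within /=.
  by apply: (@filterS _ (nbhs t)) => s /= + ts; apply; rewrite ltr_pM2l.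
have cll t : (b ^+ 2 * s) @[s --> t^'-] --> (b ^+ 2 * t)^'-.
  move=> A /cl; rewrite /nbhs /= /at_left /within /=.
  by apply: (@filterS _ (nbhs t)) => s /= + ts; apply; rewrite ltr_pM2l.
split=> t.
- apply: cvgM; first exact: cvg_cst.
  exact: (cvg_comp _ _ (cr t) (xr _)).
- have /cvg_ex[l xl'] := xl (b ^+ 2 * t).
  apply/cvg_ex; exists (b * l).
  apply: cvgM; first exact: cvg_cst.
  exact: (cvg_comp _ _ (cll t) xl').
- by move=> t0; rewrite mulr0 x0 // pmulr_rlt0.
Qed.

Definition rescale (b : R) (x : skorohod) : skorohod :=
  Skorohod (rescale_cadlag b x).

End Skorohod.

Section LargeDeviations.
Variables (R : realType) (T : topologicalType).
Local Open Scope ereal_scope.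

Definition good_rate_function (I : T -> \bar R) :=
  (forall x, 0 <= I x) /\
  (forall c : R, (0 <= c)%R -> compact [set x | I x <= c%:E]).

(* The variables X_1, X_2, ... may live on different probability spaces; the
   index 0 plays no role. *)
Definition LDP (d : nat -> measure_display)
    (Omega : forall n, measurableType (d n))
    (P : forall n, probability (Omega n) R)
    (X : forall n, Omega n -> T) (r : nat -> R) (I : T -> \bar R) :=
  [/\ forall n, (0 < n)%N ->
        forall B, <<s @open T >> B -> measurable (X n @^-1` B),
      forall A, closed A ->
        limn_esup (fun n => (r n)^-1%:E * lne (P n (X n @^-1` A)))
          <= - ereal_inf [set I x | x in A]
    & forall U, open U ->
        - ereal_inf [set I x | x in U]
          <= limn_einf (fun n => (r n)^-1%:E * lne (P n (X n @^-1` U)))].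

End LargeDeviations.

Section Markov.
Variables (R : realType) (E : seq R).

Definition transition_operator (p : R -> R -> R -> R)
    (t : R) (f : R -> R) (x : R) : R :=
  \sum_(y <- E) p t x y * f y.

Definition transition_function (p : R -> R -> R -> R) :=
  [/\ forall t x y, 0 <= t -> x \in E -> y \in E -> 0 <= p t x y,
      forall t x, 0 <= t -> x \in E -> \sum_(y <- E) p t x y = 1,
      forall x y, x \in E -> y \in E -> p 0 x y = (x == y)%:R
    & forall s t x z, 0 <= s -> 0 <= t -> x \in E -> z \in E ->
        p (s + t) x z = \sum_(y <- E) p s x y * p t y z].

Definition has_generator (p : R -> R -> R -> R)
    (A : (R -> R) -> R -> R) :=
  forall f x, x \in E ->
    h^-1 * (transition_operator p h f x - f x) @[h --> 0^'+] --> A f x.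

Section process.
Variables (d : measure_display) (Omega : measurableType d).
Variables (P : probability Omega R) (X : Omega -> skorohod R).

Definition natural_filtration (s : R) : set_system Omega :=
  <<s \bigcup_(u in `[0, s]) preimage_set_system setT (X ^~ u) measurable >>.

(* The last clause says that
   E[f (X_(s+t)) | F_s] = (transition_operator p t f) (X_s). *)
Definition markov_process (p : R -> R -> R -> R) :=
  [/\ forall t, 0 <= t -> measurable_fun setT (X ^~ t),
      forall w t, 0 <= t -> X w t \in E
    & forall s t f B, 0 <= s -> 0 <= t -> natural_filtration s B ->
        \int[P]_(w in B) f (X w (s + t)) =
        \int[P]_(w in B) transition_operator p t f (X w s)].

Definition markov_process_with_generator (A : (R -> R) -> R -> R) :=
  exists p, [/\ transition_function p, has_generator p A & markov_process p].

End process.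
End Markov.

Section CurieWeiss.
Variable R : realType.

Definition cw_state (n : nat) : seq R :=
  [seq -1 + 2 * k%:R / n%:R | k <- iota 0 n.+1].

(* On [cw_state n] the rates vanish whenever x + 2 / n or x - 2 / n is not a
   state. *)
Definition cw_generator (n : nat) (f : R -> R) (x : R) : R :=
  n%:R * ((1 - x) / 2) * expR x * (f (x + 2 / n%:R) - f x) +
  n%:R * ((1 + x) / 2) * expR (- x) * (f (x - 2 / n%:R) - f x).

Definition lagrangian (x v : R) : R :=
  8^-1 * `|v + 2 / 3 * x ^+ 3| ^+ 2.

End CurieWeiss.

Section Rate.
Variable R : realType.
Notation mu := (@lebesgue_measure R).

Definition is_velocity (gamma g : R -> R) (T : R) :=
  mu.-integrable `[0, T] (EFin \o g) /\
  forall t, 0 <= t <= T -> gamma t = gamma 0 + \int[mu]_(s in `[0, t]) g s.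

Definition AC (gamma : R -> R) :=
  forall T, 0 <= T -> exists g, is_velocity gamma g T.

(* For gamma in AC such a g exists and is unique up to a null set on
   [0, +oo[; outside AC the value is irrelevant. *)
Definition velocity (gamma : R -> R) : R -> R :=
  xget (cst 0) [set g | forall T, 0 <= T -> is_velocity gamma g T].

Definition cw_rate (I0 : R -> \bar R) (gamma : skorohod R) : \bar R :=
  if `[< AC gamma >] then
    (I0 (gamma 0%R) + \int[mu]_(s in `[0%R, +oo[)
      (lagrangian (gamma s) (velocity gamma s))%:E)%E
  else +oo%E.

End Rate.

(* Main.v *)
Require Import Defs.
From HB Require Import structures.
From mathcomp Require Import all_boot all_order all_algebra.
From mathcomp Require Import all_classical all_reals all_analysis.
From mathcomp Require Import measurable_realfun ring lra.

(* Write X = b m(b^2 .) and r = n / b^4.  Expanding the square,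
     L(x, v) = v^2 / 8 + x^3 v / 6 + x^6 / 18,
   and the cross term is an exact differential, so that
     int_0^T L = (x_T^4 - x_0^4) / 24 + int_0^T (v^2 / 8 + x^6 / 18).
   Accordingly the tilts exp (r (a x + x^4 / 24)) satisfy, over a short time h
   and with an error that is small uniformly on compacts,
     E_x exp (r (a X_h + X_h^4 / 24)) ~
       exp (r (a x + x^4 / 24) + r h (2 a^2 - x^6 / 18)),
   which is read off the generator by a Taylor expansion.  Multiplied along the
   skeleton at times i h, with h -> 0 by right continuity, they give for the
   upper bound containment (a = 0), control of the oscillation on dyadic cells,
   and a bound on the probability that the discretised action on a dyadic grid
   is large (optimising over a on each cell); for the lower bound they give the
   change of measure that keeps X in a tube around a polygonal line.

   Call a set of paths negligible at level s when its probability is at most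
   exp (- r s'), eventually, for every s' < s.  If a closed set on which the
   rate exceeds s were not negligible at level s, there would be an ultrafilter
   containing it and the complements of all negligible sets.  By containment and
   the oscillation bound such an ultrafilter converges, locally uniformly, to a
   continuous path; its dyadic actions are at most s - I0(x_0), hence it is
   absolutely continuous (the slopes on dyadic cells form an L^2-bounded
   martingale) and its rate is at most s, a contradiction.  The same limit
   argument shows that the sublevel sets of the rate are compact.

   A Skorohod-open set is measurable because a cadlag path is the Skorohod limit
   of the step functions that sample it on the grids {i / q}, and each of these
   takes finitely many values up to a given time. *)

Set Implicit Arguments.
Unset Strict Implicit.
Unset Printing Implicit Defensive.

Import Order.TTheory GRing.Theory Num.Theory.
Import numFieldNormedType.Exports.

Local Open Scope classical_set_scope.
Local Open Scope ring_scope.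

(** * Markov chains on a finite state space *)

(** The limiting Hamiltonian is [H(x, p) = 2 p^2 - (2/3) x^3 p]; its drift is cubic because the
    linear parts of the two jump rates cancel at the critical temperature. At [p = a + x^3 / 6], the
    derivative of the tilt, it equals [2 a^2 - x^6 / 18]: the part depending on [a] is free of [x],
    so the Legendre transform [sup_a (a v - 2 a^2) = v^2 / 8], attained at [a = v / 4], can be taken
    on a whole dyadic cell with [a] frozen. A relative error [exp (r h eps)] per step accumulates
    over [T / h] steps to [exp (r T eps)], whatever [h] is. Hence [n] is fixed before [h] tends to
    0, and nothing has to be uniform in both. Events about all times are monotone limits of events
    on refining dyadic skeletons. The starting point is random, so a level [s] has to be divided
    between the start and the motion: on an interval where [I0 > a], the start already costs [a] and
    the discretised action only has to account for [s - a]. Letting [a] tend to [I0 (x_0)] after the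
    passage to the limit yields the full rate. *)

Lemma le_natr_bool (R : numDomainType) (b c : bool) :
  (b -> c) -> b%:R <= c%:R :> R.
Proof. by case: b c => -[] // /(_ isT). Qed.

Section Chain.
Variables (R : realType) (E : seq R) (k : R -> R -> R).
Hypothesis k_ge0 : forall x y, x \in E -> y \in E -> 0 <= k x y.

(** Expectation of a functional of the whole trajectory, starting point included, for a kernel of
    arbitrary mass. Peeling off the first step lets inductions shift time-dependent data by one. *)
Fixpoint chainE (N : nat) (Phi : seq R -> R) (x : R) : R :=
  if N is N'.+1 then \sum_(y <- E) k x y * chainE N' (fun s => Phi (x :: s)) y
  else Phi [:: x].

Lemma chainE_le N (Phi Psi : seq R -> R) x : x \in E ->
  (forall s, {subset s <= E} -> head 0 s = x -> size s = N.+1 -> Phi s <= Psi s) ->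
  chainE N Phi x <= chainE N Psi x.
Proof.
elim: N Phi Psi x => [|N IH] Phi Psi x xE le_PP /=.
  by apply: le_PP => // y; rewrite inE => /eqP ->.
rewrite big_seq [leRHS]big_seq; apply: ler_sum => y yE.
apply: ler_wpM2l; first exact: k_ge0.
apply: IH => // s sE _ ss; apply: le_PP => //=; last by rewrite ss.
by move=> z; rewrite inE => /predU1P[->//|/sE].
Qed.

Lemma chainE_scale N c (Phi : seq R -> R) x :
  chainE N (fun s => c * Phi s) x = c * chainE N Phi x.
Proof.
elim: N Phi x => [//|N IH] Phi x /=.
rewrite mulr_sumr; apply: eq_bigr => y _.
by rewrite IH mulrCA.
Qed.

(** The partial products form a nonnegative supermartingale started at 1. *)
Lemma chainE_prod (w : nat -> R -> R -> R) N x : x \in E ->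
  (forall l y z, 0 <= w l y z) ->
  (forall l y, (l < N)%N -> y \in E -> \sum_(z <- E) k y z * w l y z <= 1) ->
  chainE N (fun s => \prod_(l < N) w l s`_l s`_l.+1) x <= 1.
Proof.
move=> xE + +; elim: N w x xE => [|N IH] w x xE w0 w1 /=; first by rewrite big_ord0.
apply: le_trans (w1 0%N x _ xE) => //.
rewrite big_seq [leRHS]big_seq; apply: ler_sum => y yE.
apply: ler_wpM2l; first exact: k_ge0.
apply: (@le_trans _ _ (chainE N (fun s => w 0%N x y *
    \prod_(l < N) w l.+1 s`_l s`_l.+1) y)).
  apply: chainE_le => // s _ sy _.
  by rewrite big_ord_recl /= nth0 sy.
rewrite chainE_scale ler_piMr ?w0 //.
by apply: (IH (fun l => w l.+1)) => // l z lN; exact: w1.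
Qed.

(* [V] is a supersolution up to the exit time of [G]. *)
Lemma chainE_exit (G : nat -> R -> bool) (V : nat -> R -> R) N x : x \in E ->
  (forall l y, 0 <= V l y) ->
  (forall l y, ~~ G l y -> 1 <= V l y) ->
  (forall l y, (l < N)%N -> y \in E -> G l y ->
     \sum_(z <- E) k y z * V l.+1 z <= V l y) ->
  (forall y, y \in E -> \sum_(z <- E) k y z <= 1) ->
  chainE N (fun s => (~~ [forall l : 'I_N.+1, G l s`_l])%:R) x <= V 0%N x.
Proof.
move=> xE + + + k1; elim: N G V x xE => [|N IH] G V x xE V0 V1 VG.
  rewrite /=; case: forallP => [//|/= nG]; apply: V1; apply/negP => Gx.
  by apply: nG => i; rewrite ord1.
have IHy y : y \in E -> chainE N
    (fun s => (~~ [forall l : 'I_N.+1, G l.+1 s`_l])%:R) y <= V 1%N y.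
  move=> yE; apply: (IH (fun l => G l.+1) (fun l => V l.+1)) => //.
  - by move=> l z; exact: V1.
  - by move=> l z lN; exact: VG.
have [Gx|nGx] := boolP (G 0%N x); last first.
  apply: le_trans (V1 0%N _ nGx).
  apply: (@le_trans _ _ (\sum_(y <- E) k x y * 1)); last first.
    by under eq_bigr do rewrite mulr1; exact: k1.
  rewrite /= big_seq [leRHS]big_seq; apply: ler_sum => y yE.
  apply: ler_wpM2l; first exact: k_ge0.
  have -> : (1 : R) = chainE 0 (fun=> 1) x by [].
  have : forall n z, z \in E -> chainE n (fun=> 1) z <= 1.
    elim=> [//|n IHn] z zE /=.
    apply: le_trans (k1 _ zE); rewrite big_seq [leRHS]big_seq.
    by apply: ler_sum => t tE; rewrite ler_piMr ?k_ge0// IHn.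
  move=> /(_ N y yE); apply: le_trans; apply: chainE_le => // s _ _ _.
  by rewrite lern1 leq_b1.
apply: le_trans (VG 0%N _ _ xE Gx) => //.
rewrite /= big_seq [leRHS]big_seq; apply: ler_sum => y yE.
apply: ler_wpM2l; first exact: k_ge0.
apply: le_trans (IHy _ yE); apply: chainE_le => // s _ _ _.
apply: le_natr_bool; apply: contra => /forallP /= Gs; apply/forallP => -[[|l] lN] //=.
exact: (Gs (Ordinal (lN : l < N.+1)%N)).
Qed.

(** Read [k * w] as the kernel after a change of measure. Inside the tube each step keeps at least
    the fraction [q] of the mass, and the supersolution [V] dominates the mass that ever leaves; the
    difference is the mass that stays. *)
Lemma chainE_tube (G : nat -> R -> bool) (w : nat -> R -> R -> R)
    (V : nat -> R -> R) (q : R) N x : x \in E ->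
  0 <= q <= 1 ->
  (forall l y, 0 <= V l y) -> (forall l y z, 0 <= w l y z) ->
  (forall l y, ~~ G l y -> 1 <= V l y) ->
  (forall l y, (l < N)%N -> y \in E -> G l y ->
     \sum_(z <- E) k y z * w l y z * V l.+1 z <= V l y) ->
  (forall l y, (l < N)%N -> y \in E -> G l y ->
     q <= \sum_(z <- E) k y z * w l y z) ->
  q ^+ N - V 0%N x <=
  chainE N (fun s => (\prod_(l < N) w l s`_l s`_l.+1) *
                     [forall l : 'I_N.+1, G l s`_l]%:R) x.
Proof.
move=> xE /andP[q0 q1]; elim: N G w V x xE => [|N IH] G w V x xE V0 w0 V1 VG qG.
  rewrite /= big_ord0 mul1r expr0; case: forallP => [_|/= nG].
    by rewrite gerBl.
  rewrite subr_le0; apply: V1; apply/negP => Gx.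
  by apply: nG => i; rewrite ord1.
have [Gx|nGx] := boolP (G 0%N x); last first.
  apply: (@le_trans _ _ 0); first by rewrite subr_le0 (le_trans _ (V1 _ _ nGx))// exprn_ile1.
  have -> : 0 = chainE N.+1 (fun=> 0 * 0) x by rewrite chainE_scale mul0r.
  apply: chainE_le => // s _ _ _; rewrite mul0r mulr_ge0 ?ler0n//.
  by apply: prodr_ge0.
have IHy y : y \in E -> q ^+ N - V 1%N y <= chainE N
    (fun s => (\prod_(l < N) w l.+1 s`_l s`_l.+1) *
      [forall l : 'I_N.+1, G l.+1 s`_l]%:R) y.
  move=> yE; apply: (IH (fun l => G l.+1) (fun l => w l.+1) (fun l => V l.+1)) => //.
  - by move=> l z; exact: V1.
  - by move=> l z lN; exact: VG.
  - by move=> l z lN; exact: qG.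
apply: (@le_trans _ _ (\sum_(y <- E) k x y * w 0%N x y * (q ^+ N - V 1%N y))).
  under eq_bigr do rewrite mulrBr.
  rewrite sumrB lerB//; last exact: (VG 0%N).
  by rewrite -mulr_suml exprS ler_wpM2r ?exprn_ge0//; exact: (qG 0%N).
rewrite /= big_seq [leRHS]big_seq; apply: ler_sum => y yE.
rewrite -mulrA; apply: ler_wpM2l; first exact: k_ge0.
apply: (@le_trans _ _ (w 0%N x y * chainE N
    (fun s => (\prod_(l < N) w l.+1 s`_l s`_l.+1) *
      [forall l : 'I_N.+1, G l.+1 s`_l]%:R) y)).
  by apply: ler_wpM2l => //; exact: IHy.
rewrite -chainE_scale; apply: chainE_le => // s _ sy _.
rewrite big_ord_recl /= nth0 sy -!mulrA ler_wpM2l// ler_wpM2l//.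
  by apply: prodr_ge0.
apply: le_natr_bool => /forallP /= Gs; apply/forallP => -[[|l] lN] //=.
exact: (Gs (Ordinal (lN : l < N.+1)%N)).
Qed.

End Chain.

(** * Real-valued probabilities and the law of a skeleton *)

Lemma sigma_algebraI (T : Type) (G : set_system T) (A B : set T) :
  <<s G >> A -> <<s G >> B -> <<s G >> (A `&` B).
Proof.
have /sigma_algebraP : sigma_algebra setT <<s G >> by exact: smallest_sigma_algebra.
by case=> // _ _ _; exact.
Qed.

Section Probability.
Variables (R : realType) (d : measure_display) (Omega : measurableType d).
Variable P : probability Omega R.

Definition pr (A : set Omega) : R := fine (P A).

Lemma prE A : measurable A -> P A = (pr A)%:E.
Proof. by move=> mA; rewrite /pr fineK// fin_num_measure. Qed.

Lemma pr_ge0 A : 0 <= pr A.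
Proof. by rewrite /pr fine_ge0. Qed.

Lemma pr_le A B : measurable A -> measurable B -> A `<=` B -> pr A <= pr B.
Proof.
by move=> mA mB AB; rewrite -lee_fin -!prE//; apply: le_measure; rewrite ?inE.
Qed.

Lemma pr_le1 A : measurable A -> pr A <= 1.
Proof. by move=> mA; rewrite -lee_fin -prE// probability_le1. Qed.

Lemma prU A B : measurable A -> measurable B -> A `&` B = set0 ->
  pr (A `|` B) = pr A + pr B.
Proof.
move=> mA mB AB; apply: EFin_inj.
by rewrite EFinD -!prE// ?measureU//; exact: measurableU.
Qed.

Lemma prU_le A B : measurable A -> measurable B -> pr (A `|` B) <= pr A + pr B.
Proof.
move=> mA mB; have -> : A `|` B = A `|` (B `\` A).
  apply/seteqP; split=> x; last by case=> [|[]]; [left|right].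
  by case=> [|Bx]; [left|have [|] := pselect (A x); [left|right]].
have mBA : measurable (B `\` A) by exact: measurableD.
rewrite prU// ?lerD2l; last by apply/seteqP; split=> // x [? []].
by apply: pr_le => // x [].
Qed.

Section Split.
Variables (f : Omega -> R) (S : set Omega).

Lemma measurable_split (s : seq R) :
  (forall x, x \in s -> measurable (S `&` [set w | f w = x])) ->
  measurable (S `&` [set w | f w \in s]).
Proof.
elim: s => [|x s IH] ms.
  rewrite (_ : _ `&` _ = set0); first exact: measurable0.
  by apply/seteqP; split=> // w [].
rewrite (_ : _ `&` _ = (S `&` [set w | f w = x]) `|` (S `&` [set w | f w \in s])).
  apply: measurableU; first by apply: ms; exact: mem_head.
  by apply: IH => y ys; apply: ms; rewrite inE ys orbT.
rewrite -setIUr; congr (_ `&` _); apply/seteqP; split=> w /=.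
  by rewrite inE => /predU1P.
by move=> H; rewrite inE; apply/predU1P.
Qed.

Lemma pr_split (s : seq R) : uniq s ->
  (forall x, x \in s -> measurable (S `&` [set w | f w = x])) ->
  pr (S `&` [set w | f w \in s]) =
  \sum_(x <- s) pr (S `&` [set w | f w = x]).
Proof.
elim: s => [_ _|x s IH /= /andP[xs us] ms].
  rewrite big_nil (_ : _ `&` _ = set0); first by rewrite /pr measure0.
  by apply/seteqP; split=> // w [].
have ms' y : y \in s -> measurable (S `&` [set w | f w = y]).
  by move=> ys; apply: ms; rewrite inE ys orbT.
rewrite big_cons -IH// -prU//.
- congr pr; rewrite -setIUr; congr (_ `&` _); apply/seteqP; split=> w /=.
    by rewrite inE => /predU1P.
  by move=> H; rewrite inE; apply/predU1P.
- by apply: ms; exact: mem_head.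
- exact: measurable_split.
- by apply/seteqP; split=> // w [[_ /= fx] [_ /=]]; rewrite fx (negbTE xs).
Qed.
End Split.

End Probability.

Section MarkovChain.
Variables (R : realType) (d : measure_display) (Omega : measurableType d).
Variables (P : probability Omega R) (X : Omega -> skorohod R).
Variables (E : seq R) (p : R -> R -> R -> R).
Hypothesis uE : uniq E.
Hypothesis p_trans : transition_function E p.
Hypothesis X_markov : markov_process E P X p.

Let Ft := natural_filtration X.

Lemma natural_filtration_measurable s B : Ft s B -> measurable B.
Proof.
have [mX _ _] := X_markov.
apply: smallest_sub; first exact: sigma_algebra_measurable.
move=> A [u /=]; rewrite in_itv/= => /andP[u0 _] [C mC <-].
by apply: mX.
Qed.

Lemma natural_filtrationS s t B : s <= t -> Ft s B -> Ft t B.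
Proof.
move=> st; apply: sub_sigma_algebra2 => A [u /= us Au]; exists u => //=.
by move: us; rewrite !in_itv/= => /andP[-> /le_trans]; apply.
Qed.

Lemma natural_filtration_eq s x : 0 <= s -> Ft s [set w | X w s = x].
Proof.
move=> s0; apply: sub_sigma_algebra; exists s; first by rewrite /= in_itv/= s0 lexx.
exists [set x]; first exact: measurable_set1.
by rewrite setTI.
Qed.

Lemma markov_step s t B x y : 0 <= s -> 0 <= t -> Ft s B -> x \in E -> y \in E ->
  pr P (B `&` [set w | X w s = x] `&` [set w | X w (s + t) = y]) =
  p t x y * pr P (B `&` [set w | X w s = x]).
Proof.
move=> s0 t0 FB xE yE; have [mX XE mk] := X_markov.
set B' := B `&` _.
have FB' : Ft s B' by apply: sigma_algebraI => //; exact: natural_filtration_eq.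
have mB' := natural_filtration_measurable FB'.
have mst : measurable [set w | X w (s + t) = y].
  apply: (@natural_filtration_measurable (s + t)).
  by apply: natural_filtration_eq; rewrite addr_ge0.
transitivity (\int[P]_(w in B') (\1_[set w | X w (s + t) = y] w : R)).
  rewrite /Rintegral; under eq_integral do rewrite -/(_ \o _).
  by rewrite integral_indic//; rewrite setIC.
transitivity (\int[P]_(w in B') ((X w (s + t) == y)%:R : R)).
  apply: eq_Rintegral => w _; rewrite indicE.
  suff -> : (w \in [set w | X w (s + t) = y]) = (X w (s + t) == y) by [].
  by apply/idP/eqP; rewrite inE.
rewrite (mk s t (fun z => (z == y)%:R) B' s0 t0 FB') -Rintegral_cst//; 
  apply: eq_Rintegral => w; rewrite inE => -[_ /= ->].
rewrite /transition_operator (bigD1_seq y)//= eqxx mulr1 big1 ?addr0// => z zy.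
by rewrite (negbTE zy) mulr0.
Qed.

Definition skeleton s h N w := [seq X w (s + l%:R * h) | l <- iota 0 N.+1].

Lemma skeletonS s h N w :
  skeleton s h N.+1 w = X w s :: skeleton (s + h) h N w.
Proof.
rewrite /skeleton /= mul0r addr0; congr (_ :: _).
rewrite !addr0 mul1r; congr (_ :: _).
rewrite -[2%N]/(1 + 1)%N iotaDl -map_comp; apply: eq_map => l /=.
by rewrite -addrA natrD mulrDl mul1r.
Qed.

Lemma nth_skeleton s h N w l : (l <= N)%N ->
  (skeleton s h N w)`_l = X w (s + l%:R * h).
Proof.
by move=> lN; rewrite (nth_map 0%N) ?size_iota// nth_iota.
Qed.

Lemma measurable_eqX s x : 0 <= s -> measurable [set w | X w s = x].
Proof. by move=> s0; apply: natural_filtration_measurable; exact: natural_filtration_eq. Qed.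

(** The past event [B] is what closes the induction: after one step it becomes [B] together with
    [X_s = x], an event of the past of [s + h]. Measurability is carried along because each event is
    a finite union over the values of [X_s], for arbitrary [Phi]. *)
Lemma skeleton_law N s h B (Phi : pred (seq R)) : 0 <= s -> 0 <= h -> Ft s B ->
  measurable (B `&` [set w | Phi (skeleton s h N w)]) /\
  pr P (B `&` [set w | Phi (skeleton s h N w)]) =
  \sum_(x <- E) pr P (B `&` [set w | X w s = x]) *
     chainE E (p h) N (fun s => (Phi s)%:R) x.
Proof.
move=> s0 h0; elim: N s B Phi s0 => [|N IH] s B Phi s0 FB;
  have [mX XE mk] := X_markov; set S := B `&` _.
  have SE : S = S `&` [set w | X w s \in E].
    by apply/seteqP; split=> w //=; [move=> Sw; split=> //; exact: XE|case].
  have mS x : x \in E -> measurable (S `&` [set w | X w s = x]) /\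
      pr P (S `&` [set w | X w s = x]) =
      pr P (B `&` [set w | X w s = x]) * (Phi [:: x])%:R.
    move=> xE; have [Px|nPx] := boolP (Phi [:: x]).
      rewrite (_ : S `&` _ = B `&` [set w | X w s = x]).
        rewrite mulr1; split=> //; apply: measurableI; last exact: measurable_eqX.
        exact: natural_filtration_measurable FB.
      apply/seteqP; split=> w [].
        by move=> [].
      by move=> Bw /= Xw; do !split => //; rewrite /skeleton /= mul0r addr0 Xw.
    rewrite mulr0 (_ : S `&` _ = set0) ?/pr ?measure0//.
    apply/seteqP; split=> // w [[_ /=]]; rewrite /skeleton /= mul0r addr0 => + Xw.
    by rewrite Xw (negbTE nPx).
  split; first by rewrite SE; apply: measurable_split => x /mS[].
  rewrite SE pr_split//; last by move=> x /mS[].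
  by apply: eq_big_seq => x /mS[].
have SE : S = S `&` [set w | X w s \in E].
  by apply/seteqP; split=> w //=; [move=> Sw; split=> //; exact: XE|case].
have mS x : x \in E -> measurable (S `&` [set w | X w s = x]) /\
    pr P (S `&` [set w | X w s = x]) =
    pr P (B `&` [set w | X w s = x]) * chainE E (p h) N.+1 (fun s => (Phi s)%:R) x.
  move=> xE; set Bx := B `&` [set w | X w s = x].
  have FBx : Ft s Bx by apply: sigma_algebraI => //; exact: natural_filtration_eq.
  rewrite (_ : S `&` _ = Bx `&` [set w | Phi (x :: skeleton (s + h) h N w)]); last first.
    apply/seteqP; split=> w.
      by move=> [[Bw /=]]; rewrite skeletonS => + xw; rewrite xw.
    by move=> [[Bw /= xw] Pw]; do !split => //=; rewrite skeletonS xw.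
  have := IH (s + h) Bx (fun r => Phi (x :: r)) (addr_ge0 s0 h0).
  move=> /(_ (natural_filtrationS _ FBx)) []; first by rewrite lerDl.
  move=> mSx ->; split=> //; rewrite /= mulr_sumr.
  by apply: eq_big_seq => y yE; rewrite markov_step// mulrCA mulrA.
split; first by rewrite SE; apply: measurable_split => x /mS[].
rewrite SE pr_split//; last by move=> x /mS[].
by apply: eq_big_seq => x /mS[].
Qed.

End MarkovChain.

(** * Exponential martingales of the rescaled generator *)

Lemma normM_le (R : realDomainType) (x y a c : R) :
  `|x| <= a -> `|y| <= c -> `|x * y| <= a * c.
Proof. by move=> xa yc; rewrite normrM ler_pM. Qed.

Lemma normD_le (R : realDomainType) (x y a c : R) :
  `|x| <= a -> `|y| <= c -> `|x + y| <= a + c.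
Proof. by move=> xa yc; rewrite (le_trans (ler_normD _ _))// lerD. Qed.

Lemma normX_le (R : realDomainType) (x a : R) n :
  `|x| <= a -> `|x ^+ n| <= a ^+ n.
Proof. by move=> xa; rewrite normrX lerXn2r// nnegrE ?(le_trans _ xa). Qed.

Section Exponential.
Variable R : realType.
Implicit Types x u : R.

(** The tail of the series is dominated by a geometric one, since [(n + 4)! >= 2 ^ n.+1]. *)
Lemma expR_taylor3 x : `|x| <= 1 ->
  `|expR x - (1 + x + x ^+ 2 / 2 + x ^+ 3 / 6)| <= x ^+ 4.
Proof.
move=> x1; set q := (X in `|_ - X|).
have x40 : 0 <= x ^+ 4 by rewrite exprn_even_ge0.
have partial n : `|series (exp_coeff x) (n + 4)%N - q| <= x ^+ 4 * (1 - 2^-1 ^+ n).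
  elim: n => [|n IH].
    rewrite /series /= !big_nat_recl//= big_nil /exp_coeff /= /q.
    rewrite [X in `|X|](_ : _ = 0) ?normr0; last first.
      by rewrite !factS fact0 !expr0 !expr1 /=; field.
    by rewrite expr0 subrr mulr0.
  rewrite addSn /series /= big_nat_recr//= -/(series _ _) addrAC.
  apply: le_trans (ler_normD _ _) _.
  apply: le_trans (lerD IH (_ : _ <= x ^+ 4 * 2^-1 ^+ n.+1)) _.
    rewrite /exp_coeff /= normrM normrX addnC exprD -mulrA.
    have -> : `|x| ^+ 4 = x ^+ 4 by rewrite -normrX ger0_norm.
    rewrite ler_wpM2l// -[leRHS]mul1r ler_pM// ?exprn_ile1//.
    rewrite ger0_norm ?invr_ge0// exprVn lef_pV2 ?posrE ?ltr0n ?fact_gt0//.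
      rewrite -natrX ler_nat addnC.
      elim: n {IH} => [//|n IH]; by rewrite addSn factS expnS leq_mul// addn4.
  rewrite -mulrDr ler_wpM2l// exprS; have : 0 <= 2^-1 ^+ n :> R by rewrite exprn_ge0.
  lra.
have cv : `|series (exp_coeff x) n - q| @[n --> \oo] --> `|expR x - q|.
  apply: cvg_norm; apply: cvgB; last exact: cvg_cst.
  exact: is_cvg_series_exp_coeff.
rewrite -(cvg_lim _ cv)//; apply: limr_le; first by apply/cvg_ex; eexists; exact: cv.
near=> n; have [n4 _] : (4 <= n)%N /\ True by split=> //; near: n; exact: nbhs_infty_ge.
rewrite -(subnK n4) (le_trans (partial _))// ler_piMr// gerBl exprn_ge0//.
Unshelve. all: by end_near. Qed.

Lemma expR_taylor2 x : `|x| <= 1 ->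
  `|expR x - 1 - x - x ^+ 2 / 2| <= 2 * `|x| ^+ 3.
Proof.
move=> x1; have := expR_taylor3 x1.
have -> : x ^+ 4 = `|x| ^+ 4 by rewrite -normrX ger0_norm// exprn_even_ge0.
move=> t3; have -> : expR x - 1 - x - x ^+ 2 / 2 =
  (expR x - (1 + x + x ^+ 2 / 2 + x ^+ 3 / 6)) + x ^+ 3 * 6^-1 by field.
apply: le_trans (normD_le t3 (normM_le (normX_le _ (lexx `|x|)) (lexx _))) _.
rewrite (ger0_norm (_ : 0 <= 6^-1))// exprS.
have := exprn_ge0 3 (normr_ge0 x); set z := _ ^+ 3; nra.
Qed.

Lemma expR_le_quad x : `|x| <= 1 -> expR x <= 1 + x + 3 * x ^+ 2.
Proof.
move=> x1; have := expR_taylor2 x1; rewrite ler_norml => /andP[_].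
have -> : `|x| ^+ 3 = `|x| * x ^+ 2 by rewrite exprS real_normK// num_real.
have := sqr_ge0 x; set y := x ^+ 2; set e := expR x => y0.
have : `|x| * y <= y by rewrite ler_piMl.
lra.
Qed.

(** Used at [u = x / b] for upward jumps and at [- u] for downward ones. The absence of a linear
    term is criticality; the two rates differ by [- 2 u^3 / 3] to leading order, which is the origin
    of the cubic drift. *)
Lemma rate_expansion u : `|u| <= 1 ->
  `|(1 - u) * expR u - (1 - u ^+ 2 / 2 - u ^+ 3 / 3)| <= 3 * u ^+ 4.
Proof.
move=> u1; have t3 := expR_taylor3 u1.
set e := expR u in t3 *.
have -> : (1 - u) * e - (1 - u ^+ 2 / 2 - u ^+ 3 / 3) =
  (1 - u) * (e - (1 + u + u ^+ 2 / 2 + u ^+ 3 / 6)) + - 6^-1 * u ^+ 4 by field.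
have u2 : `|1 - u| <= 2 by move: u1; rewrite !ler_norml => /andP[? ?]; apply/andP; split; lra.
have u40 : 0 <= u ^+ 4 by rewrite exprn_even_ge0.
apply: le_trans (normD_le (normM_le u2 t3) (normM_le (lexx _) (lexx _))) _.
rewrite normrN (ger0_norm (_ : 0 <= 6^-1))// (ger0_norm u40); lra.
Qed.

(** Effect of one jump on the exponential of the tilt: [s] is the direction, [P] the derivative of
    the tilt, [rho] the rest of its increment, [t] stands for [1 / b] and [kap] for [b^4 / n]. The
    error is compared with [t ^+ 6] because the generator carries the factor [t ^- 6]. *)
Lemma expR_perturb (P s t rho C Q kap : R) :
  `|s| = 1 -> 0 < t <= 1 -> 0 <= kap <= 1 -> 0 <= C ->
  `|P| <= Q -> `|rho| <= C * kap * t ^+ 6 -> (2 * Q + C) * t ^+ 3 <= 1 ->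
  `|expR (2 * P * s * t ^+ 3 + rho) - 1 - (2 * P * s * t ^+ 3 + 2 * P ^+ 2 * t ^+ 6)|
   <= t ^+ 6 * ((C * (1 + 2 * (2 * Q + C)) + 2 * (2 * Q + C) ^+ 3) * (kap + t)).
Proof.
move=> s1 /andP[t0 t1] /andP[k0 k1] C0 PQ rhoC D1.
set D := 2 * Q + C in D1 *; set z := 2 * P * s * t ^+ 3.
have Q0 : 0 <= Q by rewrite (le_trans _ PQ).
have D0 : 0 <= D by rewrite /D; lra.
have t3 : 0 <= t ^+ 3 by rewrite exprn_ge0// ltW.
have t6 : 0 <= t ^+ 6 by rewrite exprn_ge0// ltW.
have te1 n : t ^+ n <= 1 by apply: exprn_ile1 => //; exact: ltW.
have t31 : t ^+ 3 <= t by rewrite exprS ler_piMr// ltW.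
have t63 : t ^+ 6 = t ^+ 3 * t ^+ 3 by rewrite -exprD.
have zQ : `|z| <= 2 * Q * t ^+ 3.
  rewrite /z 3!normrM s1 mulr1 (ger0_norm t3) ler_wpM2r//.
  by rewrite (ger0_norm (_ : 0 <= 2))// ler_wpM2l.
have rho3 : `|rho| <= C * t ^+ 3.
  apply: le_trans rhoC _; rewrite -mulrA ler_wpM2l// t63 mulrA ler_piMl//.
  by rewrite mulr_ile1.
have AD : `|z + rho| <= D * t ^+ 3.
  by apply: le_trans (normD_le zQ rho3) _; rewrite -mulrDl.
have A1 : `|z + rho| <= 1 by apply: le_trans D1.
have zz : z ^+ 2 = 4 * P ^+ 2 * t ^+ 6.
  have s2 : s ^+ 2 = 1 by rewrite -real_normK ?num_real// s1 expr1n.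
  by rewrite /z t63 !exprMn s2 mulr1; ring.
have -> : expR (z + rho) - 1 - (z + 2 * P ^+ 2 * t ^+ 6) =
  (expR (z + rho) - 1 - (z + rho) - (z + rho) ^+ 2 / 2) +
  (rho + rho * (z + rho + z) * 2^-1).
  have -> : 2 * P ^+ 2 * t ^+ 6 = z ^+ 2 / 2 by rewrite zz; field.
  by field.
have AzD : `|z + rho + z| <= 2 * D * t ^+ 3.
  apply: le_trans (normD_le AD zQ) _; rewrite -mulrDl ler_wpM2r// /D; lra.
apply: le_trans (normD_le (expR_taylor2 A1)
  (normD_le rhoC (normM_le (normM_le rhoC AzD) (lexx `|2^-1|)))) _.
rewrite (ger0_norm (_ : 0 <= 2^-1))//.
have A3 : `|z + rho| ^+ 3 <= D ^+ 3 * (t * t ^+ 6).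
  apply: (@le_trans _ _ ((D * t ^+ 3) ^+ 3)).
    by rewrite -normrX; exact: normX_le.
  rewrite exprMn ler_wpM2l ?exprn_ge0// -exprM -exprS.
  by rewrite (exprD t 7 2) ler_piMr// ?exprn_ge0 ?exprn_ile1// ltW.
have : C * kap * t ^+ 6 * (2 * D * t ^+ 3) * 2^-1 <= C * kap * t ^+ 6 * D.
  rewrite -mulrA ler_wpM2l//; first by rewrite mulr_ge0// mulr_ge0.
  have : t ^+ 3 <= 1 by rewrite (le_trans t31).
  have := mulr_ge0 D0 t3; nra.
set T6 := t ^+ 6 in t6 A3 *; set D3 := D ^+ 3 in A3 *; move=> h1.
have CT : 0 <= C * T6 by rewrite mulr_ge0.
have DT : 0 <= D3 * T6 by rewrite mulr_ge0// exprn_ge0.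
have CDT : 0 <= C * T6 * D by rewrite mulr_ge0.
have := mulr_ge0 CT (ltW t0); have := mulr_ge0 CDT k0; have := mulr_ge0 CDT (ltW t0).
have := mulr_ge0 DT k0.
set e3 := `|z + rho| ^+ 3 in A3 *; nra.
Qed.

End Exponential.

Section Generator.
Variable R : realType.

(* [x^4 / 24] is a primitive of the coefficient [x^3 / 6] of [v] in
   [lagrangian x v = v^2 / 8 + x^3 v / 6 + x^6 / 18]; with this tilt the limiting
   Hamiltonian is [2 a^2 - x^6 / 18], quadratic in [a] with a constant
   coefficient. *)
Definition tilt (a x : R) := a * x + x ^+ 4 / 24.

Lemma tilt_increment (a x s t kap : R) : s ^+ 2 = 1 -> kap != 0 ->
  kap^-1 * (tilt a (x + s * (2 * kap * t ^+ 3)) - tilt a x) =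
  2 * (a + x ^+ 3 / 6) * s * t ^+ 3 +
  (6 * x ^+ 2 + 4 * x * s * (2 * kap * t ^+ 3) + (2 * kap * t ^+ 3) ^+ 2) / 6
  * kap * t ^+ 6.
Proof.
move=> s2 k0; rewrite /tilt; set d := 2 * kap * t ^+ 3.
have s3 : s ^+ 3 = s by rewrite exprS s2 mulr1.
have s4 : s ^+ 4 = 1 by rewrite (exprM s 2 2) s2 expr1n.
have -> : a * (x + s * d) + (x + s * d) ^+ 4 / 24 - (a * x + x ^+ 4 / 24) =
  (a + x ^+ 3 / 6) * s * d +
  (6 * x ^+ 2 * s ^+ 2 + 4 * x * s ^+ 3 * d + s ^+ 4 * d ^+ 2) / 24 * d ^+ 2 by field.
by rewrite s2 s3 s4 /d; field.
Qed.

(** With [P = a + x^3 / 6], the second-order term of the exponential contributes [2 P^2] and the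
    asymmetry of the rates [- (2/3) x^3 P]; their sum is [2 a^2 - x^6 / 18]. The terms of order
    [t ^+ 3] cancel between the two directions. *)
Lemma generator_expansion (K A : R) : 0 <= K -> 0 <= A ->
  exists M t0 : R, [/\ 0 <= M, 0 < t0 &
  forall t kap a x, 0 < t <= t0 -> 0 < kap <= 2^-1 -> `|a| <= A -> `|x| <= K ->
  `|t ^- 6 * ((1 - x * t) / 2 * expR (x * t) *
       (expR (kap^-1 * (tilt a (x + 2 * kap * t ^+ 3) - tilt a x)) - 1) +
     (1 + x * t) / 2 * expR (- (x * t)) *
       (expR (kap^-1 * (tilt a (x - 2 * kap * t ^+ 3) - tilt a x)) - 1))
   - (2 * a ^+ 2 - x ^+ 6 / 18)| <= M * (kap + t)].
Proof.
move=> K0 A0; pose Q := A + K ^+ 3; pose C := 6 * K ^+ 2 + 4 * K + 1.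
have K20 : 0 <= K ^+ 2 by rewrite exprn_ge0.
have K30 : 0 <= K ^+ 3 by rewrite exprn_ge0.
have K40 : 0 <= K ^+ 4 by rewrite exprn_ge0.
have Q0 : 0 <= Q by rewrite addr_ge0.
have C0 : 0 <= C by rewrite /C; lra.
pose D := 2 * Q + C.
have D0 : 0 <= D by rewrite /D; lra.
pose Er := C * (1 + 2 * D) + 2 * D ^+ 3.
have Er0 : 0 <= Er by rewrite /Er addr_ge0// mulr_ge0// ?exprn_ge0//; lra.
exists (5 * Er + 6 * K ^+ 4 * Q + 6 * K ^+ 4 * Q ^+ 2 + K ^+ 2 * Q ^+ 2).
exists (1 + K + D)^-1; split.
- by rewrite !addr_ge0// !mulr_ge0// ?exprn_ge0.
- by rewrite invr_gt0; lra.
move=> t kap a x /andP[t0 tD] /andP[k0 k12] aA xK.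
have tD' : t * (1 + K + D) <= 1 by rewrite -ler_pdivlMr ?div1r//; lra.
have t1 : t <= 1 by nra.
have te n : 0 <= t ^+ n by rewrite exprn_ge0// ltW.
have te1 n : t ^+ n <= 1 by apply: exprn_ile1 => //; exact: ltW.
have tK : K * t <= 1 by nra.
have tD3 : D * t ^+ 3 <= 1.
  have : t ^+ 3 <= t by rewrite exprS ler_piMr// ltW.
  by nra.
pose P := a + x ^+ 3 / 6.
have PQ : `|P| <= Q.
  apply: normD_le => //; apply: (@le_trans _ _ (K ^+ 3 * 6^-1)); last by lra.
  by apply: normM_le; [exact: normX_le|rewrite ger0_norm].
have PQ2 : `|P ^+ 2| <= Q ^+ 2 by exact: normX_le.
pose rho s := (6 * x ^+ 2 + 4 * x * s * (2 * kap * t ^+ 3) +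
  (2 * kap * t ^+ 3) ^+ 2) / 6 * kap * t ^+ 6.
have d01 : `|2 * kap * t ^+ 3| <= 1.
  have h : 0 <= 2 * kap by lra.
  by rewrite ger0_norm; [apply: mulr_ile1 => //; lra|exact: mulr_ge0].
have rhoC s : `|s| = 1 -> `|rho s| <= C * kap * t ^+ 6.
  move=> s1; rewrite /rho 2!normrM (ger0_norm (te 6)) (ger0_norm (ltW k0)).
  rewrite ler_wpM2r// ler_wpM2r ?(ltW k0)//.
  have h1 : `|6 * x ^+ 2| <= 6 * K ^+ 2.
    by apply: normM_le; [rewrite ger0_norm|exact: normX_le].
  have h2 : `|4 * x * s * (2 * kap * t ^+ 3)| <= 4 * K * 1 * 1.
    apply: normM_le => //; apply: normM_le; last by rewrite s1.
    by apply: normM_le => //; rewrite ger0_norm.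
  have h3 : `|(2 * kap * t ^+ 3) ^+ 2| <= 1 ^+ 2 by exact: normX_le.
  apply: le_trans (normM_le (normD_le (normD_le h1 h2) h3) (lexx _)) _.
  rewrite (ger0_norm (_ : 0 <= 6^-1))// /C expr1n; lra.
have kap1 : 0 <= kap <= 1 by apply/andP; split; lra.
have eB s : `|s| = 1 -> `|expR (2 * P * s * t ^+ 3 + rho s) - 1 -
   (2 * P * s * t ^+ 3 + 2 * P ^+ 2 * t ^+ 6)| <= t ^+ 6 * (Er * (kap + t)).
  by move=> s1; apply: expR_perturb => //; [rewrite t0|exact: rhoC].
have -> : x + 2 * kap * t ^+ 3 = x + 1 * (2 * kap * t ^+ 3) by rewrite mul1r.
have -> : x - 2 * kap * t ^+ 3 = x + (-1) * (2 * kap * t ^+ 3) by rewrite mulN1r.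
rewrite !tilt_increment ?expr1n ?sqrrN ?expr1n ?gt_eqF// -/P -/(rho 1) -/(rho (-1)).
have e1B := eB 1 (normr1 _); have e2B := eB (-1) (normrN1 _).
set u := x * t.
have uKt : `|u| <= K * t by apply: normM_le => //; rewrite ger0_norm// ltW.
have u1 : `|u| <= 1 by apply: le_trans tK.
have uN1 : `|- u| <= 1 by rewrite normrN.
have u4 : u ^+ 4 <= K ^+ 4 * t ^+ 4.
  by rewrite -exprMn -[leLHS]ger0_norm ?exprn_even_ge0//; exact: normX_le.
have f1B := rate_expansion u1; have f2B := rate_expansion uN1.
set e1 := _ - _ in e1B; set e2 := _ - _ in e2B.
set f1 := _ - _ in f1B; set f2 := _ - _ in f2B.
pose r1 := (1 - u) * expR u; pose r2 := (1 - - u) * expR (- u).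
have f1B' : `|f1| <= 3 * (K ^+ 4 * t ^+ 4) by apply: le_trans f1B _; lra.
have f2B' : `|f2| <= 3 * (K ^+ 4 * t ^+ 4).
  by apply: le_trans f2B _; rewrite -[(- u) ^+ 4]/((- u) ^+ (2 * 2)) exprM sqrrN -exprM; lra.
have u2B : `|u ^+ 2| <= K ^+ 2 * t ^+ 2 by rewrite -exprMn; exact: normX_le.
have u21 : `|u ^+ 2| <= 1 by rewrite normrX exprn_ile1.
have u31 : `|u ^+ 3| <= 1 by rewrite normrX exprn_ile1.
have u41 : u ^+ 4 <= 1.
  by rewrite -[leLHS]ger0_norm ?exprn_even_ge0// normrX exprn_ile1.
have uN4 : (- u) ^+ 4 = u ^+ 4 by ring.
have uN3 : (- u) ^+ 3 = - u ^+ 3 by ring.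
have r1B : `|r1| <= 5.
  move: f1B u21 u31; rewrite /f1 -/r1 !ler_norml => /andP[? ?] /andP[? ?] /andP[? ?].
  by apply/andP; split; lra.
have r2B : `|r2| <= 5.
  move: f2B u21 u31; rewrite /f2 -/r2 sqrrN uN3 uN4 !ler_norml.
  move=> /andP[? ?] /andP[? ?] /andP[? ?].
  by apply/andP; split; lra.
(* Here [e1], [e2] are the errors of the two exponentials and [f1], [f2] those of the two rates. The
   identity is exact: it uses [r1 - r2 = - 2 u^3 / 3 + f1 - f2] and
   [r1 + r2 = 2 - u^2 + f1 + f2]. *)
rewrite [X in `|X|](_ : _ = t ^- 6 * ((r1 * e1 + r2 * e2) * 2^-1 +
   (f1 + - f2) * (P * t ^+ 3) + (f1 + f2 + - u ^+ 2) * (P ^+ 2 * t ^+ 6))); last first.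
  rewrite /e1 /e2 /f1 /f2 /r1 /r2.
  move: (expR (_ + rho 1)) (expR (_ + rho (-1))) (expR u) (expR (- u)) => G1 G2 G3 G4.
  have tn0 : t != 0 by rewrite gt_eqF.
  by rewrite /P /u; field.
rewrite normrM ger0_norm ?invr_ge0// mulrC ler_pdivrMr ?exprn_gt0//.
apply: le_trans (normD_le (normD_le (normM_le (normD_le (normM_le r1B e1B)
   (normM_le r2B e2B)) (lexx _)) (normM_le (normD_le f1B' (_ : `|- f2| <= _))
   (normM_le PQ (lexx _)))) (normM_le (normD_le (normD_le f1B' f2B') (_ : `|- u ^+ 2| <= _))
   (normM_le PQ2 (lexx _)))) _.
- by rewrite normrN; exact: f2B'.
- by rewrite normrN; exact: u2B.
rewrite (ger0_norm (te 3)) (ger0_norm (te 6)) (ger0_norm (_ : 0 <= 2^-1))//.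
have t7 : t ^+ 4 * t ^+ 3 = t * t ^+ 6 by rewrite -exprD -exprS.
have t4 : t ^+ 4 <= t by rewrite exprS ler_piMr// ltW.
have t2 : t ^+ 2 <= t by rewrite exprS ler_piMr// ltW.
have -> : 3 * (K ^+ 4 * t ^+ 4) + 3 * (K ^+ 4 * t ^+ 4) = 6 * K ^+ 4 * t ^+ 4 by ring.
have -> : 6 * K ^+ 4 * t ^+ 4 * (Q * t ^+ 3) = 6 * K ^+ 4 * Q * t * t ^+ 6.
  by rewrite -(mulrA (6 * K ^+ 4)) (mulrCA (t ^+ 4)) t7; ring.
have -> : (5 * (t ^+ 6 * (Er * (kap + t))) + 5 * (t ^+ 6 * (Er * (kap + t)))) / 2 =
  5 * Er * (kap + t) * t ^+ 6 by field.
rewrite mulrA -!mulrDl ler_wpM2r// (mulrDl (6 * K ^+ 4 * t ^+ 4)).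
have Q2 : 0 <= Q ^+ 2 by rewrite exprn_ge0.
have h1 : 6 * K ^+ 4 * t ^+ 4 * Q ^+ 2 <= 6 * K ^+ 4 * Q ^+ 2 * t.
  by rewrite mulrAC ler_wpM2l// !mulr_ge0.
have h2 : K ^+ 2 * t ^+ 2 * Q ^+ 2 <= K ^+ 2 * Q ^+ 2 * t.
  by rewrite mulrAC ler_wpM2l// mulr_ge0.
have h3 : 0 <= 6 * K ^+ 4 * Q ^+ 2 * kap by rewrite !mulr_ge0// ltW.
have h4 : 0 <= K ^+ 2 * Q ^+ 2 * kap by rewrite !mulr_ge0// ltW.
have h5 : 0 <= 6 * K ^+ 4 * Q * kap by rewrite !mulr_ge0// ltW.
lra.
Qed.

End Generator.

Lemma near_all_seq (T : eqType) (U : Type) (F : set_system U) (FF : Filter F)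
    (s : seq T) (Q : T -> U -> Prop) :
  (forall x, x \in s -> \forall u \near F, Q x u) ->
  \forall u \near F, forall x, x \in s -> Q x u.
Proof.
elim: s => [_|x s IH Qs]; first by apply: nearW.
have Q1 := Qs x (mem_head _ _).
have Q2 : \forall u \near F, forall x, x \in s -> Q x u.
  by apply: IH => y ys; apply: Qs; rewrite inE ys orbT.
by apply: filterS2 Q1 Q2 => u Qx Qu y; rewrite inE => /predU1P[->//|/Qu].
Qed.

Section OneStep.
Variable R : realType.

(** Turns a derivative at 0 into multiplicative bounds, the form that can be iterated along a
    skeleton. *)
Lemma expR_cone (S : R -> R) (L c1 c2 : R) : c1 < L < c2 ->
  h^-1 * (S h - 1) @[h --> 0^'+] --> L ->
  \forall h \near 0^'+, expR (c1 * h) <= S h <= expR (c2 * h).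
Proof.
move=> /andP[c1L Lc2] cv.
have c1m : c1 < (c1 + L) / 2 by rewrite midf_lt.
have mL : (c1 + L) / 2 < L by rewrite midf_lt.
set m := (c1 + L) / 2 in c1m mL.
(* The first bound on [h] gives [|c1 h| <= 1], so that [expR_le_quad] applies; the second makes its
   quadratic term [3 c1^2 h^2] smaller than the slack [(m - c1) h]. *)
pose e := Num.min (`|c1| + 1)^-1 ((m - c1) / (3 * (c1 ^+ 2 + 1))).
have q0 : 0 < c1 ^+ 2 + 1 by rewrite ltr_wpDl ?sqr_ge0.
have e0 : 0 < e.
  by rewrite lt_min invr_gt0 ltr_wpDl//= divr_gt0 ?subr_gt0// mulr_gt0.
have near1 : \forall h \near 0^'+, m < h^-1 * (S h - 1) by exact: (cvgr_gt _ cv).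
have near2 : \forall h \near 0^'+, h^-1 * (S h - 1) < c2 by exact: (cvgr_lt _ cv).
near=> h; have h0 : 0 < h by near: h; exact: nbhs_right_gt.
have he : h < e by near: h; exact: nbhs_right_lt.
move: he; rewrite lt_min => /andP[h1 h2].
have : m < h^-1 * (S h - 1) by near: h.
have : h^-1 * (S h - 1) < c2 by near: h.
rewrite !(mulrC h^-1) ltr_pdivrMr// ltr_pdivlMr// => Sc2 Sm.
apply/andP; split; last first.
  by apply: le_trans (expR_ge1Dx _); lra.
have c1h : `|c1 * h| <= 1.
  rewrite normrM (gtr0_norm h0).
  have := h1; rewrite -[_^-1]mul1r ltr_pdivlMr ?ltr_wpDl//.
  have := normr_ge0 c1; nra.
apply: le_trans (expR_le_quad c1h) _.
move: h2; rewrite ltr_pdivlMr ?mulr_gt0// => h2.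
rewrite exprMn; have : 3 * (c1 ^+ 2 * h ^+ 2) <= (m - c1) * h.
  rewrite expr2 !mulrA ler_pM2r//; have := sqr_ge0 c1; nra.
lra.
Unshelve. all: by end_near. Qed.

Definition cw_kernel (b : R) (p : R -> R -> R -> R) (h x y : R) :=
  p (b ^+ 2 * h) (x / b) (y / b).

Definition cw_states n (b : R) := [seq b * e | e <- cw_state R n].

(** The range of [h] may depend on [n], while [K], [eps] and the finite list [S] of tilts are chosen
    beforehand. This is all that the later estimates know about the Curie-Weiss dynamics. *)
Definition one_step_bounds (E : nat -> seq R) (k : nat -> R -> R -> R -> R)
    (r : nat -> R) :=
  forall K eps : R, 0 < eps -> forall S : seq R,
  \forall n \near \oo, \forall h \near 0^'+, forall x, x \in E n -> `|x| <= K ->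
  forall a, a \in S ->
  expR (r n * h * (2 * a ^+ 2 - x ^+ 6 / 18 - eps)) <=
  \sum_(y <- E n) k n h x y * expR (r n * (tilt a y - tilt a x)) <=
  expR (r n * h * (2 * a ^+ 2 - x ^+ 6 / 18 + eps)).

(** The generator is applied to [F], the exponential of the tilt in the original coordinate. In the
    variables [t = 1 / b] and [kap = b^4 / n], a rescaled jump has size [2 b / n = 2 kap t^3], and
    the accelerated rate [n b^2] equals [r t ^- 6]. *)
Lemma cw_kernel_tilt_derive n (b : R) p x a : (0 < n)%N -> 0 < b ->
  has_generator (cw_state R n) p (@cw_generator R n) ->
  x \in cw_states n b ->
  let r := n%:R / b ^+ 4 in
  let kap := b ^+ 4 / n%:R in
  let t := b^-1 in
  h^-1 * (\sum_(y <- cw_states n b) cw_kernel b p h x y *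
      expR (r * (tilt a y - tilt a x)) - 1) @[h --> 0^'+] -->
  r * (t ^- 6 * ((1 - x * t) / 2 * expR (x * t) *
       (expR (kap^-1 * (tilt a (x + 2 * kap * t ^+ 3) - tilt a x)) - 1) +
     (1 + x * t) / 2 * expR (- (x * t)) *
       (expR (kap^-1 * (tilt a (x - 2 * kap * t ^+ 3) - tilt a x)) - 1))).
Proof.
move=> n0 b0 gen xE r kap t.
have bn0 : b != 0 by rewrite gt_eqF.
have nn0 : n%:R != 0 :> R by rewrite pnatr_eq0 gtn_eqF.
move: xE => /mapP[x0 x0E xb].
have x0b : x / b = x0 by rewrite xb mulrC mulKf.
pose F (z : R) := expR (r * (tilt a (b * z) - tilt a x)).
have F1 : F x0 = 1 by rewrite /F -xb subrr mulr0 expR0.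
have cb : (b ^+ 2 * h) @[h --> (0 : R)^'+] --> (0 : R)^'+.
  have c0 : (b ^+ 2 * h) @[h --> (0 : R)] --> (0 : R).
    by rewrite -[X in _ --> X](mulr0 (b ^+ 2)); apply: cvgM; [exact: cvg_cst|exact: cvg_id].
  move=> A /c0; rewrite /nbhs /= /at_right /within /=.
  by apply: (@filterS _ (nbhs (0:R))) => s /= + ts; apply; rewrite mulr_gt0// exprn_gt0.
have := cvg_comp _ _ cb (gen F x0 x0E).
move=> /(cvgM (cvg_cst (b ^+ 2))); rewrite F1.
have -> : b ^+ 2 * cw_generator n F x0 =
  r * (t ^- 6 * ((1 - x * t) / 2 * expR (x * t) *
       (expR (kap^-1 * (tilt a (x + 2 * kap * t ^+ 3) - tilt a x)) - 1) +
     (1 + x * t) / 2 * expR (- (x * t)) *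
       (expR (kap^-1 * (tilt a (x - 2 * kap * t ^+ 3) - tilt a x)) - 1))).
  rewrite /cw_generator F1 /F.
  have -> : b * (x0 + 2 / n%:R) = x + 2 * kap * t ^+ 3.
    by rewrite xb /kap /t; field; rewrite bn0 nn0.
  have -> : b * (x0 - 2 / n%:R) = x - 2 * kap * t ^+ 3.
    by rewrite xb /kap /t; field; rewrite bn0 nn0.
  have -> : kap^-1 = r by rewrite /kap /r invf_div.
  rewrite -x0b -/t.
  move: (expR (r * _)) (expR (r * _)) (expR (x * t)) (expR (- _)) => G1 G2 G3 G4.
  by rewrite /r /t; field; rewrite bn0.
apply: cvg_trans; apply: near_eq_cvg; near=> h.
have h0 : 0 < h by near: h; exact: nbhs_right_gt.
have hn0 : h != 0 by rewrite gt_eqF.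
have b2 : b ^+ 2 != 0 by rewrite expf_neq0.
rewrite /= invfM mulrA mulrA mulfV// mul1r /transition_operator /cw_states [in RHS]big_map.
congr (_ * (_ - 1)); apply: eq_bigr => y _.
by rewrite /cw_kernel x0b [b * y]mulrC mulfK// mulrC.
Unshelve. all: by end_near. Qed.

Lemma cw_one_step (p : nat -> R -> R -> R -> R) (b : nat -> R) :
  (forall n, (0 < n)%N -> has_generator (cw_state R n) (p n) (@cw_generator R n)) ->
  (forall n, (0 < n)%N -> 0 < b n) ->
  b n @[n --> \oo] --> +oo -> b n ^+ 4 / n%:R @[n --> \oo] --> (0 : R) ->
  one_step_bounds (fun n => cw_states n (b n)) (fun n => cw_kernel (b n) (p n))
    (fun n => n%:R / b n ^+ 4).
Proof.
move=> gen b0 binf b4 K eps eps0 S.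
pose A := \sum_(a <- S) `|a|.
have AS a : a \in S -> `|a| <= A.
  rewrite /A => /path.splitPr[s1 s2]; rewrite big_cat big_cons /=.
  by rewrite addrCA lerDl addr_ge0// sumr_ge0.
have A0 : 0 <= A by rewrite sumr_ge0.
have K0 : 0 <= Num.max K 0 by rewrite le_max lexx orbT.
have [M [t0 [M0 t00 exp]]] := generator_expansion K0 A0.
pose e := eps / (4 * (M + 1)).
have e0 : 0 < e by rewrite divr_gt0// mulr_gt0// ltr_wpDl.
near=> n.
have n0 : (0 < n)%N by near: n; exists 1%N.
have bn := b0 n n0.
have bt : (b n)^-1 <= Num.min t0 e.
  have : (Num.min t0 e)^-1 <= b n by near: n; exact: (cvgryPge _).1 binf _.
  by move=> h; rewrite -[leRHS]invrK lef_pV2 ?posrE ?invr_gt0 ?lt_min ?t00.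
have k0 : 0 < b n ^+ 4 / n%:R by rewrite divr_gt0 ?exprn_gt0 ?ltr0n.
have [kh ke] : b n ^+ 4 / n%:R < 2^-1 /\ b n ^+ 4 / n%:R < e.
  by split; near: n; apply: (cvgr_lt _ b4).
move: bt; rewrite le_min => /andP[bt be].
have : \forall h \near 0^'+, forall x, x \in cw_states n (b n) ->
    forall a, a \in S -> `|x| <= K ->
  expR (n%:R / b n ^+ 4 * h * (2 * a ^+ 2 - x ^+ 6 / 18 - eps)) <=
  \sum_(y <- cw_states n (b n)) cw_kernel (b n) (p n) h x y *
     expR (n%:R / b n ^+ 4 * (tilt a y - tilt a x)) <=
  expR (n%:R / b n ^+ 4 * h * (2 * a ^+ 2 - x ^+ 6 / 18 + eps)).
  (* For fixed [n] there are finitely many states and tilts, so the pointwise derivatives give one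
     range of [h] for all of them. *)
  apply: near_all_seq => x xE; apply: near_all_seq => a aS.
  have [xK|] := leP `|x| K; last by move=> _; apply: nearW.
  have r0 : 0 < n%:R / b n ^+ 4 by rewrite divr_gt0 ?exprn_gt0 ?ltr0n.
  have cv := cw_kernel_tilt_derive (a := a) n0 bn (gen n n0) xE.
  have xK' : `|x| <= Num.max K 0 by rewrite le_max xK.
  have := exp (b n)^-1 (b n ^+ 4 / n%:R) a x _ _ (AS a aS) xK'.
  rewrite invr_gt0 bn bt k0 (ltW kh) => /(_ isT isT).
  set G := _ ^- 6 * _ in cv *; set H := 2 * a ^+ 2 - _ => GH.
  have {}GH : `|G - H| < eps.
    apply: le_lt_trans GH _; apply: (@le_lt_trans _ _ (M * (e + e))).
      by rewrite ler_wpM2l// lerD// ltW.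
    rewrite /e -mulrDl -(mulr2n eps) -mulr_natr mulrA ltr_pdivrMr ?mulr_gt0 ?ltr_wpDl//.
    nra.
  move: GH; rewrite ltr_norml => /andP[GH1 GH2].
  set r := n%:R / b n ^+ 4 in r0 cv *.
  have cc : r * (H - eps) < r * G < r * (H + eps).
    by rewrite !ltr_pM2l//; apply/andP; split; lra.
  have := expR_cone cc cv; apply: filterS => h.
  by rewrite (mulrAC r h (H - _)) (mulrAC r h (H + _)) => hh _.
apply: filterS => h hh x xE xK a aS; exact: hh.
Unshelve. all: by end_near. Qed.

Lemma uniq_cw_states n (b : R) : (0 < n)%N -> 0 < b -> uniq (cw_states n b).
Proof.
move=> n0 b0; rewrite /cw_states /cw_state -map_comp map_inj_uniq ?iota_uniq//.
move=> i j /= /(mulfI (lt0r_neq0 b0)) /addrI.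
have nn0 : n%:R != 0 :> R by rewrite pnatr_eq0 gtn_eqF.
have n2 : 2 != 0 :> R by rewrite pnatr_eq0.
by move=> /(mulIf (invr_neq0 nn0)) /(mulfI n2) /eqP; rewrite eqr_nat => /eqP.
Qed.

Lemma cw_statesP n (b x : R) : b != 0 ->
  (x \in cw_states n b) = (x / b \in cw_state R n).
Proof.
move=> b0; have {1}-> : x = b * (x / b) by rewrite mulrC divfK.
by rewrite mem_map//; exact: mulfI.
Qed.

Lemma cw_kernel_transition n (b : R) p : 0 < b ->
  transition_function (cw_state R n) p ->
  transition_function (cw_states n b) (cw_kernel b p).
Proof.
move=> b0 [p0 p1 pid pC]; have bn0 := lt0r_neq0 b0.
have t0 t : 0 <= t -> 0 <= b ^+ 2 * t.
  by move=> t0; rewrite mulr_ge0// exprn_ge0// ltW.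
split=> [t x y|t x|x y|s t x z]; rewrite /cw_kernel.
- by rewrite !cw_statesP// => /t0; exact: p0.
- rewrite cw_statesP// => /t0 tt xE; rewrite big_map -[RHS](p1 _ _ tt xE).
  by apply: eq_bigr => y _; rewrite [b * y]mulrC mulfK.
- rewrite !cw_statesP// => xE yE; rewrite mulr0 pid//; congr (_%:R).
  by rewrite (inj_eq (mulIf (invr_neq0 bn0))).
- rewrite !cw_statesP// => /t0 ss /t0 tt xE zE; rewrite mulrDr pC// [RHS]big_map.
  by apply: eq_bigr => y _; rewrite [b * y]mulrC mulfK.
Qed.

Lemma cw_rescale_markov d (Omega : measurableType d) (P : probability Omega R)
    n (b : R) p (X : Omega -> skorohod R) : 0 < b ->
  markov_process (cw_state R n) P X p ->
  markov_process (cw_states n b) P (fun w => rescale b (X w)) (cw_kernel b p).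
Proof.
move=> b0 [mX XE mk]; have bn0 := lt0r_neq0 b0.
have t0 t : 0 <= t -> 0 <= b ^+ 2 * t.
  by move=> t0; rewrite mulr_ge0// exprn_ge0// ltW.
split=> [t /t0 tt|w t /t0 tt|s t f B /t0 ss /t0 tt FB] /=.
- by apply: measurable_funM => //; exact: mX.
- by rewrite cw_statesP// mulrC mulKf//; exact: XE.
- have FB' : natural_filtration X (b ^+ 2 * s) B.
    apply: (sub_sigma_algebra2 _ FB) => A [u /=]; rewrite in_itv/= => /andP[u0 us].
    move=> [C mC <-]; exists (b ^+ 2 * u).
      by rewrite /= in_itv/= t0//= ler_wpM2l// exprn_ge0// ltW.
    exists [set z | C (b * z)]; last by rewrite setTI.
    rewrite -[X in measurable X]setTI.
    have : measurable_fun setT (fun z : R => b * z) by apply: measurable_funM.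
    by apply.
  rewrite mulrDr (mk _ _ (fun z => f (b * z)) _ ss tt FB').
  apply: eq_Rintegral => w _; rewrite /transition_operator [RHS]big_map.
  have bK z : b * z / b = z by rewrite mulrC mulKf.
  by apply: eq_bigr => y _; rewrite /cw_kernel !bK.
Qed.

End OneStep.

(** * Exponential estimates for the skeleton chain *)

Section ChainEstimates.
Variables (R : realType) (E : seq R) (k : R -> R -> R).
Variables (r h eps K : R) (S : seq R).
Hypothesis k_ge0 : forall x y, x \in E -> y \in E -> 0 <= k x y.
Hypothesis k_sum1 : forall x, x \in E -> \sum_(y <- E) k x y = 1.
Hypothesis r_gt0 : 0 < r.
Hypothesis h_gt0 : 0 < h.
Hypothesis eps_ge0 : 0 <= eps.
Hypothesis k_tilt : forall x, x \in E -> `|x| <= K -> forall a, a \in S ->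
  expR (r * h * (2 * a ^+ 2 - x ^+ 6 / 18 - eps)) <=
  \sum_(y <- E) k x y * expR (r * (tilt a y - tilt a x)) <=
  expR (r * h * (2 * a ^+ 2 - x ^+ 6 / 18 + eps)).

Let x4_ge0 (x : R) : 0 <= x ^+ 4. Proof. by rewrite exprn_even_ge0. Qed.
Let x6_ge0 (x : R) : 0 <= x ^+ 6. Proof. by rewrite exprn_even_ge0. Qed.

Lemma tilt_sum_le (a c x : R) (f : R -> R) : x \in E -> `|x| <= K -> a \in S ->
  (forall y, f y = expR (c + r * (tilt a y - tilt a x))) ->
  \sum_(y <- E) k x y * f y <= expR (c + r * h * (2 * a ^+ 2 - x ^+ 6 / 18 + eps)).
Proof.
move=> xE xK aS fE; under eq_bigr do rewrite fE expRD mulrCA.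
rewrite -mulr_sumr expRD ler_wpM2l ?expR_ge0//.
by have /andP[] := k_tilt xE xK aS.
Qed.

(* The supersolution is [exp (r x^4 / 24)], the tilt with [a = 0]. *)
Lemma chain_containment N x0 : 0 \in S -> 0 <= K -> x0 \in E ->
  chainE E k N (fun s => (~~ [forall l : 'I_N.+1, `|s`_l| <= K])%:R) x0 <=
  expR (r * ((x0 ^+ 4 - K ^+ 4) / 24 + N%:R * h * eps)).
Proof.
move=> S0 K0 x0E.
pose V l (y : R) := expR (r * ((y ^+ 4 - K ^+ 4) / 24 + (N - l)%:R * h * eps)).
have := @chainE_exit R E k k_ge0 (fun _ y => `|y| <= K) V N x0 x0E.
rewrite [X in _ -> _ -> _ -> _ -> _ <= X]/V subn0; apply.
- by move=> l y; exact: expR_ge0.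
- move=> l y; rewrite -ltNge => Ky.
  rewrite /V -expR0 ler_expR mulr_ge0 ?(ltW r_gt0)// addr_ge0//; last first.
    by rewrite !mulr_ge0// ltW.
  rewrite divr_ge0// subr_ge0.
  have -> : y ^+ 4 = `|y| ^+ 4 by rewrite -normrX ger0_norm.
  by rewrite lerXn2r// ?nnegrE ?(le_trans K0)// ltW.
- move=> l y lN yE yK.
  have := @tilt_sum_le 0 (r * ((y ^+ 4 - K ^+ 4) / 24 + (N - l.+1)%:R * h * eps)) y
    (V l.+1) yE yK S0.
  move=> /(_ _)/le_trans; apply => [z|].
    by rewrite /V /tilt; congr expR; ring.
  rewrite /V ler_expR -(mulrA r h) -mulrDr ler_wpM2l// ?(ltW r_gt0)//.
  rewrite -(subnSK lN) -natr1 expr0n /=; have := x6_ge0 y.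
  move: (y ^+ 6) => y6 y60; have := mulr_ge0 (ltW h_gt0) y60; lra.
- by move=> y yE; rewrite k_sum1.
Qed.

(** Exponential Chebyshev bound at the exit time: the supersolution is the sum of the tilts [phi]
    and [- phi] centred at [x0], and at exit one of the two terms is at least 1. Each unit of time
    costs [2 phi^2 + eps], and [K0 ^+ 4 / 24] is the quartic part of the tilt at the start. *)
Lemma chain_oscillation N x0 phi delta K0 : phi \in S -> - phi \in S -> 0 <= phi ->
  0 <= delta -> `|x0| <= K0 -> K0 + delta <= K -> x0 \in E ->
  chainE E k N (fun s => (~~ [forall l : 'I_N.+1, `|s`_l - x0| <= delta])%:R) x0 <=
  2 * expR (r * (N%:R * h * (2 * phi ^+ 2 + eps) + K0 ^+ 4 / 24 - phi * delta)).
Proof.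
move=> Sp Sm phi0 delta0 x0K K0K x0E.
pose C l (y : R) := r * (y ^+ 4 / 24 + (N - l)%:R * h * (2 * phi ^+ 2 + eps) - phi * delta).
pose V l (y : R) := expR (C l y + r * phi * (y - x0)) + expR (C l y - r * phi * (y - x0)).
have V0 : V 0%N x0 <=
    2 * expR (r * (N%:R * h * (2 * phi ^+ 2 + eps) + K0 ^+ 4 / 24 - phi * delta)).
  rewrite /V subrr mulr0 addr0 subr0 -[X in X <= _]mulr2n -[X in X <= _]mulr_natl.
  rewrite ler_wpM2l// ler_expR.
  rewrite /C subn0 ler_wpM2l ?(ltW r_gt0)//.
  have : x0 ^+ 4 <= K0 ^+ 4 by rewrite -[leLHS]ger0_norm//; exact: normX_le.
  lra.
apply: le_trans V0.
have C0 l y : - (r * phi * delta) <= C l y.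
  have : 0 <= r * (y ^+ 4 / 24 + (N - l)%:R * h * (2 * phi ^+ 2 + eps)).
    rewrite mulr_ge0// ?(ltW r_gt0)// addr_ge0// ?divr_ge0// mulr_ge0//.
      by rewrite mulr_ge0// ltW.
    by rewrite addr_ge0// mulr_ge0// exprn_ge0.
  by rewrite /C; lra.
have rphi : 0 <= r * phi by rewrite mulr_ge0// ltW.
apply: (@chainE_exit R E k k_ge0 (fun _ y => `|y - x0| <= delta)) => //.
- by move=> l y; rewrite addr_ge0// expR_ge0.
- move=> l y; rewrite -ltNge => Ky; have := C0 l y.
  move: Ky; rewrite lter_normr => /orP[] yd Cl.
    apply: (@le_trans _ _ (expR (C l y + r * phi * (y - x0)))); last first.
      by rewrite lerDl expR_ge0.
    rewrite -expR0 ler_expR; have := ler_wpM2l rphi (ltW yd); lra.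
  apply: (@le_trans _ _ (expR (C l y - r * phi * (y - x0)))); last first.
    by rewrite lerDr expR_ge0.
  rewrite -expR0 ler_expR; have := ler_wpM2l rphi (ltW yd); lra.
- move=> l y lN yE yd.
  have yK : `|y| <= K.
    apply: le_trans K0K; rewrite -(subrK x0 y) (le_trans (ler_normD _ _))//.
    by rewrite addrC lerD.
  under eq_bigr do rewrite mulrDr.
  rewrite big_split /= /V; apply: lerD.
    have := @tilt_sum_le phi (C l.+1 y + r * phi * (y - x0)) y
      (fun z => expR (C l.+1 z + r * phi * (z - x0))) yE yK Sp.
    move=> /(_ _)/le_trans; apply => [z|]; first by rewrite /C /tilt; congr expR; ring.
    rewrite ler_expR /C -(subnSK lN) -natr1.
    have := mulr_ge0 (mulr_ge0 (ltW r_gt0) (ltW h_gt0)) (x6_ge0 y); lra.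
  have := @tilt_sum_le (- phi) (C l.+1 y - r * phi * (y - x0)) y
    (fun z => expR (C l.+1 z - r * phi * (z - x0))) yE yK Sm.
  move=> /(_ _)/le_trans; apply => [z|]; first by rewrite /C /tilt; congr expR; ring.
  rewrite ler_expR /C -(subnSK lN) -natr1 sqrrN.
  have := mulr_ge0 (mulr_ge0 (ltW r_gt0) (ltW h_gt0)) (x6_ge0 y); lra.
- by move=> y yE; rewrite k_sum1.
Qed.

(** Logarithmic increment of the exponential martingale with tilt [a], divided by [r]. *)
Definition step_action (a y z : R) :=
  tilt a z - tilt a y - h * (2 * a ^+ 2 - y ^+ 6 / 18).

(** Markov's inequality for the exponential martingale with a tilt prescribed at each step. *)
Lemma chain_action N (a : nat -> R) c x0 : x0 \in E ->
  (forall l, (l < N)%N -> a l \in S) ->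
  chainE E k N (fun s => [&& [forall l : 'I_N.+1, `|s`_l| <= K] &
     c <= \sum_(l < N) step_action (a l) s`_l s`_l.+1]%:R) x0 <=
  expR (- r * (c - N%:R * h * eps)).
Proof.
move=> x0E aS.
(* The one-step bounds hold only in the ball of radius [K]; the weight 0 outside keeps the
   supermartingale property and is invisible on the event considered. *)
pose w l (y z : R) := if `|y| <= K
  then expR (r * (step_action (a l) y z - h * eps)) else 0.
have w0 l y z : 0 <= w l y z by rewrite /w; case: ifP => // _; exact: expR_ge0.
have w1 l y : (l < N)%N -> y \in E -> \sum_(z <- E) k y z * w l y z <= 1.
  move=> lN yE; rewrite /w; have [yK|_] := boolP (`|y| <= K); last first.
    by rewrite big1// => z _; rewrite mulr0.
  have := @tilt_sum_le (a l) (- r * h * (2 * a l ^+ 2 - y ^+ 6 / 18 + eps)) y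
    (fun z => expR (r * (step_action (a l) y z - h * eps))) yE yK (aS _ lN).
  move=> /(_ _)/le_trans; apply => [z|].
    by rewrite /step_action; congr expR; ring.
  by rewrite -expR0 ler_expR; lra.
have := @chainE_prod R E k k_ge0 w N x0 x0E w0 w1.
rewrite -(ler_pM2l (expR_gt0 (- r * (c - N%:R * h * eps)))) mulr1.
apply: le_trans; rewrite -chainE_scale; apply: chainE_le => // s _ _ _.
case: (boolP ([forall l : 'I_N.+1, `|s`_l| <= K] && _)) => [/andP[/forallP sK cs]|_]; last first.
  by rewrite mulr_ge0 ?expR_ge0// prodr_ge0.
rewrite (eq_bigr (fun l : 'I_N => expR (r * (step_action (a l) s`_l s`_l.+1 - h * eps)))).
  rewrite -expR_sum -expRD -[X in X <= _]expR0 ler_expR -mulr_sumr sumrB.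
  rewrite sumr_const card_ord -[_ *+ N]mulr_natl.
  have := ler_wpM2l (ltW r_gt0) cs; lra.
by move=> l _; rewrite /w (sK (widen_ord (leqnSn N) l)).
Qed.

(** Tilting by [v / 4] produces the drift [v]. Exit from the tube is then controlled by the further
    tilts by [phi] and [- phi]: [2 (v/4 + phi)^2 - 2 (v/4)^2 = v phi + 2 phi^2], whose first term is
    cancelled by the motion of the centre [c]. The factor [exp (- r C)] undoes the change of measure
    on the tube. *)
Lemma chain_tube N (v c : nat -> R) phi delta C x0 : x0 \in E ->
  0 <= phi -> 0 <= delta ->
  (forall l, (l < N)%N -> [/\ v l / 4 \in S, v l / 4 + phi \in S,
     v l / 4 - phi \in S & c l.+1 = c l + h * v l]) ->
  (forall l, (l <= N)%N -> `|c l| + delta <= K) ->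
  (forall s : seq R, (forall l, (l <= N)%N -> `|s`_l - c l| <= delta) ->
    \sum_(l < N) step_action (v l / 4) s`_l s`_l.+1 <= C) ->
  expR (- r * C) * (expR (- r * (N%:R * h * eps)) -
    2 * expR (r * (N%:R * h * (2 * phi ^+ 2 + eps) + phi * `|x0 - c 0%N| - phi * delta))) <=
  chainE E k N (fun s => [forall l : 'I_N.+1, `|s`_l - c l| <= delta]%:R) x0.
Proof.
move=> x0E phi0 delta0 vS cK sC.
pose G l (y : R) := (l <= N)%N ==> (`|y - c l| <= delta).
pose D l := r * ((N - l)%:R * h * (2 * phi ^+ 2 + eps) - phi * delta).
pose V l (y : R) := expR (D l + r * phi * (y - c l)) + expR (D l - r * phi * (y - c l)).
pose w l (y z : R) := expR (r * step_action (v l / 4) y z).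
pose q := expR (- r * (h * eps)).
have rphi : 0 <= r * phi by rewrite mulr_ge0// ltW.
have V0 : V 0%N x0 <=
    2 * expR (r * (N%:R * h * (2 * phi ^+ 2 + eps) + phi * `|x0 - c 0%N| - phi * delta)).
  rewrite mulr_natl mulr2n /V /D subn0; apply: lerD; rewrite ler_expR.
    have := ler_wpM2l rphi (ler_norm (x0 - c 0%N)); lra.
  have := ler_wpM2l rphi (ler_norm (- (x0 - c 0%N))); rewrite normrN; lra.
have D0 l : - (r * phi * delta) <= D l.
  rewrite /D mulrBr -mulrA -[leLHS]add0r lerD2r mulr_ge0// ?(ltW r_gt0)// mulr_ge0//.
    by rewrite mulr_ge0// ltW.
  by rewrite addr_ge0// mulr_ge0// exprn_ge0.
have q01 : 0 <= q <= 1.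
  by rewrite /q expR_ge0/= -expR0 ler_expR mulNr oppr_le0 !mulr_ge0// ltW.
have GK l y : (l <= N)%N -> G l y -> `|y - c l| <= delta /\ `|y| <= K.
  move=> lN; rewrite /G lN /= => yc; split=> //; apply: le_trans (cK _ lN).
  by rewrite -(subrK (c l) y) (le_trans (ler_normD _ _))// addrC lerD2l.
rewrite -(ler_pM2l (expR_gt0 (r * C))) mulrA -expRD mulNr subrr expR0 mul1r.
apply: (@le_trans _ _ (q ^+ N - V 0%N x0)).
  apply: lerB => //; rewrite /q -expRM_natl ler_expR; lra.
apply: (@le_trans _ _ (chainE E k N (fun s => (\prod_(l < N) w l s`_l s`_l.+1) *
                     [forall l : 'I_N.+1, G l s`_l]%:R) x0)); last first.
  rewrite -chainE_scale; apply: chainE_le => // s _ _ _.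
  have [/forallP Gs|_] := boolP [forall l : 'I_N.+1, G l s`_l]; last first.
    by rewrite mulr0 mulr_ge0 ?expR_ge0.
  have Gs' l : (l <= N)%N -> `|s`_l - c l| <= delta.
    by move=> lN; have := Gs (Ordinal (lN : (l < N.+1)%N)); rewrite /G /= lN.
  rewrite (_ : [forall l : 'I_N.+1, _] = true) ?mulr1; last first.
    by apply/forallP => l; apply: Gs'; rewrite -ltnS.
  by rewrite -expR_sum ler_expR -mulr_sumr ler_wpM2l// ?(ltW r_gt0)//; exact: sC.
apply: chainE_tube => //.
- by move=> l y; rewrite addr_ge0// expR_ge0.
- by move=> l y z; exact: expR_ge0.
- move=> l y; rewrite negb_imply -ltNge => /andP[lN Ky]; have := D0 l.
  move: Ky; rewrite lter_normr => /orP[] yd Cl.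
    apply: (@le_trans _ _ (expR (D l + r * phi * (y - c l)))); last first.
      by rewrite lerDl expR_ge0.
    rewrite -expR0 ler_expR; have := ler_wpM2l rphi (ltW yd); lra.
  apply: (@le_trans _ _ (expR (D l - r * phi * (y - c l)))); last first.
    by rewrite lerDr expR_ge0.
  rewrite -expR0 ler_expR; have := ler_wpM2l rphi (ltW yd); lra.
- move=> l y lN yE Gl; have [yd yK] := GK _ _ (ltnW lN) Gl.
  have [Sv Sp Sm cS] := vS _ lN.
  under eq_bigr do rewrite -mulrA mulrDr mulrDr.
  rewrite big_split /= /V; apply: lerD.
    have := @tilt_sum_le (v l / 4 + phi)
      (- r * h * (2 * (v l / 4) ^+ 2 - y ^+ 6 / 18) + D l.+1 + r * phi * (y - c l.+1)) y
      (fun z => w l y z * expR (D l.+1 + r * phi * (z - c l.+1))) yE yK Sp.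
    move=> /(_ _)/le_trans; apply => [z|].
      by rewrite /w -expRD /step_action /tilt; congr expR; ring.
    rewrite ler_expR cS /D -(subnSK lN) -natr1; lra.
  have := @tilt_sum_le (v l / 4 - phi)
    (- r * h * (2 * (v l / 4) ^+ 2 - y ^+ 6 / 18) + D l.+1 - r * phi * (y - c l.+1)) y
    (fun z => w l y z * expR (D l.+1 - r * phi * (z - c l.+1))) yE yK Sm.
  move=> /(_ _)/le_trans; apply => [z|].
    by rewrite /w -expRD /step_action /tilt; congr expR; ring.
  rewrite ler_expR cS /D -(subnSK lN) -natr1; lra.
- move=> l y lN yE Gl; have [yd yK] := GK _ _ (ltnW lN) Gl.
  have [Sv _ _ _] := vS _ lN; have /andP[lo _] := k_tilt yE yK Sv.
  rewrite -(ler_pM2l (expR_gt0 (r * h * (2 * (v l / 4) ^+ 2 - y ^+ 6 / 18)))) mulr_sumr.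
  rewrite /q -expRD; apply: (le_trans _ (le_trans lo _)).
    by rewrite ler_expR; lra.
  apply: ler_sum => z _; rewrite mulrCA /w -expRD /step_action.
  rewrite le_eqVlt; apply/orP; left; apply/eqP; congr (_ * expR _); ring.
Qed.

End ChainEstimates.

(** * From the skeleton to the path *)

Section Dyadic.
Variable R : realType.

Lemma dyadic_step_small (T e : R) : 0 <= T -> 0 < e ->
  exists k0, forall k, (k0 <= k)%N -> T / 2 ^+ k < e.
Proof.
move=> T0 e0; exists (Num.truncn (T / e)).+1 => k mk.
rewrite ltr_pdivrMr ?exprn_gt0// mulrC -ltr_pdivrMr//.
apply: lt_trans (truncnS_gt _) _; rewrite -natrX ltr_nat.
by apply: leq_ltn_trans mk _; rewrite ltn_expl.
Qed.

Lemma right_lt_near (g : R -> R) t delta : g u @[u --> t^'+] --> g t ->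
  delta < g t -> exists2 e, 0 < e & forall u, t <= u < t + e -> delta < g u.
Proof.
move=> cg dg; have : \forall u \near t^'+, delta < g u by exact: (cvgr_gt _ cg).
rewrite /at_right /within /nbhs /= => -[e /= e0 He]; exists e => // u /andP[].
rewrite le_eqVlt => /predU1P[<- //|tu ute]; apply: He => //=.
by rewrite distrC ger0_norm; lra.
Qed.

(** A violation at [t] persists on an interval to the right of [t], which contains a point of every
    sufficiently fine grid. The endpoint [s + T] lies on the grids. *)
Lemma dyadic_right_continuous (g : R -> R) s T delta k0 : 0 < T ->
  (forall t, s <= t < s + T -> g u @[u --> t^'+] --> g t) ->
  (forall k l, (k0 <= k)%N -> (l <= 2 ^ k)%N ->
     g (s + l%:R * (T / 2 ^+ k)) <= delta) ->
  forall t, s <= t <= s + T -> g t <= delta.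
Proof.
move=> T0 cg gd t /andP[st]; rewrite le_eqVlt => /predU1P[->|tT].
  have := gd k0 (2 ^ k0)%N (leqnn _) (leqnn _).
  by rewrite natrX mulrC divfK// expf_neq0.
rewrite leNgt; apply/negP => dg.
have stT : s <= t < s + T by rewrite st.
have [e e0 He] := right_lt_near (cg _ stT) dg.
have me : 0 < Num.min e (s + T - t) by rewrite lt_min e0 subr_gt0.
have [k1 Hk1] := dyadic_step_small (ltW T0) me.
pose k := maxn k0 k1; have := Hk1 k (leq_maxr _ _).
set h := T / 2 ^+ k => hm.
have h0 : 0 < h by rewrite divr_gt0 ?exprn_gt0.
have sth : 0 <= (t - s) / h by rewrite divr_ge0 ?subr_ge0// ltW.
have /andP[l1 l2] := truncn_itv sth.
set l := Num.truncn _ in l1 l2.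
have {}l1 : l%:R * h <= t - s by rewrite -ler_pdivlMr.
have {}l2 : t - s < l.+1%:R * h by rewrite -ltr_pdivrMr.
move: hm; rewrite lt_min => /andP[he hT].
have u1 : l.+1%:R * h <= t - s + h by rewrite -natr1 mulrDl mul1r lerD2r.
have lk : (l.+1 <= 2 ^ k)%N.
  rewrite -(ler_nat R) natrX -(ler_pM2r h0).
  by rewrite [leRHS]mulrC divfK ?expf_neq0//; lra.
have := gd k l.+1 (leq_maxl _ _) lk; rewrite leNgt => /negP; apply.
by apply: He; apply/andP; split; rewrite -/h; lra.
Qed.

Lemma cadlag_normB_right (x : skorohod R) (c : R -> R) t :
  c u @[u --> t^'+] --> c t ->
  `|x u - c u| @[u --> t^'+] --> `|x t - c t|.
Proof.
move=> cc; apply: cvg_norm; apply: cvgB => //.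
by case: x => x [].
Qed.

End Dyadic.

Section Monotone.
Variables (R : realType) (d : measure_display) (Omega : measurableType d).
Variable P : probability Omega R.

Lemma pr_bigcup_le (F : nat -> set Omega) (M : R) k0 :
  (forall k, measurable (F k)) -> (forall m n, (m <= n)%N -> F m `<=` F n) ->
  (forall k, (k0 <= k)%N -> pr P (F k) <= M) ->
  pr P (\bigcup_k F k) <= M.
Proof.
move=> mF homF FM; have mU : measurable (\bigcup_k F k) by exact: bigcup_measurable.
rewrite -lee_fin -prE//.
have cv : (P \o F) n @[n --> \oo] --> P (\bigcup_k F k).
  by apply: nondecreasing_cvg_mu => // m n mn; apply/subsetPset; exact: homF.
rewrite -(cvg_lim _ cv)//; apply: lime_le; first by apply/cvg_ex; eexists; exact: cv.
near=> n; rewrite /= prE// lee_fin; apply: FM.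
by near: n; exact: nbhs_infty_ge.
Unshelve. all: by end_near. Qed.

Lemma pr_bigcap_ge (F : nat -> set Omega) (M : R) k0 :
  (forall k, measurable (F k)) -> (forall m n, (m <= n)%N -> F n `<=` F m) ->
  (forall k, (k0 <= k)%N -> M <= pr P (F k)) ->
  M <= pr P (\bigcap_k F k).
Proof.
move=> mF homF FM; have mU : measurable (\bigcap_k F k) by exact: bigcapT_measurable.
rewrite -lee_fin -prE//.
have cv : (P \o F) n @[n --> \oo] --> P (\bigcap_k F k).
  apply: nonincreasing_cvg_mu => //; last first.
    by move=> m n mn; apply/subsetPset; exact: homF.
  by rewrite (le_lt_trans (probability_le1 _ _))// ltry.
rewrite -(cvg_lim _ cv)//; apply: lime_ge; first by apply/cvg_ex; eexists; exact: cv.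
near=> n; rewrite /= prE// lee_fin; apply: FM.
by near: n; exact: nbhs_infty_ge.
Unshelve. all: by end_near. Qed.

End Monotone.

Section PathEstimates.
Variables (R : realType) (d : measure_display) (Omega : measurableType d).
Variables (P : probability Omega R) (X : Omega -> skorohod R).
Variables (E : seq R) (p : R -> R -> R -> R).
Hypothesis uE : uniq E.
Hypothesis p_trans : transition_function E p.
Hypothesis X_markov : markov_process E P X p.

Let p_ge0 h : 0 <= h -> forall x y, x \in E -> y \in E -> 0 <= p h x y.
Proof. by move=> h0 x y; case: p_trans => p0 _ _ _; exact: p0. Qed.

Let XE w t : 0 <= t -> X w t \in E.
Proof. by case: X_markov => _ + _; apply. Qed.

Lemma natural_filtration_preimage s (C : set R) : 0 <= s -> measurable C ->
  natural_filtration X s [set w | C (X w s)].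
Proof.
move=> s0 mC; apply: sub_sigma_algebra; exists s; first by rewrite /= in_itv/= s0 lexx.
by exists C => //; rewrite setTI.
Qed.

Lemma measurable_preimage s (C : set R) : 0 <= s -> measurable C ->
  measurable [set w | C (X w s)].
Proof.
by move=> s0 mC; exact: (natural_filtration_measurable X_markov
  (natural_filtration_preimage s0 mC)).
Qed.

Lemma measurable_skeleton s h N (C : set R) (Phi : pred (seq R)) :
  0 <= s -> 0 <= h -> measurable C ->
  measurable ([set w | C (X w s)] `&` [set w | Phi (skeleton X s h N w)]).
Proof.
move=> s0 h0 mC.
by have [] := skeleton_law uE X_markov N Phi s0 h0
  (natural_filtration_preimage s0 mC).
Qed.

Lemma pr_splitE s (C : set R) : 0 <= s -> measurable C ->
  pr P [set w | C (X w s)] =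
  \sum_(x <- E) pr P ([set w | C (X w s)] `&` [set w | X w s = x]).
Proof.
move=> s0 mC; rewrite -(pr_split P (f := fun w => X w s))//.
  by congr pr; apply/seteqP; split=> [w Cw|w []]//; split=> //; exact: XE.
move=> x _; apply: measurableI; first exact: measurable_preimage.
exact: (measurable_eqX X_markov).
Qed.

Lemma skeleton_le s h N (C : set R) (Phi : pred (seq R)) M : 0 <= s -> 0 <= h -> measurable C ->
  (forall x, x \in E -> C x -> chainE E (p h) N (fun q => (Phi q)%:R) x <= M) ->
  pr P ([set w | C (X w s)] `&` [set w | Phi (skeleton X s h N w)]) <=
  pr P [set w | C (X w s)] * M.
Proof.
move=> s0 h0 mC CM.
have [_ ->] := skeleton_law uE X_markov N Phi s0 h0
  (natural_filtration_preimage s0 mC).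
rewrite (pr_splitE s0 mC) mulr_suml big_seq [leRHS]big_seq.
apply: ler_sum => x xE; have [Cx|nCx] := pselect (C x).
  by apply: ler_wpM2l; [exact: pr_ge0|exact: CM].
rewrite (_ : _ `&` _ = set0) /pr ?measure0 ?mul0r//.
by apply/seteqP; split=> // w [/= + Xw]; rewrite Xw.
Qed.

Lemma skeleton_ge s h N (C : set R) (Phi : pred (seq R)) M : 0 <= s -> 0 <= h -> measurable C ->
  (forall x, x \in E -> C x -> M <= chainE E (p h) N (fun q => (Phi q)%:R) x) ->
  pr P [set w | C (X w s)] * M <=
  pr P ([set w | C (X w s)] `&` [set w | Phi (skeleton X s h N w)]).
Proof.
move=> s0 h0 mC CM.
have [_ ->] := skeleton_law uE X_markov N Phi s0 h0
  (natural_filtration_preimage s0 mC).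
rewrite (pr_splitE s0 mC) mulr_suml big_seq [leRHS]big_seq.
apply: ler_sum => x xE; have [Cx|nCx] := pselect (C x).
  by apply: ler_wpM2l; [exact: pr_ge0|exact: CM].
rewrite (_ : _ `&` _ = set0) /pr ?measure0 ?mul0r//.
by apply/seteqP; split=> // w [/= + Xw]; rewrite Xw.
Qed.

Lemma dyadic_refine m n l (T : R) : (m <= n)%N ->
  l%:R * (T / 2 ^+ m) = (l * 2 ^ (n - m))%:R * (T / 2 ^+ n).
Proof.
move=> mn; rewrite natrM natrX -{2}(subnKC mn) exprD; field.
by rewrite !expf_neq0.
Qed.

Lemma dyadic_refine_le m n l : (m <= n)%N -> (l <= 2 ^ m)%N ->
  (l * 2 ^ (n - m) <= 2 ^ n)%N.
Proof. by move=> mn lm; rewrite -{2}(subnKC mn) expnD leq_mul2r lm orbT. Qed.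

Section Event.
Variables (s T : R) (C : set R) (G : R -> R -> R -> bool).
Hypothesis s_ge0 : 0 <= s.
Hypothesis T_gt0 : 0 < T.
Hypothesis mC : measurable C.

Let step k := T / 2 ^+ k.
Let step_ge0 k : 0 <= step k. Proof. by rewrite divr_ge0 ?exprn_ge0// ltW. Qed.

Definition dyadic_pred k (q : seq R) :=
  [forall l : 'I_(2 ^ k).+1, G q`_0 (s + l%:R * step k) q`_l].

Lemma dyadic_predP k w : reflect
  (forall l, (l <= 2 ^ k)%N -> G (X w s) (s + l%:R * step k) (X w (s + l%:R * step k)))
  (dyadic_pred k (skeleton X s (step k) (2 ^ k) w)).
Proof.
apply: (iffP forallP) => [Gl l lk|Gl l].
  have := Gl (Ordinal (lk : (l < (2 ^ k).+1)%N)).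
  by rewrite !nth_skeleton//= mul0r addr0.
by rewrite !nth_skeleton// ?mul0r ?addr0; [apply: Gl; rewrite -ltnS|rewrite -ltnS].
Qed.

Lemma dyadic_pred_mono m n w : (m <= n)%N ->
  dyadic_pred n (skeleton X s (step n) (2 ^ n) w) ->
  dyadic_pred m (skeleton X s (step m) (2 ^ m) w).
Proof.
move=> mn /dyadic_predP Gn; apply/dyadic_predP => l lm.
by rewrite /step (dyadic_refine _ _ mn); apply: Gn; exact: dyadic_refine_le.
Qed.

(** The exits seen on finer and finer dyadic skeletons form an increasing sequence of events, so a
    bound valid for all fine levels passes to their union. *)
Lemma dyadic_exit_le M : 0 <= M ->
  (\forall h \near 0^'+, forall N x, N%:R * h = T -> x \in E -> C x ->
     chainE E (p h) N (fun q =>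
       (~~ [forall l : 'I_N.+1, G x (s + l%:R * h) q`_l])%:R) x <= M) ->
  exists Bad, [/\ measurable Bad, pr P Bad <= pr P [set w | C (X w s)] * M &
    forall w, C (X w s) -> ~ Bad w -> forall k l, (l <= 2 ^ k)%N ->
      G (X w s) (s + l%:R * step k) (X w (s + l%:R * step k))].
Proof.
move=> M0 hM.
pose F k := [set w | C (X w s)] `&`
  [set w | ~~ dyadic_pred k (skeleton X s (step k) (2 ^ k) w)].
have mF k : measurable (F k).
  exact: (measurable_skeleton (2 ^ k) (fun q => ~~ dyadic_pred k q) s_ge0 (step_ge0 k) mC).
exists (\bigcup_k F k); split; first exact: bigcup_measurable.
- have [e /= e0 He] := hM.
  have [k0 Hk0] := dyadic_step_small (ltW T_gt0) e0.
  apply: (@pr_bigcup_le _ _ _ P F _ k0 mF).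
    move=> m n mn w [Cw /= nG]; split=> //=; apply: contra nG.
    exact: dyadic_pred_mono.
  move=> k kk; apply: (skeleton_le (Phi := fun q => ~~ dyadic_pred k q)) => //.
  move=> x xE Cx; apply: (le_trans _ (He (step k) _ _ (2 ^ k)%N x _ xE Cx)).
  - apply: chainE_le => //; first exact: p_ge0.
    move=> q _ qx _; apply: le_natr_bool; apply: contra => /forallP Gq.
    by apply/forallP => l; rewrite nth0 qx; exact: Gq.
  - by rewrite /= sub0r normrN ger0_norm//; exact: Hk0.
  - by rewrite divr_gt0// exprn_gt0.
  - by rewrite natrX mulrC divfK// expf_neq0.
- move=> w Cw nB k; apply/dyadic_predP; apply/negP => /negP nG.
  by apply: nB; exists k.
Qed.

(** Dual to [dyadic_exit_le]: the events of staying decrease with the level, and the lower bound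
    passes to the intersection. *)
Lemma dyadic_stay_ge M :
  (\forall k \near \oo, forall x, x \in E -> C x ->
     M <= chainE E (p (step k)) (2 ^ k) (fun q =>
       [forall l : 'I_(2 ^ k).+1, G x (s + l%:R * step k) q`_l]%:R) x) ->
  exists Good, [/\ measurable Good, pr P [set w | C (X w s)] * M <= pr P Good &
    forall w, Good w -> C (X w s) /\ forall k l, (l <= 2 ^ k)%N ->
      G (X w s) (s + l%:R * step k) (X w (s + l%:R * step k))].
Proof.
move=> hM.
pose F k := [set w | C (X w s)] `&`
  [set w | dyadic_pred k (skeleton X s (step k) (2 ^ k) w)].
have mF k : measurable (F k)
  by exact: (measurable_skeleton (2 ^ k) (dyadic_pred k) s_ge0 (step_ge0 k) mC).
exists (\bigcap_k F k); split; first exact: bigcapT_measurable.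
- have [k0 _ Hk0] := hM.
  apply: (@pr_bigcap_ge _ _ _ P F _ k0 mF).
    by move=> m n mn w [Cw /= G1]; split=> //=; exact: dyadic_pred_mono mn G1.
  move=> k kk; apply: (skeleton_ge (Phi := dyadic_pred k)) => //.
  move=> x xE Cx; apply: (le_trans (Hk0 k kk x xE Cx)).
  apply: chainE_le => //; first exact: p_ge0.
  move=> q _ qx _; apply: le_natr_bool => /forallP Gq.
  by apply/forallP => l; rewrite nth0 qx; exact: Gq.
- move=> w Gw; split; first by have [] := Gw 0%N I.
  by move=> k; apply/dyadic_predP; have [] := Gw k I.
Qed.

End Event.

End PathEstimates.

Lemma normB_exp (R : realFieldType) (u v K : R) n : `|u| <= K -> `|v| <= K ->
  `|u ^+ n.+1 - v ^+ n.+1| <= n.+1%:R * K ^+ n * `|u - v|.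
Proof.
move=> uK vK; elim: n => [|n IH]; first by rewrite !expr1 expr0 !mul1r.
have -> : u ^+ n.+2 - v ^+ n.+2 = u * (u ^+ n.+1 - v ^+ n.+1) + v ^+ n.+1 * (u - v).
  by rewrite !exprS; ring.
apply: le_trans (normD_le (normM_le uK IH) (normM_le (normX_le _ vK) (lexx _))) _.
rewrite le_eqVlt; apply/orP; left; apply/eqP.
by rewrite -[n.+2%:R]natr1 !exprS; ring.
Qed.

Section PathFunctionals.
Variable R : realType.

(** Riemann sum of [v^2 / 8 + x^6 / 18] plus the exact differential. It reads the path at finitely
    many times only, hence passes to pointwise limits. *)
Definition path_action (T : R) j (y : R -> R) :=
  \sum_(i < 2 ^ j) ((y (i.+1%:R * (T / 2 ^+ j)) - y (i%:R * (T / 2 ^+ j))) ^+ 2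
     / (8 * (T / 2 ^+ j)) + T / 2 ^+ j * (y (i%:R * (T / 2 ^+ j)) ^+ 6 / 18))
  + (y T ^+ 4 - y 0 ^+ 4) / 24.

Lemma path_actionE T j y : path_action T j y =
  (\sum_(i < 2 ^ j) (y (i.+1%:R * (T / 2 ^+ j)) - y (i%:R * (T / 2 ^+ j))) ^+ 2
     / (T / 2 ^+ j)) / 8 +
  (\sum_(i < 2 ^ j) T / 2 ^+ j * y (i%:R * (T / 2 ^+ j)) ^+ 6) / 18 +
  (y T ^+ 4 - y 0 ^+ 4) / 24.
Proof.
rewrite /path_action big_split/= !mulr_suml; congr (_ + _ + _).
  by apply: eq_bigr => i _; rewrite invfM [8^-1 * _]mulrC [LHS]mulrA.
by apply: eq_bigr => i _; rewrite mulrA.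
Qed.

Definition path_oscillates (T : R) j delta (y : R -> R) :=
  exists i t, [/\ (i < 2 ^ j)%N, i%:R * (T / 2 ^+ j) <= t <= i.+1%:R * (T / 2 ^+ j) &
    delta < `|y t - y (i%:R * (T / 2 ^+ j))|].

(** The tilt is frozen on each of [m] blocks of [q] steps, so its linear and quartic parts
    telescope; only the [x^6] term still runs over the fine steps. *)
Lemma sum_step_action m q (h : R) (a y : nat -> R) :
  \sum_(l < m * q) step_action h (a (l %/ q)%N) (y l) (y l.+1) =
  \sum_(i < m) (a i * (y (i.+1 * q)%N - y (i * q)%N) - 2 * (q%:R * h) * a i ^+ 2) +
  (y (m * q)%N ^+ 4 - y 0%N ^+ 4) / 24 +
  \sum_(i < m) \sum_(l < q) h * (y (i * q + l)%N ^+ 6 / 18).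
Proof.
rewrite -(big_mkord xpredT (fun l => step_action h (a (l %/ q)%N) (y l) (y l.+1))).
rewrite big_nat_mul big_mkord.
have -> : (y (m * q)%N ^+ 4 - y 0%N ^+ 4) / 24 =
  \sum_(i < m) (y (i.+1 * q)%N ^+ 4 - y (i * q)%N ^+ 4) / 24.
  rewrite -mulr_suml -(big_mkord xpredT (fun i => y (i.+1 * q)%N ^+ 4 - y (i * q)%N ^+ 4)).
  by rewrite (telescope_sumr (fun i => y (i * q)%N ^+ 4))// mul0n.
rewrite -!big_split /=; apply: eq_bigr => i _.
have -> : (i.+1 * q = i * q + q)%N by rewrite mulSn addnC.
rewrite -{1}[(i * q)%N]add0n [X in \sum_(_ <= _ < X) _]addnC big_addn addnK big_mkord.
rewrite (eq_bigr (fun l : 'I_q => step_action h (a i) (y (i * q + l)%N)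
    (y (i * q + l).+1))); last first.
  move=> l _; rewrite (addnC l) divnMDl ?(leq_ltn_trans _ (ltn_ord l))//.
  by rewrite divn_small// addn0.
rewrite /step_action /tilt sumrB.
have -> : \sum_(l < q) (a i * y (i * q + l).+1 + y (i * q + l).+1 ^+ 4 / 24 -
    (a i * y (i * q + l)%N + y (i * q + l)%N ^+ 4 / 24)) =
  a i * (y (i * q + q)%N - y (i * q)%N) + (y (i * q + q)%N ^+ 4 - y (i * q)%N ^+ 4) / 24.
  rewrite -(big_mkord xpredT (fun l => a i * y (i * q + l).+1 + y (i * q + l).+1 ^+ 4 / 24 -
    (a i * y (i * q + l)%N + y (i * q + l)%N ^+ 4 / 24))).
  under eq_bigr do rewrite -addnS.
  rewrite (telescope_sumr (fun l => a i * y (i * q + l)%N + y (i * q + l)%N ^+ 4 / 24))//.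
  by rewrite addn0; ring.
under [X in _ - X = _]eq_bigr do rewrite mulrBr.
rewrite sumrB sumr_const card_ord -[_ *+ q]mulr_natl; ring.
Qed.

End PathFunctionals.

Lemma pr_bigsetU_le (R : realType) d (Omega : measurableType d)
    (P : probability Omega R) (I : Type) (s : seq I) (F : I -> set Omega) :
  (forall i, measurable (F i)) ->
  measurable (\big[setU/set0]_(i <- s) F i) /\
  pr P (\big[setU/set0]_(i <- s) F i) <= \sum_(i <- s) pr P (F i).
Proof.
move=> mF; elim: s => [|i s [mU IH]].
  by rewrite !big_nil /pr measure0; split.
rewrite !big_cons; split; first exact: measurableU.
by apply: le_trans (prU_le P (mF i) mU) _; rewrite lerD2l.
Qed.

(** * Exponentially negligible sets of paths *)

Section Negligible.
Variables (R : realType) (d : nat -> measure_display).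
Variables (Omega : forall n, measurableType (d n)).
Variables (P : forall n, probability (Omega n) R).
Variables (X : forall n, Omega n -> skorohod R) (r : nat -> R).
Arguments X : clear implicits.
Hypothesis r_gt0 : forall n, (0 < n)%N -> 0 < r n.
Hypothesis r_infty : r n @[n --> \oo] --> +oo.

(** An outer-probability notion: a measurable cover [Bad] suffices, so sets defined by conditions at
    all times can be used directly. The strict inequality [s' < s] leaves room to absorb constant
    factors, which makes the class stable under finite unions. *)
Definition exp_negligible (s : R) (B : set (skorohod R)) :=
  forall s', s' < s -> \forall n \near \oo, exists2 Bad : set (Omega n),
    measurable Bad /\ pr (P n) Bad <= expR (- r n * s') & X n @^-1` B `<=` Bad.

Lemma exp_negligibleS s A B : A `<=` B -> exp_negligible s B -> exp_negligible s A.
Proof.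
move=> AB nB s' ss; apply: filterS (nB s' ss) => n [Bad mB BB]; exists Bad => //.
by move=> w Aw; apply: BB; exact: AB.
Qed.

Lemma near_expR_absorb (c e : R) : 0 < e ->
  \forall n \near \oo, c <= expR (r n * e).
Proof.
move=> e0; near=> n.
have rn : c / e <= r n by near: n; exact: (cvgryPge _).1 r_infty _.
apply: le_trans (expR_ge1Dx _); move: rn; rewrite ler_pdivrMr//; lra.
Unshelve. all: by end_near. Qed.

Lemma exp_negligibleU s A B : exp_negligible s A -> exp_negligible s B ->
  exp_negligible s (A `|` B).
Proof.
move=> nA nB s' ss; pose s'' := (s' + s) / 2.
have ss1 : s'' < s by rewrite midf_lt.
have ss2 : 0 < s'' - s' by rewrite subr_gt0 midf_lt.
have c2 := near_expR_absorb 2 ss2.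
apply: filterS3 (nA _ ss1) (nB _ ss1) c2 => n [B1 [m1 p1] s1] [B2 [m2 p2] s2] h2.
exists (B1 `|` B2); last by move=> w [/s1|/s2]; [left|right].
split; first exact: measurableU.
apply: le_trans (prU_le (P n) m1 m2) _; apply: le_trans (lerD p1 p2) _.
rewrite -mulr2n -mulr_natl -(ler_pM2r (expR_gt0 (r n * s''))) -mulrA -!expRD.
have -> : - r n * s'' + r n * s'' = 0 by ring.
have -> : - r n * s' + r n * s'' = r n * (s'' - s') by ring.
by rewrite expR0 mulr1.
Qed.

Lemma exp_negligible0 s : exp_negligible s set0.
Proof.
move=> s' _; apply: nearW => n; exists set0 => //.
by rewrite /pr measure0 /= expR_ge0.
Qed.

Lemma exp_negligible_bigcup s m (F : nat -> set (skorohod R)) :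
  (forall i, (i < m)%N -> exp_negligible s (F i)) ->
  exp_negligible s [set y | exists2 i, (i < m)%N & F i y].
Proof.
elim: m => [|m IH] nF.
  by apply: exp_negligibleS (@exp_negligible0 s) => y [].
apply: exp_negligibleS (exp_negligibleU (IH _) (nF m (leqnn _))).
  move=> y [i]; rewrite ltnS leq_eqVlt => /predU1P[->|im Fi]; first by right.
  by left; exists i.
by move=> i im; apply: nF; exact: ltnW.
Qed.

End Negligible.

(** The maximum over [a] of [a D - 2 tau a^2] is [D^2 / (8 tau)], at [b = D / (4 tau)], and choosing
    [a] instead loses [2 tau (b - a)^2]. A mesh [rho <= 1] gives [(b - a)^2 <= rho], hence a loss of
    at most [kap]. Finiteness of the grid permits the union bound over tilts. *)
Lemma grid_quadratic (R : realType) (tau K kap : R) : 0 < tau -> 0 <= K -> 0 < kap ->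
  exists S : seq R, forall D, `|D| <= 2 * K ->
    exists2 i, (i < size S)%N & D ^+ 2 / (8 * tau) - kap <= S`_i * D - 2 * tau * S`_i ^+ 2.
Proof.
move=> t0 K0 k0; pose A := K / (2 * tau); pose rho := Num.min 1 (kap / (2 * tau)).
have rho0 : 0 < rho by rewrite lt_min ltr01 divr_gt0// mulr_gt0.
pose M := (Num.truncn (2 * A / rho)).+1.
exists [seq - A + rho * i%:R | i <- iota 0 M] => D DK.
pose b := D / (4 * tau).
have tn0 : tau != 0 by rewrite gt_eqF.
have Db : D = 4 * tau * b by rewrite /b; field.
have bA : `|b| <= A.
  have t4 : 0 < 4 * tau by rewrite mulr_gt0.
  rewrite /b /A normrM [X in _ * X]ger0_norm ?invr_ge0 ?(ltW t4)//.
  by rewrite ler_pdivrMr// (_ : K / (2 * tau) * (4 * tau) = 2 * K)//; field.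
move: bA; rewrite ler_norml => /andP[bA1 bA2].
have bA0 : 0 <= (b + A) / rho by rewrite divr_ge0 ?(ltW rho0)//; lra.
have /andP[i1 i2] := truncn_itv bA0; set i := Num.truncn _ in i1 i2.
have iM : (i < M)%N.
  rewrite ltnS; apply: le_truncn; rewrite ler_pM2r ?invr_gt0//; lra.
exists i; first by rewrite size_map size_iota.
rewrite (nth_map 0%N) ?size_iota// nth_iota// add0n.
set a := - A + rho * i%:R.
have ab : 0 <= b - a <= rho.
  move: i1 i2; rewrite ler_pdivlMr// ltr_pdivrMr// -natr1 /a => h1 h2.
  by apply/andP; split; lra.
have -> : D ^+ 2 / (8 * tau) = 2 * tau * b ^+ 2 by rewrite Db; field.
have -> : a * D - 2 * tau * a ^+ 2 = 2 * tau * b ^+ 2 - 2 * tau * (b - a) ^+ 2.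
  by rewrite Db; ring.
rewrite lerD2l lerN2.
have : (b - a) ^+ 2 <= kap / (2 * tau).
  case/andP: ab => ab0 ab1; apply: (@le_trans _ _ rho); last by rewrite ge_min lexx orbT.
  have : rho <= 1 by rewrite ge_min lexx.
  rewrite expr2; nra.
by rewrite ler_pdivlMr ?mulr_gt0// mulrC.
Qed.

(** * Exponential upper estimates for the process *)

Section UpperEstimates.
Variables (R : realType) (d : nat -> measure_display).
Variables (Omega : forall n, measurableType (d n)).
Variables (P : forall n, probability (Omega n) R).
Variables (X : forall n, Omega n -> skorohod R) (r : nat -> R).
Arguments X : clear implicits.
Variables (E : nat -> seq R) (k : nat -> R -> R -> R -> R).
Hypothesis r_gt0 : forall n, (0 < n)%N -> 0 < r n.
Hypothesis r_infty : r n @[n --> \oo] --> +oo.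
Hypothesis uE : forall n, (0 < n)%N -> uniq (E n).
Hypothesis k_trans : forall n, (0 < n)%N -> transition_function (E n) (k n).
Hypothesis X_markov : forall n, (0 < n)%N -> markov_process (E n) (P n) (X n) (k n).
Hypothesis k_step : one_step_bounds E k r.

Let k_ge0 n h : (0 < n)%N -> 0 <= h -> forall x y, x \in E n -> y \in E n -> 0 <= k n h x y.
Proof. by move=> n0 h0 x y; case: (k_trans n0) => p0 _ _ _; exact: p0. Qed.

Let k_sum1 n h : (0 < n)%N -> 0 <= h -> forall x, x \in E n -> \sum_(y <- E n) k n h x y = 1.
Proof. by move=> n0 h0 x; case: (k_trans n0) => _ p1 _ _; exact: p1. Qed.

Lemma containment_negligible s :
  (exists K0, exp_negligible P X r s [set y | K0 < `|y 0|]) ->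
  exists2 K, 0 <= K & forall T, 0 < T ->
    exp_negligible P X r s [set y | exists2 t, 0 <= t <= T & K < `|y t|].
Proof.
move=> [K0' nK0]; pose K0 := Num.max K0' 0.
have K00 : 0 <= K0 by rewrite le_max lexx orbT.
have K04 : 0 <= K0 ^+ 4 by rewrite exprn_ge0.
(* Since [K <= K ^+ 4], this makes [(K0^4 - K^4) / 24 + 1 <= - s]. The summand 1 is the accumulated
   error [T * eps] with [eps = 1 / T]; this choice of [eps] keeps [K] independent of [T]. *)
pose K := K0 ^+ 4 + 24 * (`|s| + 1).
have K1 : 1 <= K by rewrite /K; have := normr_ge0 s; lra.
exists K => [|T T0]; first by rewrite (le_trans _ K1).
have K4 : K <= K ^+ 4 by rewrite exprS ler_peMr ?exprn_ege1// (le_trans _ K1).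
pose B0 : set (skorohod R) := [set y | K0' < `|y 0|].
pose B1 : set (skorohod R) := [set y | `|y 0| <= K0 /\ exists2 t, 0 <= t <= T & K < `|y t|].
apply: (@exp_negligibleS _ _ _ _ _ _ _ _ (B0 `|` B1)).
  move=> y yK; have [yK0|yK0] := leP `|y 0| K0; first by right.
  by left; apply: le_lt_trans yK0; rewrite le_max lexx.
apply: exp_negligibleU => // s' ss.
have eps0 : 0 < T^-1 by rewrite invr_gt0.
near=> n; have n0 : (0 < n)%N by near: n; exists 1%N.
have st : \forall h \near 0^'+, forall x, x \in E n -> `|x| <= K ->
  forall a, a \in [:: 0] ->
  expR (r n * h * (2 * a ^+ 2 - x ^+ 6 / 18 - T^-1)) <=
  \sum_(y <- E n) k n h x y * expR (r n * (tilt a y - tilt a x)) <=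
  expR (r n * h * (2 * a ^+ 2 - x ^+ 6 / 18 + T^-1)).
  by near: n; exact: k_step.
have mC : measurable [set x : R | `|x| <= K0].
  rewrite (_ : [set _ | _] = `[- K0, K0]%classic); first exact: measurable_itv.
  by apply/seteqP; split=> x /=; rewrite in_itv/= ler_norml.
have [||Bad [mB pB HB]] := @dyadic_exit_le R _ _ (P n) (X n) (E n) (k n) (uE n0)
  (k_trans n0) (X_markov n0) 0 T _ (fun _ _ y => `|y| <= K) (lexx 0) T0 mC
  (expR (- r n * s)).
- exact: expR_ge0.
- near=> h => N x NhT xE xK0.
  have h0 : 0 < h by near: h; exact: nbhs_right_gt.
  have hst := near st h; move: (hst) => /(_ _) sth.
  apply: le_trans (@chain_containment R (E n) (k n h) (r n) h T^-1 K [:: 0]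
    _ _ _ _ _ _ N x _ _ _) _.
  + exact: (k_ge0 n0 (ltW h0)).
  + exact: (k_sum1 n0 (ltW h0)).
  + exact: r_gt0.
  + by [].
  + exact: ltW.
  + by near: h.
  + exact: mem_head.
  + by rewrite (le_trans _ K1).
  + by [].
  rewrite ler_expR mulNr -mulrN ler_wpM2l ?(ltW (r_gt0 n0))//.
  rewrite NhT mulfV ?gt_eqF//.
  have : x ^+ 4 <= K0 ^+ 4.
    by rewrite -[leLHS]ger0_norm ?exprn_even_ge0//; exact: normX_le.
  have := ler_norm s; rewrite /K in K4 *; lra.
exists Bad.
  split=> //; apply: le_trans pB _.
  apply: (@le_trans _ _ (expR (- r n * s))).
    rewrite ler_piMl ?expR_ge0// pr_le1//.
    by apply: (measurable_preimage (X_markov n0)).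
  by rewrite ler_expR !mulNr lerN2 ler_wpM2l ?(ltW (r_gt0 n0))// ltW.
move=> w [/= wK0 [t /andP[t0 tT] Kt]]; apply: contrapT => nB.
have := HB w wK0 nB; move: Kt; rewrite ltNge => /negP + Hd; apply.
have -> : X n w t = X n w t - (cst 0) t by rewrite subr0.
apply: (@dyadic_right_continuous R (fun t => `|X n w t - (cst 0) t|) 0 T K 0%N T0).
- by move=> u _; apply: cadlag_normB_right; exact: cvg_cst.
- by move=> j l _ lj; rewrite subr0; exact: Hd.
- by rewrite t0 add0r.
Unshelve. all: by end_near. Qed.

Let measurable_ball K : measurable [set x : R | `|x| <= K].
Proof.
rewrite (_ : [set _ | _] = `[- K, K]%classic); first exact: measurable_itv.
by apply/seteqP; split=> x /=; rewrite in_itv/= ler_norml.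
Qed.

Lemma oscillation_negligible s T K delta : 0 < T -> 0 <= K -> 0 < delta ->
  exists j0, forall j, (j0 <= j)%N -> exp_negligible P X r s
    [set y | (forall t, 0 <= t <= T -> `|y t| <= K) /\ path_oscillates T j delta y].
Proof.
(* With cells so short that [tau (2 phi^2 + 1) <= 1], the exponent of [chain_oscillation] is at most
   [- (s + 2)]; the surplus 2 absorbs the factor 2 in front. *)
move=> T0 K0 d0; pose phi := (K ^+ 4 / 24 + `|s| + 3) / delta.
have K4 : 0 <= K ^+ 4 by rewrite exprn_ge0.
have phi0 : 0 <= phi by rewrite divr_ge0 ?(ltW d0)//; have := normr_ge0 s; lra.
have q0 : 0 < 2 * phi ^+ 2 + 1 by rewrite ltr_wpDl// mulr_ge0// exprn_ge0.
have iq0 : 0 < (2 * phi ^+ 2 + 1)^-1 by rewrite invr_gt0.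
have [j0 Hj0] := dyadic_step_small (ltW T0) iq0; exists j0 => j /Hj0.
set tau := T / 2 ^+ j => tauq.
have tau0 : 0 < tau by rewrite divr_gt0 ?exprn_gt0.
have {}tauq : tau * (2 * phi ^+ 2 + 1) <= 1.
  by rewrite -ler_pdivlMr// div1r ltW.
pose F i : set (skorohod R) := [set y | `|y (i%:R * tau)| <= K /\
  exists2 t, i%:R * tau <= t <= i.+1%:R * tau & delta < `|y t - y (i%:R * tau)|].
apply: (@exp_negligibleS _ _ _ _ _ _ _ _ [set y | exists2 i, (i < 2 ^ j)%N & F i y]).
  move=> y [yK [i [t [ij it dt]]]]; exists i => //; split; last by exists t.
  apply: yK; rewrite mulr_ge0 ?(ltW tau0)//=.
  have -> : T = (2 ^ j)%:R * tau by rewrite natrX mulrC divfK// expf_neq0.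
  by rewrite ler_pM2r// ler_nat ltnW.
apply: exp_negligible_bigcup => // i ij s' ss.
have itau0 : 0 <= i%:R * tau by rewrite mulr_ge0// ltW.
near=> n; have n0 : (0 < n)%N by near: n; exists 1%N.
have c2 : 2 <= expR (r n * 2) by near: n; exact: near_expR_absorb.
have st : \forall h \near 0^'+, forall x, x \in E n -> `|x| <= K + delta ->
  forall a, a \in [:: phi; - phi] ->
  expR (r n * h * (2 * a ^+ 2 - x ^+ 6 / 18 - 1)) <=
  \sum_(y <- E n) k n h x y * expR (r n * (tilt a y - tilt a x)) <=
  expR (r n * h * (2 * a ^+ 2 - x ^+ 6 / 18 + 1)).
  by near: n; exact: k_step.
have [||Bad [mB pB HB]] := @dyadic_exit_le R _ _ (P n) (X n) (E n) (k n) (uE n0)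
  (k_trans n0) (X_markov n0) (i%:R * tau) tau _ (fun x _ y => `|y - x| <= delta)
  itau0 tau0 (measurable_ball K) (expR (- r n * s)).
- exact: expR_ge0.
- near=> h => N x NhT xE xK0.
  have h0 : 0 < h by near: h; exact: nbhs_right_gt.
  apply: le_trans (@chain_oscillation R (E n) (k n h) (r n) h 1 (K + delta)
    [:: phi; - phi] _ _ _ _ _ _ N x phi delta K _ _ _ _ _ _ _) _ => //.
  + exact: (k_ge0 n0 (ltW h0)).
  + exact: (k_sum1 n0 (ltW h0)).
  + exact: r_gt0.
  + by near: h.
  + exact: mem_head.
  + by rewrite !inE eqxx orbT.
  + exact: ltW.
  rewrite NhT; apply: (@le_trans _ _ (expR (r n * 2) * expR (- r n * (s + 2)))).
    apply: ler_pM; rewrite ?expR_ge0//.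
    rewrite ler_expR mulNr -mulrN ler_wpM2l ?(ltW (r_gt0 n0))//.
    have pd : phi * delta = K ^+ 4 / 24 + `|s| + 3 by rewrite /phi divfK ?gt_eqF.
    by have := ler_norm s; rewrite pd; lra.
  by rewrite -expRD ler_expR; lra.
exists Bad.
  split=> //; apply: le_trans pB _.
  apply: (@le_trans _ _ (expR (- r n * s))).
    rewrite ler_piMl ?expR_ge0// pr_le1//.
    by apply: (measurable_preimage (X_markov n0)).
  by rewrite ler_expR !mulNr lerN2 ler_wpM2l ?(ltW (r_gt0 n0))// ltW.
move=> w [/= wK0 [t /andP[t0 tT] Kt]]; apply: contrapT => nB.
have := HB w wK0 nB; move: Kt; rewrite ltNge => /negP + Hd; apply.
apply: (@dyadic_right_continuous R (fun t => `|X n w t - (cst (X n w (i%:R * tau))) t|)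
  (i%:R * tau) tau delta 0%N tau0).
- by move=> u _; apply: cadlag_normB_right; exact: cvg_cst.
- by move=> l l' _ lj; exact: Hd.
- by rewrite t0 /=; move: tT; rewrite -natr1 mulrDl mul1r.
Unshelve. all: by end_near. Qed.

(** Union bound over all assignments of a grid tilt to each dyadic cell: a path of large action is
    caught by the assignment nearly optimal for its own increments. The small-oscillation clause
    allows the running [x^6] term to be replaced by its value at the start of each cell. *)
Lemma action_negligible s T K delta j u v a : 0 < T -> 0 <= K -> 0 < delta ->
  (forall a', a' < a -> \forall n \near \oo,
     pr (P n) [set w | u <= X n w 0 <= v] <= expR (- r n * a')) ->
  exp_negligible P X r s [set y | [/\ u <= y 0 <= v,
    forall t, 0 <= t <= T -> `|y t| <= K,
    ~ path_oscillates T j (delta / (4 * T * (K ^+ 5 + 1))) y &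
    s - a + delta < path_action T j y]].
Proof.
move=> T0 K0 d0 hJ s' ss; set dd := delta / (4 * T * (K ^+ 5 + 1)).
pose tau := T / 2 ^+ j; pose m := (2 ^ j)%N.
have tau0 : 0 < tau by rewrite divr_gt0 ?exprn_gt0.
have K5 : 0 <= K ^+ 5 by rewrite exprn_ge0.
have m0 : (0 < m)%N by rewrite expn_gt0.
have mtau : m%:R * tau = T by rewrite /m natrX mulrC divfK// expf_neq0.
have dd0 : 0 < dd by rewrite divr_gt0// !mulr_gt0// ltr_wpDl.
pose kap := delta / (4 * m%:R).
have kap0 : 0 < kap by rewrite divr_gt0// mulr_gt0// ltr0n.
have [S HS] := grid_quadratic tau0 K0 kap0.
pose eps := delta / (8 * T).
have eps0 : 0 < eps by rewrite divr_gt0// mulr_gt0.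
have d16 : 0 < delta / 16 by rewrite divr_gt0.
(* An element of [A] selects a tilt on each of the [m] cells. The default 0 of [alpha] is the reason
   for taking the one-step bounds over [0 :: S]. *)
pose A := {ffun 'I_m -> 'I_(size S)}.
pose alpha (f : A) (i : nat) := if insub i is Some o then S`_(f o) else 0.
(* Half of [delta] pays for the path side: [delta / 4] for the grid and [delta / 12] for the [x^6]
   sum. The other half pays for the probabilities: [delta / 16] for the start, [delta / 16] for the
   number of tilts and [delta / 8] for the one-step errors. *)
pose c := s - a + delta / 2.
near=> n; have n0 : (0 < n)%N by near: n; exists 1%N.
have rn0 := r_gt0 n0.
have cA : #|A|%:R <= expR (r n * (delta / 16)) by near: n; exact: near_expR_absorb.
have pJ : pr (P n) [set w | u <= X n w 0 <= v] <= expR (- r n * (a - delta / 16)).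
  by near: n; apply: hJ; rewrite gtrBl.
have st : \forall h \near 0^'+, forall x, x \in E n -> `|x| <= K ->
  forall a, a \in 0 :: S ->
  expR (r n * h * (2 * a ^+ 2 - x ^+ 6 / 18 - eps)) <=
  \sum_(y <- E n) k n h x y * expR (r n * (tilt a y - tilt a x)) <=
  expR (r n * h * (2 * a ^+ 2 - x ^+ 6 / 18 + eps)).
  by near: n; exact: k_step.
have [e /= e0 He] := st.
(* A single skeleton, fine enough for the given [n], suffices here: the clauses on the path hold at
   all times, in particular on its grid. *)
have [q0 Hq0] := dyadic_step_small (ltW tau0) e0.
have := Hq0 q0 (leqnn _); set h := tau / 2 ^+ q0 => he.
have h0 : 0 < h by rewrite divr_gt0 ?exprn_gt0.
have {}st := He h; rewrite /= sub0r normrN gtr0_norm// in st.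
have {st} st := st he h0.
pose q := (2 ^ q0)%N; pose N := (m * q)%N.
have qh : q%:R * h = tau by rewrite /q natrX mulrC divfK// expf_neq0.
have NhT : N%:R * h = T by rewrite natrM -mulrA qh.
pose Phi f (x : seq R) := [forall l : 'I_N.+1, `|x`_l| <= K] &&
  (c <= \sum_(l < N) step_action h (alpha f (l %/ q)%N) x`_l x`_l.+1).
pose J := [set x : R | u <= x <= v].
have mJ : measurable J.
  rewrite (_ : J = `[u, v]%classic); first exact: measurable_itv.
  by apply/seteqP; split=> x /=; rewrite in_itv/=.
pose Bf f := [set w | J (X n w 0)] `&` [set w | Phi f (skeleton (X n) 0 h N w)].
have mBf f : measurable (Bf f).
  exact: (measurable_skeleton (uE n0) (X_markov n0) N (Phi f) (lexx 0) (ltW h0) mJ).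
have pBf f : pr (P n) (Bf f) <= expR (- r n * (a - delta / 16)) * expR (- r n * (c - T * eps)).
  apply: (@le_trans _ _ (pr (P n) [set w | J (X n w 0)] * expR (- r n * (c - T * eps)))).
    apply: (skeleton_le (uE n0) (X_markov n0) (N := N) (Phi := Phi f) (lexx 0) (ltW h0) mJ).
    move=> x xE _; rewrite -NhT.
    apply: (chain_action (k_ge0 n0 (ltW h0)) rn0 st (N := N)
      (a := fun l => alpha f (l %/ q)%N) c xE).
    move=> l lN; rewrite /alpha; case: insubP => [i _ _|_]; last exact: mem_head.
    by rewrite inE mem_nth ?orbT.
  by rewrite ler_wpM2r ?expR_ge0.
have [mB pB] := @pr_bigsetU_le R _ _ (P n) A (enum A) Bf mBf.
exists (\big[setU/set0]_(f <- enum A) Bf f).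
  split=> //; apply: le_trans pB _.
  apply: (@le_trans _ _ (#|A|%:R * (expR (- r n * (a - delta / 16)) *
    expR (- r n * (c - T * eps))))).
    rewrite -sum1_card natr_sum mulr_suml big_enum /=.
    by apply: ler_sum => f _; rewrite mul1r.
  apply: (le_trans (ler_wpM2r _ cA)); first by rewrite mulr_ge0 ?expR_ge0.
  rewrite -!expRD ler_expR /c /eps.
  have -> : T * (delta / (8 * T)) = delta / 8 by field; rewrite gt_eqF.
  have := ltW (_ : r n * s' < r n * s); rewrite ltr_pM2l// => /(_ ss).
  have := mulr_ge0 (ltW rn0) (ltW d0); lra.
move=> w /= [w0 wK wosc wact].
pose y l := X n w (l%:R * h).
have yE i : y (i * q)%N = X n w (i%:R * tau) by rewrite /y natrM -mulrA qh.
have yK l : (l <= N)%N -> `|y l| <= K.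
  by move=> lN; apply: wK; rewrite mulr_ge0 ?(ltW h0)//= -NhT ler_pM2r// ler_nat.
have Di (i : 'I_m) : exists o : 'I_(size S),
    (y (i.+1 * q)%N - y (i * q)%N) ^+ 2 / (8 * tau) - kap <=
    S`_o * (y (i.+1 * q)%N - y (i * q)%N) - 2 * tau * S`_o ^+ 2.
  have [|o oS Ho] := HS (y (i.+1 * q)%N - y (i * q)%N); last by exists (Ordinal oS).
  rewrite (le_trans (ler_normB _ _))// mulr_natl mulr2n lerD//; apply: yK.
    by rewrite leq_mul2r ltn_ord orbT.
  by rewrite leq_mul2r ltnW ?ltn_ord ?orbT.
have [g Hg] := fin_all_exists Di; pose f : A := [ffun i => g i].
have alphaE (i : 'I_m) : alpha f i = S`_(g i) by rewrite /alpha valK ffunE.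
suff Bw : Bf f w.
  have : f \in enum A by rewrite mem_enum.
  elim: (enum A) => // x xs IH; rewrite inE big_cons => /predU1P[<-|/IH]; first by left.
  by right.
split=> //=; apply/andP; split.
  apply/forallP => l; have lN : (l <= N)%N by rewrite -ltnS.
  by rewrite nth_skeleton// add0r; exact: yK.
rewrite (eq_bigr (fun l : 'I_N => step_action h (alpha f (l %/ q)%N) (y l) (y l.+1))); last first.
  by move=> l _; rewrite !nth_skeleton ?add0r// ltnW.
rewrite sum_step_action qh.
have E1 : \sum_(i < m) ((y (i.+1 * q)%N - y (i * q)%N) ^+ 2 / (8 * tau)) - delta / 4 <=
    \sum_(i < m) (alpha f i * (y (i.+1 * q)%N - y (i * q)%N) - 2 * tau * alpha f i ^+ 2).
  have -> : delta / 4 = \sum_(i < m) kap.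
    rewrite sumr_const card_ord -mulr_natl /kap; field.
    by rewrite pnatr_eq0 gtn_eqF.
  by rewrite -sumrB; apply: ler_sum => i _; rewrite alphaE.
have E2 : \sum_(i < m) (tau * (y (i * q)%N ^+ 6 / 18)) - delta / 12 <=
    \sum_(i < m) \sum_(l < q) h * (y (i * q + l)%N ^+ 6 / 18).
  apply: (@le_trans _ _ (\sum_(i < m) (tau * (y (i * q)%N ^+ 6 / 18) - tau * (K ^+ 5 * dd / 3)))).
    rewrite sumrB lerD2l lerN2 sumr_const card_ord -[_ *+ m]mulr_natl (mulrA m%:R tau) mtau /dd.
    have -> : T * (K ^+ 5 * (delta / (4 * T * (K ^+ 5 + 1))) / 3) =
      delta / 12 * (K ^+ 5 / (K ^+ 5 + 1)).
      by field; rewrite !gt_eqF// ltr_wpDl.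
    rewrite ler_piMr ?divr_ge0 ?(ltW d0)// ler_pdivrMr ?ltr_wpDl// mul1r; lra.
  apply: ler_sum => i _.
  have -> : tau * (y (i * q)%N ^+ 6 / 18) - tau * (K ^+ 5 * dd / 3) =
      \sum_(l < q) h * (y (i * q)%N ^+ 6 / 18 - K ^+ 5 * dd / 3).
    by rewrite sumr_const card_ord -[_ *+ q]mulr_natl (mulrA q%:R h) qh mulrBr.
  apply: ler_sum => l _; rewrite ler_wpM2l ?(ltW h0)//.
  have iqN : (i * q + l <= N)%N.
    rewrite /N; apply: (@leq_trans (i.+1 * q)); last by rewrite leq_mul2r ltn_ord orbT.
    by rewrite mulSn addnC leq_add2r ltnW.
  have iqN' : (i * q <= N)%N by apply: leq_trans iqN; rewrite leq_addr.
  have osc : `|y (i * q + l)%N - y (i * q)%N| <= dd.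
    rewrite leNgt; apply/negP => dosc; apply: wosc; exists i, ((i * q + l)%N%:R * h).
    rewrite -/tau -yE; split=> //; rewrite natrD mulrDl natrM -mulrA qh.
    rewrite lerDl mulr_ge0 ?(ltW h0)//= -natr1 (mulrDl _ _ tau) mul1r lerD2l -qh.
    by rewrite ler_pM2r// ler_nat ltnW.
  have := normB_exp 5 (yK _ iqN) (yK _ iqN').
  move=> /le_trans/(_ (ler_wpM2l _ osc)); rewrite mulr_ge0// => /(_ isT).
  rewrite ler_norml => /andP[+ _]; rewrite -(mulrA 6).
  by move: (y (i * q + l)%N ^+ 6) (y (i * q)%N ^+ 6) (K ^+ 5 * dd) => y1 y2 Kd; lra.
move: wact; rewrite /path_action -/tau big_split /= => wact.
have ET : y (m * q)%N = X n w T by rewrite yE mtau.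
have E0 : y 0%N = X n w 0 by rewrite /y mul0r.
rewrite ET E0 /c.
have R1 : \sum_(i < m) ((y (i.+1 * q)%N - y (i * q)%N) ^+ 2 / (8 * tau)) =
  \sum_(i < 2 ^ j) (X n w (i.+1%:R * tau) - X n w (i%:R * tau)) ^+ 2 / (8 * tau).
  by apply: eq_bigr => i _; rewrite !yE.
have R2 : \sum_(i < m) (tau * (y (i * q)%N ^+ 6 / 18)) =
  \sum_(i < 2 ^ j) tau * (X n w (i%:R * tau) ^+ 6 / 18).
  by apply: eq_bigr => i _; rewrite !yE.
rewrite R1 in E1; rewrite R2 in E2; lra.
Unshelve. all: by end_near. Qed.

End UpperEstimates.

(** * Polygonal lines and the lower estimate in a tube *)

Section Polygon.
Variables (R : realType) (g : nat -> R) (tau : R).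

Definition polygon (t : R) : R :=
  let i := Num.truncn (t / tau) in g i + (t / tau - i%:R) * (g i.+1 - g i).

(** The case [l = q] is included: truncation then moves to the next cell, whose left node is the
    same point. *)
Lemma polygonE i l q : 0 < tau -> (l <= q)%N -> (0 < q)%N ->
  polygon ((i * q + l)%:R * (tau / q%:R)) = g i + l%:R / q%:R * (g i.+1 - g i).
Proof.
move=> t0 lq q0; rewrite /polygon.
have qn0 : q%:R != 0 :> R by rewrite pnatr_eq0 gtn_eqF.
have -> : (i * q + l)%:R * (tau / q%:R) / tau = i%:R + l%:R / q%:R.
  have tn0 : tau != 0 by rewrite gt_eqF.
  by rewrite natrD natrM; field; rewrite ?qn0 ?tn0.
have q0' : 0 < q%:R :> R by rewrite ltr0n.
move: lq; rewrite leq_eqVlt => /predU1P[->|lq].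
  rewrite divff//; have -> : Num.truncn (i%:R + 1 : R) = i.+1.
    by apply: truncn_def; rewrite natr1 lexx ltr_nat ltnSn.
  by rewrite natr1; ring.
have -> : Num.truncn (i%:R + l%:R / q%:R : R) = i.
  apply: truncn_def; rewrite lerDl divr_ge0//= -natr1 ltrD2l.
  by rewrite ltr_pdivrMr// mul1r ltr_nat.
by congr (_ + _ * _); ring.
Qed.

End Polygon.

Section LowerEstimates.
Variables (R : realType) (d : nat -> measure_display).
Variables (Omega : forall n, measurableType (d n)).
Variables (P : forall n, probability (Omega n) R).
Variables (X : forall n, Omega n -> skorohod R) (r : nat -> R).
Arguments X : clear implicits.
Variables (E : nat -> seq R) (k : nat -> R -> R -> R -> R).
Hypothesis r_gt0 : forall n, (0 < n)%N -> 0 < r n.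
Hypothesis r_infty : r n @[n --> \oo] --> +oo.
Hypothesis uE : forall n, (0 < n)%N -> uniq (E n).
Hypothesis k_trans : forall n, (0 < n)%N -> transition_function (E n) (k n).
Hypothesis X_markov : forall n, (0 < n)%N -> markov_process (E n) (P n) (X n) (k n).
Hypothesis k_step : one_step_bounds E k r.

(** At [a = D / (4 tau)], with [D] the increment of the nodes, an increment [D'] of the path gives
    [a D' - 2 tau a^2 = D^2 / (8 tau) + a (D' - D)], which is linear in the deviation. The other
    terms use that [x^6 / 18] and [x^4 / 24] are Lipschitz on the ball with constants [K^5 / 3] and
    [K^3 / 6]. *)
Lemma tube_action_le (T delta om K : R) (g : nat -> R) j q0 (s : seq R) :
  0 < T -> 0 <= delta -> 0 <= om ->
  (forall i, (i <= 2 ^ j)%N -> `|g i| <= K) ->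
  (forall i, (i < 2 ^ j)%N -> `|g i.+1 - g i| <= om) ->
  let tau := T / 2 ^+ j in
  let h := T / 2 ^+ (j + q0) in
  (forall l, (l <= 2 ^ (j + q0))%N -> `|s`_l - polygon g tau (l%:R * h)| <= delta) ->
  (forall l, (l <= 2 ^ (j + q0))%N -> `|s`_l| <= K) ->
  \sum_(l < 2 ^ (j + q0)) step_action h
    ((g (l %/ 2 ^ q0).+1 - g (l %/ 2 ^ q0)%N) / tau / 4) s`_l s`_l.+1 <=
  \sum_(i < 2 ^ j) ((g i.+1 - g i) ^+ 2 / (8 * tau) + tau * (g i ^+ 6 / 18)) +
  (g (2 ^ j)%N ^+ 4 - g 0%N ^+ 4) / 24 + T * K ^+ 5 * om / 3 +
  delta * (2 * \sum_(i < 2 ^ j) `|(g i.+1 - g i) / tau / 4| + K ^+ 3 / 3 + T * K ^+ 5 / 3).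
Proof.
move=> T0 d0 om0 gK gom tau h sc sK; pose m := (2 ^ j)%N; pose q := (2 ^ q0)%N.
have tau0 : 0 < tau by rewrite divr_gt0 ?exprn_gt0.
have tn0 : tau != 0 by rewrite gt_eqF.
have q_gt0 : (0 < q)%N by rewrite expn_gt0.
have qn0 : q%:R != 0 :> R by rewrite pnatr_eq0 gtn_eqF.
have mq : (2 ^ (j + q0) = m * q)%N by rewrite expnD.
have hE : h = tau / q%:R.
  by rewrite /h /tau /q natrX exprD; field; rewrite !expf_neq0.
have h0 : 0 < h by rewrite divr_gt0 ?exprn_gt0.
have qh : q%:R * h = tau by rewrite hE mulrC divfK.
have mtau : m%:R * tau = T by rewrite /m natrX mulrC divfK// expf_neq0.
have K0 : 0 <= K by apply: le_trans (gK 0%N _).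
pose a i := (g i.+1 - g i) / tau / 4.
rewrite mq in sc sK.
rewrite -(big_mkord xpredT (fun l => step_action h (a (l %/ q)%N) s`_l s`_l.+1)) mq big_mkord.
rewrite (sum_step_action m q h a (fun l => s`_l)) qh.
have sg i : (i <= m)%N -> `|s`_(i * q) - g i| <= delta.
  move=> im; have := sc (i * q)%N; rewrite leq_mul2r im orbT => /(_ isT).
  have := @polygonE R g tau i 0 q tau0 (leq0n _) q_gt0.
  by rewrite addn0 -hE => ->; rewrite mul0r mul0r addr0.
have sgl i l : (i < m)%N -> (l < q)%N -> (i * q + l <= m * q)%N /\
    `|s`_(i * q + l) - g i| <= delta + om.
  move=> im lq; have lm : (i * q + l <= m * q)%N.
    apply: (@leq_trans (i.+1 * q)); last by rewrite leq_mul2r im orbT.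
    by rewrite mulSn addnC leq_add2r ltnW.
  split=> //; have := sc _ lm; rewrite hE polygonE// 1?ltnW// => h1.
  have -> : s`_(i * q + l) - g i = (s`_(i * q + l) - (g i + l%:R / q%:R * (g i.+1 - g i)))
     + l%:R / q%:R * (g i.+1 - g i) by ring.
  apply: normD_le => //; rewrite -[om]mul1r; apply: normM_le; last exact: gom.
  by rewrite ger0_norm ?divr_ge0// ler_pdivrMr ?ltr0n// mul1r ler_nat ltnW.
have E1 : \sum_(i < m) (a i * (s`_(i.+1 * q) - s`_(i * q)) - 2 * tau * a i ^+ 2) <=
    \sum_(i < m) ((g i.+1 - g i) ^+ 2 / (8 * tau)) + delta * (2 * \sum_(i < m) `|a i|).
  rewrite (mulrA delta 2) [X in _ + X]mulr_sumr -big_split /=; apply: ler_sum => i _.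
  have -> : a i * (s`_(i.+1 * q) - s`_(i * q)) - 2 * tau * a i ^+ 2 =
    (g i.+1 - g i) ^+ 2 / (8 * tau) +
    a i * ((s`_(i.+1 * q) - g i.+1) - (s`_(i * q) - g i)).
    by rewrite /a; field.
  rewrite lerD2l; apply: le_trans (ler_norm _) _; rewrite mulrC.
  apply: normM_le => //; rewrite mulr_natr mulr2n; apply: normD_le; first exact: sg.
  by rewrite normrN; apply: sg; rewrite ltnW.
have E2 : \sum_(i < m) \sum_(l < q) h * (s`_(i * q + l) ^+ 6 / 18) <=
    \sum_(i < m) (tau * (g i ^+ 6 / 18)) + T * K ^+ 5 * om / 3 + delta * (T * K ^+ 5 / 3).
  have -> : T * K ^+ 5 * om / 3 = m%:R * (tau * (K ^+ 5 * om / 3)) by rewrite -mtau; ring.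
  have -> : delta * (T * K ^+ 5 / 3) = m%:R * (tau * (K ^+ 5 * delta / 3)) by rewrite -mtau; ring.
  have -> : \sum_(i < m) tau * (g i ^+ 6 / 18) + m%:R * (tau * (K ^+ 5 * om / 3)) +
      m%:R * (tau * (K ^+ 5 * delta / 3)) =
      \sum_(i < m) \sum_(l < q) h * (g i ^+ 6 / 18 + K ^+ 5 * om / 3 + K ^+ 5 * delta / 3).
    rewrite [RHS](eq_bigr (fun i : 'I_m => tau * (g i ^+ 6 / 18) +
      tau * (K ^+ 5 * om / 3) + tau * (K ^+ 5 * delta / 3))); last first.
      by move=> i _; rewrite sumr_const card_ord -[_ *+ q]mulr_natl (mulrA q%:R h) qh !mulrDr.
    rewrite !big_split /= !sumr_const !card_ord.
    by rewrite -(mulr_natl (tau * (K ^+ 5 * om / 3))) -(mulr_natl (tau * (K ^+ 5 * delta / 3))).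
  apply: ler_sum => i _.
  apply: ler_sum => l _; rewrite ler_wpM2l ?(ltW h0)//.
  have [lm sgi] := sgl i l (ltn_ord i) (ltn_ord l).
  have := normB_exp 5 (sK _ lm) (gK i (ltnW (ltn_ord i))).
  move=> /le_trans/(_ (ler_wpM2l _ sgi)); rewrite mulr_ge0 ?exprn_ge0// => /(_ isT).
  rewrite ler_norml => /andP[_]; rewrite mulrDr; move: (s`_ _ ^+ 6) (g i ^+ 6) (K ^+ 5) => y1 y2 K5.
  by lra.
have E3 : (s`_(m * q) ^+ 4 - s`_0 ^+ 4) / 24 <= (g m ^+ 4 - g 0%N ^+ 4) / 24 + delta * (K ^+ 3 / 3).
  have K3 : 0 <= 4%:R * K ^+ 3 by rewrite mulr_ge0// exprn_ge0.
  have := normB_exp 3 (sK _ (leqnn _)) (gK m (leqnn _)).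
  move=> /le_trans/(_ (ler_wpM2l K3 (sg m (leqnn _)))).
  have := normB_exp 3 (sK 0%N (leq0n _)) (gK 0%N (leq0n _)).
  have := sg 0%N (leq0n _); rewrite mul0n => s0.
  move=> /le_trans/(_ (ler_wpM2l K3 s0)).
  rewrite !ler_norml => /andP[h1 _] /andP[_ h2]; move: h1 h2.
  move: (s`_(m * q) ^+ 4) (s`_0 ^+ 4) (g m ^+ 4) (g 0%N ^+ 4) (K ^+ 3) => y1 y2 y3 y4 K3'.
  by lra.
rewrite [X in X + _ + _ + _]big_split /= -/m.
rewrite !mulrDr; move: E1 E2 E3; rewrite -/m.
set s1 := \sum_(i < m) (_ - _); set s2 := \sum_(i < m) \sum_(l < q) _.
set s3 := \sum_(i < m) (g _ - _) ^+ 2 / _; set s4 := \sum_(i < m) `|_|.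
set s5 := \sum_(i < m) _ * (_ ^+ 6 / 18).
by rewrite /=; lra.
Qed.

Let k_ge0 n h : (0 < n)%N -> 0 <= h -> forall x y, x \in E n -> y \in E n -> 0 <= k n h x y.
Proof. by move=> n0 h0 x y; case: (k_trans n0) => p0 _ _ _; exact: p0. Qed.

Lemma tube_lower_bound (T om K e delta : R) (g : nat -> R) j :
  0 < T -> 0 < e -> 0 < delta -> 0 <= om ->
  (forall i, (i <= 2 ^ j)%N -> `|g i| <= K) ->
  (forall i, (i < 2 ^ j)%N -> `|g i.+1 - g i| <= om) ->
  let tau := T / 2 ^+ j in
  let c := \sum_(i < 2 ^ j) ((g i.+1 - g i) ^+ 2 / (8 * tau) + tau * (g i ^+ 6 / 18)) +
    (g (2 ^ j)%N ^+ 4 - g 0%N ^+ 4) / 24 + T * (K + om + 1) ^+ 5 * om / 3 in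
  exists2 rho, 0 < rho & \forall n \near \oo, exists Good : set (Omega n),
    [/\ measurable Good,
      pr (P n) [set w | `|X n w 0 - g 0%N| <= rho] * expR (- r n * (c + e)) <= pr (P n) Good &
      forall w, Good w -> forall i t, (i < 2 ^ j)%N -> i%:R * tau <= t < i.+1%:R * tau ->
        `|X n w t - g i| <= delta + om].
Proof.
move=> T0 e0 d0 om0 gK gom tau c; pose m := (2 ^ j)%N.
have tau0 : 0 < tau by rewrite divr_gt0 ?exprn_gt0.
have tn0 : tau != 0 by rewrite gt_eqF.
have K0 : 0 <= K by apply: le_trans (gK 0%N _).
pose K' := K + om + 1.
have K'0 : 0 <= K' by rewrite /K'; lra.
pose a i := (g i.+1 - g i) / tau / 4.
pose A := 2 * (\sum_(i < m) `|a i|) + K' ^+ 3 / 3 + T * K' ^+ 5 / 3.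
have A0 : 0 <= A.
  by rewrite /A !addr_ge0// ?mulr_ge0 ?exprn_ge0 ?sumr_ge0 ?(ltW T0)//.
(* [A] is the coefficient of the tube width in [tube_action_le], so narrowing the tube to [dl] makes
   that term at most [e / 4]. The bound [dl <= 1] keeps the tube in the ball of radius [K']. *)
pose dl := Num.min (Num.min 1 delta) (e / (4 * (A + 1))).
have dl0 : 0 < dl.
  by rewrite !lt_min ltr01 d0/= divr_gt0// mulr_gt0// ltr_wpDl.
have dl1 : dl <= 1 by rewrite !ge_min lexx.
have dld : dl <= delta by rewrite !ge_min lexx orbT.
have dlA : dl * A <= e / 4.
  have : dl <= e / (4 * (A + 1)) by rewrite ge_min lexx orbT.
  rewrite ler_pdivlMr ?mulr_gt0 ?ltr_wpDl//; nra.
(* With this [phi] one has [T (2 phi^2) = b] and [phi dl = 8 b], while a start within [dl / 4] costs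
   at most [2 b]. As [T eps <= b], the exit exponent is below [- T eps - b], and [4 <= exp (r b)]
   bounds the exit term by half of the surviving mass. *)
pose phi := dl / (16 * T).
have phi0 : 0 < phi by rewrite divr_gt0// mulr_gt0.
pose b := dl ^+ 2 / (128 * T).
have b0 : 0 < b by rewrite divr_gt0 ?exprn_gt0 ?mulr_gt0.
pose eps := Num.min (e / 4) b / T.
have eps0 : 0 < eps by rewrite divr_gt0// lt_min b0 divr_gt0.
have Teps : T * eps = Num.min (e / 4) b by rewrite mulrC divfK// gt_eqF.
have Teps1 : T * eps <= e / 4 by rewrite Teps ge_min lexx.
have Teps2 : T * eps <= b by rewrite Teps ge_min lexx orbT.
exists (dl / 4); first by rewrite divr_gt0.
pose S := flatten [seq [:: a i; a i + phi; a i - phi] | i <- iota 0 m].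
have aS i : (i < m)%N -> [/\ a i \in S, a i + phi \in S & a i - phi \in S].
  move=> im; have iI : i \in iota 0 m by rewrite mem_iota.
  by split; apply/flatten_mapP; exists i => //; rewrite !inE eqxx ?orbT.
have e4 : 0 < e / 4 by rewrite divr_gt0.
near=> n; have n0 : (0 < n)%N by near: n; exists 1%N.
have rn0 := r_gt0 n0.
have c4 : 4 <= expR (r n * b) by near: n; exact: near_expR_absorb.
have c2 : 2 <= expR (r n * (e / 4)) by near: n; exact: near_expR_absorb.
have st : \forall h \near 0^'+, forall x, x \in E n -> `|x| <= K' ->
  forall a, a \in S ->
  expR (r n * h * (2 * a ^+ 2 - x ^+ 6 / 18 - eps)) <=
  \sum_(y <- E n) k n h x y * expR (r n * (tilt a y - tilt a x)) <=
  expR (r n * h * (2 * a ^+ 2 - x ^+ 6 / 18 + eps)).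
  by near: n; exact: k_step.
have mC : measurable [set x : R | `|x - g 0%N| <= dl / 4].
  rewrite (_ : [set _ | _] = `[g 0%N - dl / 4, g 0%N + dl / 4]%classic);
    first exact: measurable_itv.
  by apply/seteqP; split=> x /=; rewrite in_itv/= ler_distl.
have [|Good [mG pG HG]] := @dyadic_stay_ge R _ _ (P n) (X n) (E n) (k n) (uE n0)
  (k_trans n0) (X_markov n0) 0 T _ (fun _ t y => `|y - polygon g tau t| <= dl)
  (lexx 0) T0 mC (expR (- r n * (c + e))).
  have [e1 /= e10 He] := st.
  have [q1 Hq1] := dyadic_step_small (ltW T0) e10.
  exists (maxn j q1) => // kk /=; rewrite geq_max => /andP[jk qk] x xE xg.
  have := Hq1 _ qk; rewrite -(subnKC jk); set q0 := (kk - j)%N.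
  set h := T / 2 ^+ (j + q0) => he.
  have h0 : 0 < h by rewrite divr_gt0 ?exprn_gt0.
  have {}st := He h; rewrite /= sub0r normrN gtr0_norm// in st.
  have {st} st := st he h0.
  pose q := (2 ^ q0)%N; pose N := (2 ^ (j + q0))%N.
  have q_gt0 : (0 < q)%N by rewrite expn_gt0.
  have qn0 : q%:R != 0 :> R by rewrite pnatr_eq0 gtn_eqF.
  have NE : N = (m * q)%N by rewrite /N expnD.
  have hE : h = tau / q%:R.
    by rewrite /h /tau /q natrX exprD; field; rewrite !expf_neq0.
  have NhT : N%:R * h = T by rewrite /N natrX mulrC divfK// expf_neq0.
  pose cc l := polygon g tau (l%:R * h).
  have ccE l : (l <= N)%N -> `|cc l| <= K + om.
    rewrite leq_eqVlt => /predU1P[->|lN].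
      have := @polygonE R g tau m 0 q tau0 (leq0n _) q_gt0.
      rewrite addn0 -hE -NE /cc => ->; rewrite mul0r mul0r addr0.
      by rewrite (le_trans (gK _ _))// lerDl.
    rewrite /cc (divn_eq l q) hE polygonE//; last by rewrite ltnW// ltn_pmod.
    have lm : (l %/ q < m)%N by rewrite ltn_divLR// -NE.
    apply: normD_le; first by apply: gK; rewrite ltnW.
    rewrite -[om]mul1r; apply: normM_le; last exact: gom.
    by rewrite ger0_norm ?divr_ge0// ler_pdivrMr ?ltr0n// mul1r ler_nat ltnW// ltn_pmod.
  apply: (@le_trans _ _ (chainE (E n) (k n h) N
      (fun s => [forall l : 'I_N.+1, `|s`_l - cc l| <= dl]%:R) x)); last first.
    apply: chainE_le => //; first exact: (k_ge0 n0 (ltW h0)).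
    move=> s _ _ _; apply: le_natr_bool => /forallP sl; apply/forallP => l.
    by rewrite add0r; exact: sl.
  have := @chain_tube R (E n) (k n h) (r n) h eps K' S (k_ge0 n0 (ltW h0)) rn0 h0
    (ltW eps0) st N (fun l => (g (l %/ q).+1 - g (l %/ q)%N) / tau) cc phi dl
    (c + e / 4) x xE (ltW phi0) (ltW dl0).
  move=> CT; apply: (fun h1 h2 h3 h4 => le_trans h4 (CT h1 h2 h3)).
  - move=> l lN; have lm : (l %/ q < m)%N by rewrite ltn_divLR// -NE.
    have [aS1 aS2 aS3] := aS _ lm; split=> //.
    rewrite /cc (divn_eq l q) -addnS hE !polygonE//; first last.
    + by rewrite ltn_pmod.
    + by rewrite ltnW// ltn_pmod.
    rewrite -divn_eq -natr1; field.
    by rewrite ?tn0 ?qn0.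
  - by move=> l lN; rewrite /K' lerD// ccE.
  - move=> s sc.
    have := @tube_action_le T dl om K' g j q0 s T0 (ltW dl0) om0 _ gom sc _.
    move=> /(_ _ _)/le_trans; apply.
    + by move=> i im; rewrite (le_trans (gK _ im))// /K'; lra.
    + move=> l lN; rewrite -(subrK (cc l) s`_l) (le_trans (ler_normD _ _))//.
      rewrite /K' addrC lerD ?ccE// (le_trans _ dl1)//; exact: sc.
    rewrite -/tau /c -/K' -/m lerD2l.
    by move: dlA; rewrite /A.
  - rewrite NhT; have -> : cc 0%N = g 0%N.
      have := @polygonE R g tau 0 0 q tau0 (leq0n _) q_gt0.
      by rewrite addn0 mul0n /cc -hE => ->; rewrite mul0r mul0r addr0.
    have xg' : phi * `|x - g 0%N| <= phi * (dl / 4) by rewrite ler_wpM2l// ltW.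
    have X1 : T * (2 * phi ^+ 2 + eps) + phi * `|x - g 0%N| - phi * dl <= - (T * eps) - b.
      have E1 : T * (2 * phi ^+ 2) = b.
        by rewrite /phi /b; field; rewrite gt_eqF.
      have E2 : phi * dl = 8 * b by rewrite /phi /b; field; rewrite gt_eqF.
      have E3 : phi * (dl / 4) = 2 * b by rewrite mulrA E2; field.
      by rewrite mulrDr E1 E2; rewrite E3 in xg'; lra.
    have X2 : 2 * expR (r n * (T * (2 * phi ^+ 2 + eps) + phi * `|x - g 0%N| - phi * dl)) <=
      2^-1 * expR (- r n * (T * eps)).
      apply: (@le_trans _ _ (2 * (expR (- r n * (T * eps)) * expR (- r n * b)))).
        rewrite ler_wpM2l// -expRD ler_expR.
        have := ler_wpM2l (ltW rn0) X1; lra.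
      have : expR (- r n * b) <= 4^-1.
        by rewrite mulNr expRN lef_pV2 ?posrE ?expR_gt0.
      have := expR_ge0 (- r n * (T * eps)); nra.
    apply: (@le_trans _ _ (expR (- r n * (c + e / 4)) *
      (2^-1 * expR (- r n * (T * eps))))); last first.
      rewrite ler_wpM2l ?expR_ge0//; lra.
    apply: (@le_trans _ _ (expR (- r n * (c + e / 4)) *
      (expR (- r n * (e / 4)) * expR (- r n * (e / 4))))).
      rewrite -!expRD ler_expR; have := mulr_gt0 rn0 e0; lra.
    rewrite ler_wpM2l ?expR_ge0// ler_pM ?expR_ge0//.
      by rewrite mulNr expRN lef_pV2 ?posrE ?expR_gt0.
    by rewrite ler_expR !mulNr lerN2 ler_wpM2l ?(ltW rn0).
exists Good; split=> // w Gw i t im /andP[it ti].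
have [_ {}HG] := HG w Gw.
have cl : forall t, i%:R * tau <= t <= i%:R * tau + tau ->
    `|X n w t - (cst (g i)) t| <= delta + om; last first.
  by apply: cl; rewrite it; move: ti; rewrite -natr1 mulrDl mul1r => /ltW.
apply: (@dyadic_right_continuous R (fun t => `|X n w t - (cst (g i)) t|)
  (i%:R * tau) tau (delta + om) 0%N tau0).
  by move=> u _; apply: cadlag_normB_right; exact: cvg_cst.
move=> q1 l _ lq /=; pose q := (2 ^ q1)%N.
have q_gt0 : (0 < q)%N by rewrite expn_gt0.
have tE : i%:R * tau + l%:R * (tau / 2 ^+ q1) = (i * q + l)%:R * (T / 2 ^+ (j + q1)).
  rewrite natrD natrM /q natrX /tau exprD; field.
  by rewrite !expf_neq0.
have tE' : (i * q + l)%:R * (T / 2 ^+ (j + q1)) = (i * q + l)%:R * (tau / q%:R).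
  by rewrite /tau /q natrX exprD; field; rewrite !expf_neq0.
have il : (i * q + l <= 2 ^ (j + q1))%N.
  rewrite expnD; apply: (@leq_trans (i.+1 * q)); last by rewrite leq_mul2r im orbT.
  by rewrite mulSn addnC leq_add2r.
have := HG (j + q1)%N _ il; rewrite add0r -tE tE tE' polygonE// => h1.
have -> : X n w ((i * q + l)%:R * (tau / q%:R)) - g i =
  (X n w ((i * q + l)%:R * (tau / q%:R)) - (g i + l%:R / q%:R * (g i.+1 - g i)))
     + l%:R / q%:R * (g i.+1 - g i) by ring.
apply: normD_le; first exact: le_trans dld.
rewrite -[om]mul1r; apply: normM_le; last exact: gom.
by rewrite ger0_norm ?divr_ge0// ler_pdivrMr ?ltr0n// mul1r ler_nat.
Unshelve. all: by end_near. Qed.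

End LowerEstimates.

(** * Absolutely continuous paths and their energy *)

Section RealIntegrals.
Variable R : realType.
Notation mu := (@lebesgue_measure R).
Implicit Types (f g gam : R -> R).

Lemma integrable_setU (A B : set R) (f : R -> R) :
  measurable A -> measurable B -> [disjoint A & B] ->
  mu.-integrable A (EFin \o f) -> mu.-integrable B (EFin \o f) ->
  mu.-integrable (A `|` B) (EFin \o f).
Proof.
move=> mA mB dAB /integrableP[mfA fA] /integrableP[mfB fB].
have mf : measurable_fun (A `|` B) (EFin \o f) by apply/measurable_funU.
apply/integrableP; split=> //.
rewrite integral_setU//; first by rewrite lte_add_pinfty.
by apply: measurableT_comp.
Qed.

Lemma integrable_itvS f (a b s t : R) : a <= s -> t <= b ->
  mu.-integrable `[a, b] (EFin \o f) -> mu.-integrable `[s, t] (EFin \o f).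
Proof.
move=> as_ tb; apply: integrableS => //= x /=; rewrite !in_itv/= => /andP[sx xt].
by rewrite (le_trans as_)// (le_trans xt).
Qed.

Lemma Rintegral_sub f (a b s t : R) : a <= s -> s <= t -> t <= b ->
  mu.-integrable `[a, b] (EFin \o f) ->
  \int[mu]_(x in `[s, t]) f x =
  \int[mu]_(x in `[a, t]) f x - \int[mu]_(x in `[a, s]) f x.
Proof.
move=> as_ st tb intf.
have intt : mu.-integrable `[a, t] (EFin \o f) by apply: integrable_itvS intf.
rewrite Rintegral_itvB ?bnd_simp//; symmetry; apply: Rintegral_itv_obnd_cbnd.
apply: integrableS intt => //= x /=; rewrite !in_itv/= => /andP[sx ->].
by rewrite (le_trans as_)// ltW.
Qed.

Lemma Rintegral_le f g (a b : R) : mu.-integrable `[a, b] (EFin \o f) ->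
  mu.-integrable `[a, b] (EFin \o g) -> (forall x, a <= x <= b -> f x <= g x) ->
  \int[mu]_(x in `[a, b]) f x <= \int[mu]_(x in `[a, b]) g x.
Proof.
move=> intf intg fg; apply: le_Rintegral => // x /=; rewrite in_itv/=; exact: fg.
Qed.

Lemma Rintegral_itv_cst (a b c : R) : a <= b ->
  \int[mu]_(x in `[a, b]) c = c * (b - a).
Proof.
rewrite le_eqVlt => /predU1P[->|ab].
  by rewrite Rintegral_cst//= set_itv1 lebesgue_measure_set1 subrr !mulr0.
transitivity (c * fine (mu `[a, b]%classic)); first exact: Rintegral_cst.
by rewrite lebesgue_measure_itv/= lte_fin ab -EFinD.
Qed.

Lemma integrable_itv_cst (a b c : R) : mu.-integrable `[a, b] (EFin \o cst c).
Proof.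
apply: measurable_bounded_integrable => //=.
  by rewrite lebesgue_measure_itv/=; case: ifP => _; rewrite ?ltry.
exists `|c|; split; first exact: num_real.
by move=> M cM x _ /=; exact: ltW.
Qed.

Lemma Rintegral_small f (a b e : R) : a <= b ->
  mu.-integrable `[a, b] (EFin \o f) -> 0 < e ->
  exists2 d, 0 < d & forall s t, a <= s -> s <= t -> t <= b -> t - s < d ->
    \int[mu]_(x in `[s, t]) `|f x| < e.
Proof.
move=> ab intf e0.
have intf' : mu.-integrable setT (EFin \o (f \_ `[a, b]%classic)).
  by rewrite -restrict_EFin; apply/(integrable_mkcond _ _).1.
have [d [d0 Hd]] := integral_normr_continuous intf' e0.
exists d => // s t as_ st tb tsd.
have -> : \int[mu]_(x in `[s, t]) `|f x| =
    \int[mu]_(x in `[s, t]) `|(f \_ `[a, b]%classic) x|.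
  apply: eq_Rintegral => x; rewrite inE/= in_itv/= => /andP[sx xt].
  by rewrite patchE mem_set//= in_itv/= (le_trans as_)// (le_trans xt).
apply: Hd => //; change (mu `[s, t]%classic < d%:E)%E.
by rewrite lebesgue_measure_itv/=; case: ifPn => _; rewrite ?lte_fin// -EFinD lte_fin.
Qed.

Lemma integrable_RZ (D : set R) f (c : R) : measurable D ->
  mu.-integrable D (EFin \o f) -> mu.-integrable D (EFin \o (fun x => c * f x)).
Proof.
move=> mD intf; have := @integrableZl _ _ _ mu D mD c _ intf.
by apply: eq_integrable => // x _ /=; rewrite EFinM.
Qed.

Lemma integrable_RD (D : set R) f g : measurable D ->
  mu.-integrable D (EFin \o f) -> mu.-integrable D (EFin \o g) ->
  mu.-integrable D (EFin \o (fun x => f x + g x)).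
Proof.
move=> mD intf intg; have := @integrableD _ _ _ mu D mD _ _ intf intg.
by apply: eq_integrable => // x _ /=; rewrite EFinD.
Qed.

Lemma integrable_RB (D : set R) f g : measurable D ->
  mu.-integrable D (EFin \o f) -> mu.-integrable D (EFin \o g) ->
  mu.-integrable D (EFin \o (fun x => f x - g x)).
Proof.
move=> mD intf intg; have := @integrableB _ _ _ mu D mD _ _ intf intg.
by apply: eq_integrable => // x _ /=; rewrite EFinB.
Qed.

Lemma integrable_RM (a b : R) f g : (a <= b) -> measurable_fun `[a, b] f ->
  (exists K, forall x, a <= x <= b -> `|f x| <= K) ->
  mu.-integrable `[a, b] (EFin \o g) ->
  mu.-integrable `[a, b] (EFin \o (fun x => f x * g x)).
Proof.
move=> ab mf [K fK] intg.
have bf : [bounded f x | x in `[a, b]%classic].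
  exists K; split; first exact: num_real.
  by move=> M KM x /=; rewrite in_itv/= => /fK /le_trans; apply; exact: ltW.
have := @integrableMr _ _ _ mu _ (measurable_itv _) _ _ mf bf intg.
by apply: eq_integrable => // x _ /=; rewrite EFinM.
Qed.

Section Velocity.
Variables (gam g : R -> R) (T : R).
Hypothesis vel : is_velocity gam g T.

Lemma velocity_integrable s t : 0 <= s -> t <= T ->
  mu.-integrable `[s, t] (EFin \o g).
Proof. by move=> s0 tT; apply: integrable_itvS (proj1 vel). Qed.

Lemma velocity_increment s t : 0 <= s -> s <= t -> t <= T ->
  gam t - gam s = \int[mu]_(x in `[s, t]) g x.
Proof.
move=> s0 st tT; have [intg gamE] := vel.
rewrite (@Rintegral_sub g 0 T)// gamE ?(le_trans s0)//.
by rewrite [gam s]gamE ?s0 ?(le_trans st)//; ring.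
Qed.

Lemma velocityS T' : T' <= T -> is_velocity gam g T'.
Proof.
move=> TT; have [intg gamE] := vel; split; first exact: integrable_itvS intg.
by move=> t /andP[t0 tT]; apply: gamE; rewrite t0 (le_trans tT).
Qed.

Lemma velocity_modulus e : 0 <= T -> 0 < e -> exists2 d, 0 < d &
  forall s t, 0 <= s -> s <= t -> t <= T -> t - s < d -> `|gam t - gam s| < e.
Proof.
move=> T0 e0; have [d d0 Hd] := Rintegral_small T0 (proj1 vel) e0.
exists d => // s t s0 st tT tsd; rewrite velocity_increment//.
apply: le_lt_trans (Hd s t s0 st tT tsd).
by apply: le_normr_Rintegral => //; exact: velocity_integrable.
Qed.

Lemma velocity_continuous : 0 <= T -> {within `[0, T], continuous gam}.
Proof.
move=> T0; have [intg gamE] := vel.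
have c : {within `[0, T], continuous (fun t => gam 0 + \int[mu]_(x in `[0, t]) g x)}.
  move=> t; apply: cvgD; first exact: cvg_cst.
  exact: (parameterized_integral_continuous T0 intg).
apply: (subspace_eq_continuous _ c).
by move=> t; rewrite inE/= in_itv/= => /gamE tE; exact: esym tE.
Qed.

Lemma path_measurable : 0 <= T -> measurable_fun `[0, T] gam.
Proof.
by move=> T0; apply: subspace_continuous_measurable_fun => //; exact: velocity_continuous.
Qed.

Lemma path_bounded : 0 <= T -> exists2 K, 0 <= K & forall t, 0 <= t <= T -> `|gam t| <= K.
Proof.
move=> T0; have [intg gamE] := vel.
have I0 : 0 <= \int[mu]_(x in `[0, T]) `|g x| by apply: Rintegral_ge0.
exists (`|gam 0| + \int[mu]_(x in `[0, T]) `|g x|); first by rewrite addr_ge0.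
move=> t /andP[t0 tT]; have -> : gam t = gam 0 + (gam t - gam 0) by ring.
apply: (le_trans (ler_normD _ _)); rewrite lerD2l velocity_increment//.
have intt := velocity_integrable (lexx 0) tT.
apply: (le_trans (le_normr_Rintegral _ intt)) => //.
have intn : mu.-integrable `[0, T] (EFin \o (fun x => `|g x|)).
  exact: (integrable_norm intg).
rewrite -subr_ge0 -(@Rintegral_sub (fun x => `|g x|) 0 T)//.
by apply: Rintegral_ge0.
Qed.

(** Jensen's inequality on one interval: integrate [2 v g - v^2 <= g^2] with [v] the mean slope. *)
Lemma energy_increment s t : mu.-integrable `[0, T] (EFin \o (fun x => g x ^+ 2)) ->
  0 <= s -> s < t -> t <= T ->
  (gam t - gam s) ^+ 2 / (t - s) <= \int[mu]_(x in `[s, t]) g x ^+ 2.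
Proof.
move=> int2 s0 st tT; pose v := (gam t - gam s) / (t - s).
have ts : 0 < t - s by rewrite subr_gt0.
have intg := velocity_integrable s0 tT.
have intc : mu.-integrable `[s, t] (EFin \o (fun x => 2 * v * g x)).
  exact: integrable_RZ.
have intv : mu.-integrable `[s, t] (EFin \o (fun x => v ^+ 2)) by exact: integrable_itv_cst.
apply: (@le_trans _ _ (\int[mu]_(x in `[s, t]) (2 * v * g x - v ^+ 2))).
  rewrite RintegralB// RintegralZl// -velocity_increment ?(ltW st)//.
  rewrite Rintegral_itv_cst ?(ltW st)// /v le_eqVlt; apply/orP; left; apply/eqP.
  by field; rewrite gt_eqF.
apply: Rintegral_le.
- exact: integrable_RB.
- exact: integrable_itvS int2.
- move=> x _; have := sqr_ge0 (g x - v); rewrite sqrrB; lra.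
Qed.

Lemma dyadic_energy_le j : 0 < T ->
  mu.-integrable `[0, T] (EFin \o (fun x => g x ^+ 2)) ->
  \sum_(i < 2 ^ j) (gam (i.+1%:R * (T / 2 ^+ j)) - gam (i%:R * (T / 2 ^+ j))) ^+ 2
    / (T / 2 ^+ j) <= \int[mu]_(x in `[0, T]) g x ^+ 2.
Proof.
move=> T0 int2; set tau := T / 2 ^+ j.
have tau0 : 0 < tau by rewrite divr_gt0 ?exprn_gt0.
have NT : (2 ^ j)%:R * tau = T by rewrite natrX mulrC divfK// expf_neq0.
pose Phi t := \int[mu]_(x in `[0, t]) g x ^+ 2.
have -> : \int[mu]_(x in `[0, T]) g x ^+ 2 =
    \sum_(i < 2 ^ j) (Phi (i.+1%:R * tau) - Phi (i%:R * tau)).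
  rewrite -(big_mkord xpredT (fun i => Phi (i.+1%:R * tau) - Phi (i%:R * tau))).
  rewrite (telescope_sumr (fun i => Phi (i%:R * tau)))// NT mul0r /Phi set_itv1.
  by rewrite Rintegral_set1 subr0.
apply: ler_sum => i _.
have i1 : i%:R * tau < i.+1%:R * tau by rewrite ltr_pM2r// ltr_nat.
have i2 : i.+1%:R * tau <= T by rewrite -NT ler_pM2r// ler_nat.
have i0 : 0 <= i%:R * tau by rewrite mulr_ge0// ltW.
rewrite /Phi -(@Rintegral_sub (fun x => g x ^+ 2) 0 T)// ?(ltW i1)//.
have -> : tau = i.+1%:R * tau - i%:R * tau :> R by rewrite -natr1; ring.
have -> : i.+1%:R * (i.+1%:R * tau - i%:R * tau) = i.+1%:R * tau by rewrite -natr1; ring.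
have -> : i%:R * (i.+1%:R * tau - i%:R * tau) = i%:R * tau by rewrite -natr1; ring.
exact: energy_increment.
Qed.

Lemma dyadic_modulus e : 0 < T -> 0 < e -> exists j0, forall j, (j0 <= j)%N ->
  forall i t, (i < 2 ^ j)%N -> i%:R * (T / 2 ^+ j) <= t <= i.+1%:R * (T / 2 ^+ j) ->
    `|gam t - gam (i%:R * (T / 2 ^+ j))| < e.
Proof.
move=> T0 e0; have [d d0 Hd] := velocity_modulus (ltW T0) e0.
have [j0 Hj] := dyadic_step_small (ltW T0) d0; exists j0 => j /Hj.
set tau := T / 2 ^+ j => taud i t ij /andP[it ti].
have tau0 : 0 < tau by rewrite divr_gt0 ?exprn_gt0.
have NT : (2 ^ j)%:R * tau = T by rewrite natrX mulrC divfK// expf_neq0.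
apply: Hd => //; first by rewrite mulr_ge0// ltW.
  by rewrite (le_trans ti)// -NT ler_pM2r// ler_nat.
by move: ti; rewrite -natr1; lra.
Qed.

(** On a cell [[s, t]], the increment of the fourth power is [c (gam t - gam s)], the integral of
    [c * g]. By continuity [c] is close to [4 gam x ^+ 3] throughout the cell, so the total error is
    a small multiple of the integral of [|g|]. *)
Lemma chain_rule4 : 0 < T ->
  mu.-integrable `[0, T] (EFin \o (fun x => gam x ^+ 3 * g x)) /\
  \int[mu]_(x in `[0, T]) (gam x ^+ 3 * g x) = (gam T ^+ 4 - gam 0 ^+ 4) / 4.
Proof.
move=> T0; have [intg gamE] := vel; have [K K0 gK] := path_bounded (ltW T0).
have mg := path_measurable (ltW T0).
have mg3 : measurable_fun `[0, T] (fun x => gam x ^+ 3) by exact: measurable_funX.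
have intG : mu.-integrable `[0, T] (EFin \o (fun x => gam x ^+ 3 * g x)).
  apply: integrable_RM => //; first exact: ltW.
  by exists (K ^+ 3) => x /gK; exact: normX_le.
split=> //; set I := \int[mu]_(x in _) _.
have intn : mu.-integrable `[0, T] (EFin \o (fun x => `|g x|)).
  exact: (integrable_norm intg).
pose N := \int[mu]_(x in `[0, T]) `|g x|.
have N0 : 0 <= N by apply: Rintegral_ge0.
suff H e : 0 < e -> `|gam T ^+ 4 - gam 0 ^+ 4 - 4 * I| <= e * N.
  suff : gam T ^+ 4 - gam 0 ^+ 4 - 4 * I = 0 by lra.
  apply/eqP; rewrite -normr_le0; apply/ler_addgt0Pl => e e0; rewrite addr0.
  apply: (le_trans (H (e / (N + 1)) _)); first by rewrite divr_gt0// ltr_wpDl.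
  by rewrite -mulrA ler_piMr ?(ltW e0)// mulrC ler_pdivrMr ?ltr_wpDl// mul1r; lra.
(* The 18 counts the quadratic monomials in the factorisation of [c - 4 gam x ^+ 3] below:
   [(1 + 2 + 3) + 4 * 3]. *)
move=> e0; pose e' := e / (18 * (K ^+ 2 + 1)).
have K20 : 0 <= K ^+ 2 by rewrite exprn_ge0.
have e'0 : 0 < e' by rewrite divr_gt0// mulr_gt0// ltr_wpDl.
have [j0 Hj] := dyadic_modulus T0 e'0; move: {Hj} (Hj j0 (leqnn _)).
set tau := T / 2 ^+ j0 => Hj.
have tau0 : 0 < tau by rewrite divr_gt0 ?exprn_gt0.
have NT : (2 ^ j0)%:R * tau = T by rewrite natrX mulrC divfK// expf_neq0.
pose Phi t := \int[mu]_(x in `[0, t]) (gam x ^+ 3 * g x).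
pose Psi t := \int[mu]_(x in `[0, t]) `|g x|.
have tel (F : R -> R) : F T - F 0 = \sum_(i < 2 ^ j0) (F (i.+1%:R * tau) - F (i%:R * tau)).
  rewrite -(big_mkord xpredT (fun i => F (i.+1%:R * tau) - F (i%:R * tau))).
  by rewrite (telescope_sumr (fun i => F (i%:R * tau)))// NT mul0r.
have Phi0 : Phi 0 = 0 by rewrite /Phi set_itv1 Rintegral_set1.
have Psi0 : Psi 0 = 0 by rewrite /Psi set_itv1 Rintegral_set1.
have -> : N = Psi T - Psi 0 by rewrite Psi0 subr0.
have -> : gam T ^+ 4 - gam 0 ^+ 4 - 4 * I =
    (gam T ^+ 4 - 4 * Phi T) - (gam 0 ^+ 4 - 4 * Phi 0) by rewrite Phi0 /Phi -/I; ring.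
rewrite (tel (fun t => gam t ^+ 4 - 4 * Phi t)) (tel Psi) mulr_sumr.
apply: (le_trans (ler_norm_sum _ _ _)); apply: ler_sum => i _.
set s := i%:R * tau; set t := i.+1%:R * tau.
have st : s < t by rewrite ltr_pM2r// ltr_nat.
have tT : t <= T by rewrite -NT ler_pM2r// ler_nat.
have s0 : 0 <= s by rewrite mulr_ge0// ltW.
rewrite /Psi -(@Rintegral_sub (fun x => `|g x|) 0 T)// ?(ltW st)//.
pose c := gam t ^+ 3 + gam t ^+ 2 * gam s + gam t * gam s ^+ 2 + gam s ^+ 3.
have intst := velocity_integrable s0 tT.
have intGst : mu.-integrable `[s, t] (EFin \o (fun x => gam x ^+ 3 * g x)).
  exact: integrable_itvS intG.
have -> : gam t ^+ 4 - 4 * Phi t - (gam s ^+ 4 - 4 * Phi s) =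
    \int[mu]_(x in `[s, t]) (c * g x - 4 * (gam x ^+ 3 * g x)).
  rewrite RintegralB//; last 2 first.
    exact: integrable_RZ.
    exact: integrable_RZ.
  rewrite !RintegralZl// -velocity_increment ?(ltW st)//.
  rewrite (@Rintegral_sub (fun x => gam x ^+ 3 * g x) 0 T)// ?(ltW st)//.
  by rewrite -/(Phi s) -/(Phi t) /c; ring.
have intd : mu.-integrable `[s, t] (EFin \o (fun x => c * g x - 4 * (gam x ^+ 3 * g x))).
  by apply: integrable_RB => //; exact: integrable_RZ.
apply: (le_trans (le_normr_Rintegral _ intd)) => //.
rewrite -RintegralZl//; last exact: integrable_itvS intn.
apply: Rintegral_le.
- exact: (integrable_norm intd).
- by apply: integrable_RZ => //; exact: integrable_itvS intn.
move=> x /andP[sx xt].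
have -> : c * g x - 4 * (gam x ^+ 3 * g x) = (c - 4 * gam x ^+ 3) * g x by ring.
rewrite normrM ler_wpM2r//.
have gs : `|gam s| <= K by apply: gK; rewrite s0 (le_trans (ltW st)).
have gt : `|gam t| <= K by apply: gK; rewrite tT (le_trans s0 (ltW st)).
have gx : `|gam x| <= K by apply: gK; rewrite (le_trans s0)// (le_trans xt).
have h1 : `|gam t - gam s| <= e' by apply/ltW/Hj => //; rewrite ltW//=.
have h2 : `|gam x - gam s| <= e' by apply/ltW/Hj => //; rewrite sx.
have -> : c - 4 * gam x ^+ 3 =
  (gam t ^+ 2 + 2 * (gam t * gam s) + 3 * gam s ^+ 2) * (gam t - gam s) -
  4 * (gam x ^+ 2 + gam x * gam s + gam s ^+ 2) * (gam x - gam s) by rewrite /c; ring.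
apply: (@le_trans _ _ ((K ^+ 2 + 2 * (K * K) + 3 * K ^+ 2) * e' +
  4 * (K ^+ 2 + K * K + K ^+ 2) * e')).
  apply: (le_trans (ler_normB _ _)); apply: lerD; apply: normM_le => //.
    apply: normD_le; last by apply: normM_le; [rewrite ger0_norm|exact: normX_le].
    apply: normD_le; first exact: normX_le.
    by apply: normM_le; [rewrite ger0_norm|exact: normM_le].
  apply: normM_le; first by rewrite ger0_norm.
  apply: normD_le; last exact: normX_le.
  by apply: normD_le; [exact: normX_le|exact: normM_le].
rewrite -expr2 /e' -mulrDl; set L := _ + _.
have -> : L = 18 * K ^+ 2 by rewrite /L; ring.
rewrite mulrA ler_pdivrMr ?mulr_gt0 ?ltr_wpDl//.
by have := mulr_ge0 (ltW e0) K20; lra.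
Qed.

End Velocity.
End RealIntegrals.

Lemma EFin_Rintegral (R : realType) (D : set R) (f : R -> R) : measurable D ->
  (@lebesgue_measure R).-integrable D (EFin \o f) ->
  (\int[@lebesgue_measure R]_(x in D) (f x)%:E)%E =
  (\int[@lebesgue_measure R]_(x in D) f x)%:E.
Proof.
move=> mD intf; rewrite /Rintegral fineK//.
by have := @integrable_fin_num _ _ R (@lebesgue_measure R) D mD _ intf.
Qed.

(** * Almost everywhere limits of rapidly Cauchy sequences in L^1 *)

Section FastCauchy.
Variables (R : realType).
Notation mu := (@lebesgue_measure R).
Variables (a b A : R) (u : nat -> R -> R).
Let D : set R := `[a, b[%classic.
Hypothesis A_ge0 : 0 <= A.
Hypothesis int_u : forall m, mu.-integrable D (EFin \o u m).
Hypothesis u_fast : forall m,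
  \int[mu]_(x in D) `|u m.+1 x - u m x| <= A / (2 ^ m.+1)%:R.

Lemma mD : measurable D. Proof. exact: measurable_itv. Qed.

Lemma mu_ m : measurable_fun D (u m).
Proof. by apply/measurable_EFinP; case/integrableP: (int_u m). Qed.

Let dif m x := `|u m.+1 x - u m x|.

Lemma mdif m : measurable_fun D (fun x => (dif m x)%:E).
Proof.
apply/measurable_EFinP; apply: measurableT_comp => //.
by apply: measurable_funB; exact: mu_.
Qed.

Lemma int_dif m : mu.-integrable D (EFin \o dif m).
Proof. apply: (@integrable_norm _ _ _ mu D (fun x => u m.+1 x - u m x)).
by apply: integrable_RB; [exact: mD|exact: int_u|exact: int_u]. Qed.

Let G x := (\sum_(0 <= m <oo) (dif m x)%:E)%E.

Lemma G_ge0 x : (0 <= G x)%E.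
Proof. by apply: nneseries_ge0 => m _ _; rewrite lee_fin /dif. Qed.

Lemma intG : mu.-integrable D G.
Proof.
have mG : measurable_fun D G.
  have := @ge0_emeasurable_sum _ _ R D (fun m x => (dif m x)%:E) xpredT.
  move=> /(_ _ _)/(eq_measurable_fun G); apply.
  - by move=> x _; apply: eq_eseriesl => m.
  - by move=> m x _ _; rewrite lee_fin /dif.
  - by move=> m _; exact: mdif.
apply/integrableP; split=> //.
have -> : (fun x => `|G x|%E) = G by apply/funext => x; rewrite gee0_abs ?G_ge0.
rewrite /G integral_nneseries;
  [|exact: mD|by move=> m; exact: mdif|by move=> m x _; rewrite lee_fin /dif].
apply: (@le_lt_trans _ _ A%:E); last exact: ltry.
apply: (le_trans _ (epsilon_trick0 xpredT A_ge0)).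
apply: lee_nneseries => [m _ _|m _].
  by apply: integral_ge0 => x _; rewrite lee_fin /dif.
apply: le_trans (_ : ((\int[mu]_(x in D) dif m x)%:E <= _)%E); last first.
  by rewrite lee_fin; exact: u_fast.
by rewrite (EFin_Rintegral mD (int_dif m)).
Qed.

(** The upper limit makes the function measurable with no exceptional set to remove; it is the
    genuine limit wherever the sum [G] of the successive differences is finite, that is almost
    everywhere. *)
Definition fast_limit x := fine (limn_esup (fun m => (u m x)%:E)).

Lemma cvg_u : {ae mu, forall x, D x -> (u m x)%:E @[m --> \oo] --> (fast_limit x)%:E}.
Proof.
have := @integrable_ae _ _ _ mu D mD _ intG; apply: filterS => x Gfin Dx.
have {}Gfin := Gfin Dx.
have c1 : cvgn (series (dif ^~ x)).
  apply: nnseries_is_cvg => [m|]; first exact: normr_ge0.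
  by have := Gfin; rewrite fin_num_abs gee0_abs ?G_ge0.
have c2 : cvgn (series (fun m => u m.+1 x - u m x)) by apply: normed_cvg.
have uE m : u m x = u 0%N x + series (fun m => u m.+1 x - u m x) m.
  by rewrite /series /= (telescope_sumr (fun m => u m x))// addrC subrK.
have c3 : u m x @[m --> \oo] --> u 0%N x + limn (series (fun m => u m.+1 x - u m x)).
  by under eq_fun do rewrite uE; apply: cvgD => //; exact: cvg_cst.
have c4 : (u m x)%:E @[m --> \oo] -->
    (u 0%N x + limn (series (fun m => u m.+1 x - u m x)))%:E.
  exact: cvg_comp c3 _.
by rewrite /fast_limit (cvg_limn_einf_sup c4).2.
Qed.

Lemma fast_limit_measurable : measurable_fun D fast_limit.
Proof.
apply: measurableT_comp; first exact: fine_measurable.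
by apply: measurable_fun_limn_esup => m; apply/measurable_EFinP; exact: mu_.
Qed.

Lemma dom m x : (`|(u m x)%:E| <= (`|u 0%N x|)%:E + G x)%E.
Proof.
rewrite abse_EFin; apply: (@le_trans _ _ ((`|u 0%N x| + \sum_(0 <= l < m) dif l x)%:E)).
  rewrite lee_fin; have -> : u m x = u 0%N x + \sum_(0 <= l < m) (u l.+1 x - u l x).
    by rewrite (telescope_sumr (fun m => u m x))// addrC subrK.
  by rewrite (le_trans (ler_normD _ _))// lerD2l ler_norm_sum.
rewrite EFinD leeD2l// -sumEFin.
by apply: (nneseries_lim_ge (P := xpredT)) => l _ _; rewrite lee_fin /dif.
Qed.

(** Dominated convergence with the majorant [|u 0| + G], simultaneously available on every [B], as
    is needed to identify the increments of the path. *)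
Lemma fast_limit_integral (B : set R) : measurable B -> B `<=` D ->
  mu.-integrable B (EFin \o fast_limit) /\
  \int[mu]_(x in B) u m x @[m --> \oo] --> \int[mu]_(x in B) fast_limit x.
Proof.
move=> mB BD.
have mf : measurable_fun B (EFin \o fast_limit).
  by apply/measurable_EFinP; exact: measurable_funS mD BD fast_limit_measurable.
have mun m : measurable_fun B (EFin \o u m).
  by apply/measurable_EFinP; exact: measurable_funS mD BD (mu_ m).
have intg : mu.-integrable B (fun x => (`|u 0%N x|)%:E + G x)%E.
  apply: (@integrableS _ _ _ mu D B _ mD mB BD); apply: integrableD; [exact: mD| |exact: intG].
  exact: (@integrable_norm _ _ _ mu D (u 0%N) (int_u 0%N)).
have cv : {ae mu, forall x, B x -> (EFin \o u m) x @[m --> \oo] --> (EFin \o fast_limit) x}.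
  by apply: (@filterS _ _ (ae_filter_ringOfSetsType mu) _ _ _ cvg_u) => x h /BD.
have dm : {ae mu, forall x, forall m, B x -> (`|(EFin \o u m) x| <= (`|u 0%N x|)%:E + G x)%E}.
  by apply: nearW => x m _; exact: dom.
have [i1 _ i3] := @dominated_convergence _ _ _ mu B mB _ _ _ mun mf cv intg dm.
split=> //; have := fine_cvg; rewrite /Rintegral => fc.
by apply: fc; rewrite -/(Rintegral _ _ _) -EFin_Rintegral.
Qed.

Lemma fast_limit_sqr (C : R) :
  (forall m, mu.-integrable D (EFin \o (fun x => u m x ^+ 2))) ->
  (forall m, \int[mu]_(x in D) u m x ^+ 2 <= C) ->
  mu.-integrable D (EFin \o (fun x => fast_limit x ^+ 2)) /\
  \int[mu]_(x in D) fast_limit x ^+ 2 <= C.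
Proof.
move=> int2 uC.
have mf2 : measurable_fun D (EFin \o (fun x => fast_limit x ^+ 2)).
  by apply/measurable_EFinP; apply: measurable_funX; exact: fast_limit_measurable.
have mu2 m : measurable_fun D (EFin \o (fun x => u m x ^+ 2)).
  by apply/measurable_EFinP; apply: measurable_funX; exact: mu_.
have key : (\int[mu]_(x in D) ((fast_limit x ^+ 2)%:E) <= C%:E)%E.
  apply: (@le_trans _ _ (\int[mu]_(x in D) limn_einf (fun m => (u m x ^+ 2)%:E))%E).
    rewrite le_eqVlt; apply/orP; left; apply/eqP; apply: ae_eq_integral => //.
      exact: mD.
      rewrite /limn_einf; apply: measurableT_comp; first exact: oppe_measurable.
      apply: measurable_fun_limn_esup => m.
      by apply: measurableT_comp; [exact: oppe_measurable|exact: mu2].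
    apply: (@filterS _ _ (ae_filter_ringOfSetsType mu) _ _ _ cvg_u) => x h /h {}h; apply/esym.
    suff /cvg_limn_einf_sup[-> _] : (u m x ^+ 2)%:E @[m --> \oo] --> (fast_limit x ^+ 2)%:E by [].
    have {}h : u m x @[m --> \oo] --> fast_limit x by exact: fine_cvg h.
    apply: cvg_comp (_ : u m x ^+ 2 @[m --> \oo] --> fast_limit x ^+ 2) _ => //.
    by rewrite !expr2; apply: cvgM.
  have := @fatou _ _ _ mu D mD (fun m x => (u m x ^+ 2)%:E) mu2.
  move=> /(_ _)/le_trans; apply; first by move=> m x _; rewrite lee_fin sqr_ge0.
  rewrite limn_einf_lim; apply: lime_le; first exact: is_cvg_einfs.
  apply: nearW => m; apply: (@le_trans _ _ (\int[mu]_(x in D) (u m x ^+ 2)%:E)%E).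
    by apply: ereal_inf_lbound; exists m => /=.
  have -> : (\int[mu]_(x in D) (u m x ^+ 2)%:E = (\int[mu]_(x in D) u m x ^+ 2)%:E)%E.
    by apply: EFin_Rintegral; [exact: mD|exact: int2].
  by rewrite lee_fin.
have int : mu.-integrable D (EFin \o (fun x => fast_limit x ^+ 2)).
  apply/integrableP; split=> //; apply: le_lt_trans (ltry C).
  under eq_integral do rewrite /= ger0_norm ?sqr_ge0//.
  exact: key.
by split=> //; rewrite -lee_fin -EFin_Rintegral//; exact: mD.
Qed.

End FastCauchy.

Lemma truncn_div (R : realType) (y : R) q : (0 < q)%N ->
  Num.truncn (y / q%:R) = (Num.truncn y %/ q)%N.
Proof.
move=> q0; have [y0|y0] := leP 0 y; last first.
  have -> : Num.truncn y = 0%N by apply/truncn0Pn; rewrite -ltNge; lra.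
  rewrite div0n; apply/truncn0Pn; rewrite -ltNge.
  by apply: lt_trans ltr01; rewrite pmulr_llt0// invr_gt0 ltr0n.
have /andP[n1 n2] := truncn_itv y0; set n := Num.truncn y in n1 n2 *.
have q0' : (0 : R) < q%:R by rewrite ltr0n.
apply: truncn_def; rewrite ler_pdivlMr// ltr_pdivrMr// -!natrM.
rewrite (le_trans _ n1) ?ler_nat ?leq_divM//=.
by apply: (lt_le_trans n2); rewrite ler_nat ltn_ceil.
Qed.

Section StepFunctions.
Variable R : realType.
Notation mu := (@lebesgue_measure R).

Lemma step_integral (tau : R) (phi : nat -> R) n : 0 < tau ->
  mu.-integrable `[0, n%:R * tau[
    (EFin \o (fun x => phi (Num.truncn (x / tau)))) /\
  \int[mu]_(x in `[0, n%:R * tau[) phi (Num.truncn (x / tau)) =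
    \sum_(0 <= i < n) tau * phi i.
Proof.
move=> tau0; elim: n => [|n [IH1 IH2]].
  rewrite mul0r set_itvco0 big_geq// Rintegral_set0; split=> //.
  exact: integrable_set0.
set D := `[n%:R * tau, n.+1%:R * tau[%classic : set R.
have nn : n%:R * tau < n.+1%:R * tau by rewrite ltr_pM2r// ltr_nat.
have n0 : 0 <= n%:R * tau by rewrite mulr_ge0// ltW.
have cellE x : D x -> Num.truncn (x / tau) = n.
  rewrite /D/= in_itv/= => /andP[x1 x2].
  by apply: truncn_def; rewrite ler_pdivlMr// ltr_pdivrMr// x1.
have mD : measurable D by exact: measurable_itv.
have muD : mu D = tau%:E.
  by rewrite /D lebesgue_measure_itv/= lte_fin nn -EFinD -mulrBl -natr1 addrAC subrr add0r mul1r.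
have intD : mu.-integrable D (EFin \o (fun x => phi (Num.truncn (x / tau)))).
  apply: (@eq_integrable _ _ _ mu D mD (EFin \o cst (phi n))).
    by move=> x; rewrite inE => /cellE/= ->.
  apply: measurable_bounded_integrable => //=; first by rewrite muD ltry.
  exists `|phi n|; split; first exact: num_real.
  by move=> M cM x _ /=; exact: ltW.
have DU : `[0, n.+1%:R * tau[%classic = `[0, n%:R * tau[ `|` D.
  apply/seteqP; split=> x; rewrite /D/= !in_itv/=.
    by move=> /andP[-> ->]; rewrite andbT; have [?|?] := ltP x (n%:R * tau); [left|right].
  move=> [/andP[-> xb]|/andP[bx ->]]; first by rewrite (lt_trans xb).
  by rewrite andbT (le_trans _ bx).
have dD : [disjoint `[0, n%:R * tau[%classic & D].
  apply/disj_setPS => x [/=]; rewrite !in_itv/= => /andP[_ xb] /andP[bx _].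
  by move: (lt_le_trans xb bx); rewrite ltxx.
have intU := integrable_setU (measurable_itv _) mD dD IH1 intD.
rewrite DU; split=> //.
transitivity (\int[mu]_(x in `[0, n%:R * tau[) phi (Num.truncn (x / tau)) +
  \int[mu]_(x in D) phi (Num.truncn (x / tau))).
  exact: (@Rintegral_setU _ _ _ mu _ _ _ (measurable_itv _) mD intU dD).
rewrite IH2 big_nat_recr//=; congr (_ + _).
transitivity (\int[mu]_(x in D) cst (phi n) x).
  by apply: eq_Rintegral => x; rewrite inE => /cellE/= ->.
transitivity (phi n * fine (mu D)); first exact: (@Rintegral_cst _ _ _ mu D mD).
by rewrite muD/= mulrC.
Qed.

End StepFunctions.

(** * Dyadic slope functions and their energy *)

Section DyadicSlopes.
Variables (R : realType) (T : R) (gam : R -> R).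
Notation mu := (@lebesgue_measure R).
Hypothesis T_gt0 : 0 < T.
Let tau j : R := T / 2 ^+ j.

Definition slope j i := (gam (i.+1%:R * tau j) - gam (i%:R * tau j)) / tau j.
Definition energy j := \sum_(0 <= i < 2 ^ j) tau j * slope j i ^+ 2.
Definition slope_fun j (x : R) := slope j (Num.truncn (x / tau j)).

Lemma dyadic_step_gt0 j : 0 < tau j.
Proof. by rewrite divr_gt0// exprn_gt0. Qed.

Lemma sum_slope j m n : (m <= n)%N ->
  \sum_(m <= i < n) tau j * slope j i = gam (n%:R * tau j) - gam (m%:R * tau j).
Proof.
move=> mn; rewrite -(telescope_sumr (fun i => gam (i%:R * tau j)) mn).
apply: eq_bigr => i _; rewrite /slope mulrC divfK//.
by rewrite gt_eqF// dyadic_step_gt0.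
Qed.

Lemma dyadic_stepE j k : (j <= k)%N -> tau j = (2 ^ (k - j))%:R * tau k.
Proof.
move=> jk; rewrite /tau natrX -{2}(subnK jk) exprD invfM.
by rewrite mulrCA (mulrA (_ ^+ _)) divff ?mul1r// gt_eqF// exprn_gt0.
Qed.

Lemma slope_refine j k i : (j <= k)%N ->
  \sum_(i * 2 ^ (k - j) <= l < i.+1 * 2 ^ (k - j)) tau k * slope k l =
  tau j * slope j i.
Proof.
move=> jk; rewrite sum_slope ?leq_mul2r ?leqnSn ?orbT//.
rewrite /slope [RHS]mulrC divfK ?gt_eqF ?dyadic_step_gt0//.
by rewrite (dyadic_stepE jk) !natrM -!mulrA.
Qed.

Lemma slope_fun_refine j k x : (j <= k)%N ->
  slope_fun j x = slope j (Num.truncn (x / tau k) %/ 2 ^ (k - j))%N.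
Proof.
move=> jk; rewrite /slope_fun -truncn_div ?expn_gt0//.
by rewrite (dyadic_stepE jk) invfM mulrA (mulrAC x).
Qed.

Lemma dyadic_lastE k : (2 ^ k)%:R * tau k = T.
Proof. by rewrite /tau natrX mulrC divfK// gt_eqF// exprn_gt0. Qed.

Lemma slope_fun_integral k n :
  mu.-integrable `[0, n%:R * tau k[ (EFin \o slope_fun k) /\
  \int[mu]_(x in `[0, n%:R * tau k[) slope_fun k x = gam (n%:R * tau k) - gam 0.
Proof.
have [i1 i2] := step_integral (slope k) n (dyadic_step_gt0 k).
by split=> //; rewrite i2 sum_slope// mul0r.
Qed.

Lemma slope_fun_sqr k :
  mu.-integrable `[0, T[ (EFin \o (fun x => slope_fun k x ^+ 2)) /\
  \int[mu]_(x in `[0, T[) slope_fun k x ^+ 2 = energy k.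
Proof.
have := step_integral (fun i => slope k i ^+ 2) (2 ^ k) (dyadic_step_gt0 k).
by rewrite dyadic_lastE.
Qed.

(* The slope functions form a martingale for the dyadic filtration. *)
Lemma slope_fun_orthogonal j k : (j <= k)%N ->
  mu.-integrable `[0, T[ (EFin \o (fun x => (slope_fun k x - slope_fun j x) ^+ 2)) /\
  \int[mu]_(x in `[0, T[) (slope_fun k x - slope_fun j x) ^+ 2 = energy k - energy j.
Proof.
move=> jk; set q := (2 ^ (k - j))%N.
have := step_integral (fun i => (slope k i - slope j (i %/ q)%N) ^+ 2) (2 ^ k) (dyadic_step_gt0 k).
rewrite dyadic_lastE => -[i1 i2].
have fE : (fun x => (slope_fun k x - slope_fun j x) ^+ 2) =
    (fun x => (slope k (Num.truncn (x / tau k)) -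
      slope j (Num.truncn (x / tau k) %/ q)%N) ^+ 2).
  by apply/funext => x; rewrite (slope_fun_refine x jk).
rewrite fE; split=> //; rewrite i2.
have kq : (2 ^ k = 2 ^ j * q)%N by rewrite -expnD subnKC.
have q0 : (0 < q)%N by rewrite expn_gt0.
rewrite /energy kq !big_nat_mul /= -sumrB; apply: eq_bigr => i _.
rewrite (eq_big_nat _ _ (F2 := fun l => tau k * slope k l ^+ 2 +
  (- 2 * slope j i) * (tau k * slope k l) + tau k * slope j i ^+ 2)); last first.
  move=> l /andP[l1 l2].
  have -> : (l %/ q = i)%N.
    by apply/eqP; rewrite eqn_leq -ltnS ltn_divLR// l2 leq_divRL.
  by ring.
rewrite !big_split/= -(mulr_sumr _ _ _ (-2 * _)) slope_refine// sumr_const_nat -mulnBl subSnn mul1n.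
rewrite -[_ *+ q]mulr_natl mulrA -dyadic_stepE//.
by ring.
Qed.

Lemma energy_homo : {homo energy : j k / (j <= k)%N >-> j <= k}.
Proof.
move=> j k jk; rewrite -subr_ge0; have [_ <-] := slope_fun_orthogonal jk.
by apply: Rintegral_ge0 => x _; exact: sqr_ge0.
Qed.

Lemma energyE j : energy j = \sum_(i < 2 ^ j)
  (gam (i.+1%:R * tau j) - gam (i%:R * tau j)) ^+ 2 / tau j.
Proof.
rewrite /energy big_mkord; apply: eq_bigr => i _.
have : tau j != 0 by rewrite gt_eqF// dyadic_step_gt0.
by rewrite /slope; move: (tau j) (gam _ - _) => t d t0; field.
Qed.

End DyadicSlopes.

Lemma within_continuous_right (R : realType) (f : R -> R) (a b t : R) :
  {within `[a, b], continuous f} -> a <= t < b -> f u @[u --> t^'+] --> f t.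
Proof.
move=> cf /andP[at_ tb]; have ab := le_lt_trans at_ tb.
have [ci ca _] := (continuous_within_itvP _ ab).1 cf.
move: at_; rewrite le_eqVlt => /predU1P[<- //|a_t].
by apply: cvg_at_right_filter; apply: ci; rewrite in_itv/= a_t.
Qed.

(* A path with bounded dyadic energies is absolutely continuous: along a
   subsequence the slope functions converge in L^1, and Fatou's lemma bounds
   the energy of the limit. *)
Lemma energy_velocity (R : realType) (T C : R) (gam : R -> R) : 0 < T ->
  {within `[0, T], continuous gam} ->
  (forall j, \sum_(i < 2 ^ j)
    (gam (i.+1%:R * (T / 2 ^+ j)) - gam (i%:R * (T / 2 ^+ j))) ^+ 2
      / (T / 2 ^+ j) <= C) ->
  exists g, [/\ is_velocity gam g T,
    (@lebesgue_measure R).-integrable `[0, T] (EFin \o (fun x => g x ^+ 2)) &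
    \int[@lebesgue_measure R]_(x in `[0, T]) g x ^+ 2 <= C].
Proof.
move=> T0 cg gC; pose mu := @lebesgue_measure R.
pose E := energy T gam.
have EC j : E j <= C by rewrite /E energyE.
have Ehom : {homo E : j k / (j <= k)%N >-> j <= k} := energy_homo gam T0.
have Ecv : cvgn E.
  by apply: nondecreasing_is_cvgn => //; exists C => _ [j _ <-].
have EL j : E j <= limn E by apply: nondecreasing_cvgn_le.
have /choice[J0 HJ0] : forall m, exists j, limn E - 4^-1 ^+ m < E j.
  move=> m; have : \forall j \near \oo, limn E - 4^-1 ^+ m < E j.
    by apply: (cvgr_gt _ Ecv); rewrite ltrBlDr ltrDl exprn_gt0.
  by move=> [j0 _ Hj]; exists j0; apply: Hj => /=.
(* The sum makes [J] nondecreasing with [J m >= J0 m]; the summand [m] makes it cofinal. *)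
pose J m := (m + \sum_(l < m.+1) J0 l)%N.
have Jm m : (m <= J m)%N by rewrite leq_addr.
have J0J m : (J0 m <= J m)%N.
  by rewrite /J big_ord_recr/= addnA leq_addl.
have JS m : (J m <= J m.+1)%N.
  by rewrite /J [X in (_ <= _ + X)%N]big_ord_recr/=; apply: leq_add => //; exact: leq_addr.
have Efast m k : (J m <= k)%N -> E k - E (J m) <= 4^-1 ^+ m.
  move=> Jk; have := EL k; have := HJ0 m; have := Ehom _ _ (J0J m); lra.
pose u m := slope_fun T gam (J m).
have int_u m : mu.-integrable `[0, T[ (EFin \o u m).
  by have [] := slope_fun_integral gam T0 (J m) (2 ^ J m); rewrite dyadic_lastE.
have A0 : 0 <= 1 + T by lra.
have muD : mu `[0, T[%classic = T%:E.
  by rewrite /mu lebesgue_measure_itv/= lte_fin T0 oppr0 adde0.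
have mD : measurable (`[0, T[%classic : set R) by exact: measurable_itv.
have u_fast m : \int[mu]_(x in `[0, T[) `|u m.+1 x - u m x| <= (1 + T) / (2 ^ m.+1)%:R.
  have [i1 i2] := slope_fun_orthogonal gam T0 (JS m).
  (* Weighted inequality [|d| <= c d^2 + e]: the squared L^2 distance [4^-1 ^+ m] becomes the L^1
     bound [(1 + T) / 2 ^ m.+1]. *)
  pose c : R := 2 ^+ m / 2; pose e : R := (2 ^+ m)^-1 / 2.
  have p0 : (0 : R) < 2 ^+ m by rewrite exprn_gt0.
  have intc : mu.-integrable `[0, T[ (EFin \o cst e).
    apply: measurable_bounded_integrable => //=.
      by have := muD; rewrite /mu/= => ->; rewrite ltry.
    by exists `|e|; split=> [|M cM x _ /=]; [exact: num_real|exact: ltW].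
  have int1 := integrable_RZ c mD i1.
  have int2 := integrable_RD mD int1 intc.
  apply: (@le_trans _ _ (\int[mu]_(x in `[0, T[) (c * (u m.+1 x - u m x) ^+ 2 + cst e x))).
    apply: le_Rintegral => //.
      apply: (@integrable_norm _ _ _ mu _ (fun x => u m.+1 x - u m x)).
      by apply: integrable_RB.
    move=> x _; rewrite /c /e/=; move: (u m.+1 x - u m x) => d.
    rewrite -[d ^+ 2]real_normK ?num_real//; move: `|d| => {}d.
    rewrite -(ler_pM2l p0) mulrDr !mulrA divff ?gt_eqF// mul1r.
    have := sqr_ge0 (2 ^+ m * d - 1); nra.
  rewrite (@RintegralD _ _ _ mu _ _ _ mD int1 intc) (@RintegralZl _ _ _ mu _ _ c mD i1).
  rewrite [X in _ * X]i2 (@Rintegral_cst _ _ _ mu _ mD) [X in fine X]muD/=.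
  apply: (@le_trans _ _ (c * 4^-1 ^+ m + e * T)).
    by rewrite lerD2r ler_pM2l ?divr_gt0//; exact: Efast.
  rewrite /c /e natrX exprSr invfM mulrDl mul1r.
  have -> : (4^-1 : R) ^+ m = (2 ^+ m)^-1 * (2 ^+ m)^-1.
    by rewrite -invfM -exprMn exprVn; congr (_ ^-1); congr (_ ^+ _); ring.
  rewrite (mulrAC (2 ^+ m)) mulrA divff ?gt_eqF// mul1r lerD2l.
  by rewrite mulrC.
pose g := fast_limit u.
have [intg sqrg] : mu.-integrable `[0, T[ (EFin \o (fun x => g x ^+ 2)) /\
    \int[mu]_(x in `[0, T[) g x ^+ 2 <= C.
  apply: (fast_limit_sqr A0 int_u u_fast) => m; have [] := slope_fun_sqr gam T0 (J m) => //.
  by move=> _ ->; exact: EC.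
have closeI (f : R -> R) : mu.-integrable `[0, T[ (EFin \o f) -> mu.-integrable `[0, T] (EFin \o f).
  move=> /integrableP[mf fi]; have mf' : measurable_fun `[0, T] (EFin \o f).
    by apply/emeasurable_fun_itv_bndo_bndcP.
  apply/integrableP; split=> //; rewrite -integral_itv_bndo_bndc//.
  exact: measurableT_comp mf.
have lim_int := fast_limit_integral A0 int_u u_fast.
have intg1 : mu.-integrable `[0, T[ (EFin \o g) by have [] := lim_int _ mD (@subset_refl _ _).
have intg1' := closeI _ intg1.
have dyad j i : (i <= 2 ^ j)%N -> gam (i%:R * (T / 2 ^+ j)) - gam 0 =
    \int[mu]_(x in `[0, i%:R * (T / 2 ^+ j)]) g x.
  move=> ij; set t := i%:R * _.
  have tT : t <= T.
    by rewrite -[leRHS](dyadic_lastE T j) ler_wpM2r ?ler_nat// divr_ge0 ?exprn_ge0// ltW.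
  have sub : (`[0, t[%classic : set R) `<=` `[0, T[%classic.
    by move=> x /=; rewrite !in_itv/= => /andP[-> xt]; rewrite (lt_le_trans xt).
  have [it lt] := lim_int _ (measurable_itv _) sub.
  rewrite -Rintegral_itv_bndo_bndc//; have <- := cvg_lim (@Rhausdorff R) lt.
  apply/esym/cvg_lim; first exact: Rhausdorff.
  (* Up to a dyadic time of level [j], every slope function of level at least [j] integrates exactly
     to the increment of the path, so the sequence of integrals is eventually constant. *)
  apply: cvg_near_cst; exists j => // m /= jm.
  have jJ : (j <= J m)%N by exact: leq_trans jm (Jm m).
  have -> : t = (i * 2 ^ (J m - j))%:R * (T / 2 ^+ (J m)).
    by rewrite natrM -mulrA -dyadic_stepE.
  by have [_] := slope_fun_integral gam T0 (J m) (i * 2 ^ (J m - j)).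
exists g; split; first split=> //; last 2 first.
- exact: closeI.
- by rewrite -Rintegral_itv_bndo_bndc.
move=> t /andP[t0 tT].
pose c s := gam s - gam 0 - \int[mu]_(x in `[0, s]) g x.
have cc : {within `[0, T], continuous (fun s => `|c s|)}.
  move=> s; apply: cvg_norm; apply: cvgB.
    by apply: cvgB; [exact: cg|exact: cvg_cst].
  exact: (parameterized_integral_continuous (ltW T0) intg1').
have : `|c t| <= 0.
  apply: (@dyadic_right_continuous _ (fun s => `|c s|) 0 T 0 0 T0); last by rewrite t0 add0r.
    by move=> s; rewrite add0r => sT; exact: within_continuous_right cc sT.
  by move=> k l _ lk; rewrite add0r /c dyad// subrr normr0.
rewrite normr_le0 /c subr_eq0 => /eqP <-.
by rewrite addrC subrK.
Qed.

(** * The velocity of a path and the expansion of its action *)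

Section Velocity.
Variable R : realType.
Notation mu := (@lebesgue_measure R).
Implicit Types (gam f g h : R -> R).

(** Extended by 0, the function has a primitive that vanishes on the whole line; Lebesgue
    differentiation recovers it almost everywhere. *)
Lemma Rintegral_primitive_eq0 h (T : R) : mu.-integrable `[0, T] (EFin \o h) ->
  (forall t, 0 <= t <= T -> \int[mu]_(x in `[0, t]) h x = 0) ->
  {ae mu, forall x, (`[0, T]%classic : set R) x -> h x = 0}.
Proof.
move=> inth h0; pose f := h \_ (`[0, T]%classic : set R).
have intf : mu.-integrable setT (EFin \o f).
  by rewrite /f -restrict_EFin; apply/(integrable_mkcond _ _).1.
have intS (D : set R) : measurable D -> mu.-integrable D (EFin \o f).
  by move=> mD; exact: (@integrableS _ _ _ mu setT D _ measurableT mD (@subsetT _ _)).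
have Fx0 x : \int[mu]_(t in `]-oo, x]) f t = 0.
  have fE (D : set R) : \int[mu]_(t in D) f t = \int[mu]_(t in D `&` `[0, T]%classic) h t.
    transitivity (\int[mu]_t (f \_ D) t); first exact: Rintegral_mkcond.
    transitivity (\int[mu]_t (h \_ (D `&` `[0, T]%classic)) t); last by rewrite -Rintegral_mkcond.
    by congr (Rintegral mu setT _); apply/funext => t; rewrite /f -patch_setI.
  rewrite fE; have [x0|x0] := ltP x 0.
    rewrite (_ : _ `&` _ = set0) ?Rintegral_set0//; apply/seteqP; split=> // t /=.
    rewrite !in_itv/= => -[tx /andP[t0 _]].
    by move: (le_lt_trans (le_trans t0 tx) x0); rewrite ltxx.
  have [T0|T0] := ltP T 0.
    rewrite (_ : _ `&` _ = set0) ?Rintegral_set0//; apply/seteqP; split=> // t /=.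
    rewrite !in_itv/= => -[tx /andP[t0 tT]].
    by move: (le_lt_trans (le_trans t0 tT) T0); rewrite ltxx.
  rewrite (_ : _ `&` _ = `[0, Num.min x T]%classic).
    by apply: h0; rewrite le_min x0 T0/= ge_min lexx orbT.
  apply/seteqP; split=> t /=; rewrite !in_itv/= le_min.
    by move=> [-> /andP[-> ->]].
  by move=> /andP[-> /andP[-> ->]].
have locf : locally_integrable [set: R] f by exact: integrable_locally.
have := @FTC1Ny R f (fun y => intS _ (measurable_itv _)) locf.
apply: filterS; first exact: (ae_filter_ringOfSetsType mu).
move=> x [_ + ] xD; rewrite (_ : (fun x => _) = cst 0); last by apply/funext => y; exact: Fx0.
by rewrite derive1_cst /f patchE mem_set.
Qed.

Lemma velocity_unique gam g h (T : R) : is_velocity gam g T -> is_velocity gam h T ->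
  {ae mu, forall x, (`[0, T]%classic : set R) x -> g x = h x}.
Proof.
move=> [ig gE] [ih hE].
have := @Rintegral_primitive_eq0 (fun x => g x - h x) T.
have mD : measurable (`[0, T]%classic : set R) by exact: measurable_itv.
move=> /(_ (integrable_RB mD ig ih)) H.
suff : forall t, 0 <= t <= T -> \int[mu]_(x in `[0, t]) (g x - h x) = 0.
  move=> /H; apply: filterS; first exact: (ae_filter_ringOfSetsType mu).
  by move=> x gh /gh/eqP; rewrite subr_eq0 => /eqP.
move=> t /andP[t0 tT].
have igt := integrable_itvS (lexx 0) tT ig; have iht := integrable_itvS (lexx 0) tT ih.
rewrite (@RintegralB _ _ _ mu _ _ _ (measurable_itv _) igt iht).
have := gE t; have := hE t; rewrite t0 tT => /(_ isT) + /(_ isT).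
lra.
Qed.

Lemma velocity_sqr_eq gam g h (T : R) : is_velocity gam g T -> is_velocity gam h T ->
  mu.-integrable `[0, T] (EFin \o (fun x => g x ^+ 2)) ->
  mu.-integrable `[0, T] (EFin \o (fun x => h x ^+ 2)) /\
  \int[mu]_(x in `[0, T]) h x ^+ 2 = \int[mu]_(x in `[0, T]) g x ^+ 2.
Proof.
move=> vg vh ig2; have ae := velocity_unique vg vh.
have mD : measurable (`[0, T]%classic : set R) by exact: measurable_itv.
have mh : measurable_fun `[0, T] (EFin \o (fun x => h x ^+ 2)).
  apply/measurable_EFinP; apply: measurable_funX; apply/measurable_EFinP.
  by case: vh => /integrableP[].
have mg : measurable_fun `[0, T] (EFin \o (fun x => g x ^+ 2)) by case/integrableP: ig2.
have E : (\int[mu]_(x in `[0%R, T]) (h x ^+ 2)%:E = \int[mu]_(x in `[0%R, T]) (g x ^+ 2)%:E)%E.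
  apply: (@ae_eq_integral _ _ _ mu _ _ _ mD mh mg).
  by apply: (@filterS _ _ (ae_filter_ringOfSetsType mu) _ _ _ ae) => x /= H /H ->.
split; last by rewrite /Rintegral E.
apply/integrableP; split=> //.
have absE (f : R -> R) : (fun x => `|(EFin \o (fun y => f y ^+ 2)%R) x|)%E =
    (fun x => (f x ^+ 2)%:E).
  by apply/funext => x /=; rewrite ger0_norm ?sqr_ge0.
rewrite absE E; case/integrableP: ig2 => _; by rewrite absE.
Qed.

(** Absolute continuity supplies a density for each horizon separately, whereas [velocity] selects
    one for all horizons; it has to be shown that the latter exists. *)
Lemma AC_velocity gam : Defs.AC gam -> forall T, 0 <= T -> is_velocity gam (velocity gam) T.
Proof.
move=> ACg; apply: (@xgetPex _ _ [set g | forall T, 0 <= T -> is_velocity gam g T]).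
have /choice[G HG] : forall k : nat, exists g, is_velocity gam g k%:R.
  by move=> k; exact: ACg.
(* Gluing: on [[n, n + 1[] take the density chosen for the horizon [n + 1]. *)
pose g x := G (Num.truncn x).+1 x.
have key n : mu.-integrable `[0, n%:R[ (EFin \o g) /\
    forall t, 0 <= t <= n%:R -> \int[mu]_(x in `[0, t[) g x = gam t - gam 0.
  elim: n => [|n [IH1 IH2]].
    split; first by rewrite set_itvco0; exact: integrable_set0.
    move=> t /andP[t0 tle]; have -> : t = 0 by apply/eqP; rewrite eq_le tle.
    by rewrite set_itvco0 Rintegral_set0 subrr.
  have part t : n%:R <= t <= n.+1%:R ->
      [/\ mu.-integrable `[n%:R, t[ (EFin \o g), mu.-integrable `[0, t[ (EFin \o g)
      & \int[mu]_(x in `[0, t[) g x = gam t - gam 0].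
    move=> /andP[nt tn].
    have mD : measurable (`[n%:R, t[%classic : set R) by exact: measurable_itv.
    have GE x : (`[n%:R, t[%classic : set R) x -> g x = G n.+1 x.
      rewrite /= in_itv/= => /andP[x1 x2]; rewrite /g (@truncn_def _ _ n)// x1/=.
      exact: lt_le_trans tn.
    have iG := velocity_integrable (HG n.+1) (ler0n _ n) tn.
    have iGo : mu.-integrable `[n%:R, t[ (EFin \o G n.+1).
      apply: (@integrableS _ _ _ mu _ _ _ (measurable_itv _) mD _ iG).
      by move=> x /=; rewrite !in_itv/= => /andP[-> /ltW].
    have ig : mu.-integrable `[n%:R, t[ (EFin \o g).
      apply: (@eq_integrable _ _ _ mu _ mD (EFin \o G n.+1)) => //.
      by move=> x; rewrite inE => /GE/= ->.
    have DU : `[0, t[%classic = `[0, n%:R[ `|` `[n%:R, t[ :> set R.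
      apply/seteqP; split=> x /=; rewrite !in_itv/=.
        by move=> /andP[-> ->]; rewrite andbT; have [?|?] := ltP x n%:R; [left|right].
      move=> [/andP[-> xb]|/andP[bx ->]]; first by rewrite (lt_le_trans xb).
      by rewrite andbT (le_trans _ bx).
    have dD : [disjoint (`[0, n%:R[%classic : set R) & `[n%:R, t[%classic].
      apply/disj_setPS => x [/=]; rewrite !in_itv/= => /andP[_ xb] /andP[bx _].
      by move: (lt_le_trans xb bx); rewrite ltxx.
    have intU := integrable_setU (measurable_itv _) mD dD IH1 ig.
    split=> //; first by rewrite DU.
    rewrite DU.
    transitivity (\int[mu]_(x in `[0, n%:R[) g x + \int[mu]_(x in `[n%:R, t[) g x).
      exact: (@Rintegral_setU _ _ _ mu _ _ _ (measurable_itv _) mD intU dD).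
    rewrite IH2 ?ler0n ?lexx//.
    transitivity (gam n%:R - gam 0 + \int[mu]_(x in `[n%:R, t[) G n.+1 x).
      by congr (_ + _); apply: eq_Rintegral => x; rewrite inE => /GE.
    rewrite Rintegral_itv_bndo_bndc// -(velocity_increment (HG n.+1))//.
    by rewrite addrC addrA subrK.
  have nn : n%:R <= (n.+1%:R : R) <= n.+1%:R by rewrite lexx ler_nat leqnSn.
  split; first by have [] := part _ nn.
  move=> t /andP[t0 tn]; have [ltn|nlt] := leP t n%:R; first by apply: IH2; rewrite t0.
  by have [] := part t _; rewrite ?tn ?ltW.
exists g => T T0; pose n := (Num.truncn T).+1.
have Tn : T < n%:R by exact: truncnS_gt.
have [k1 k2] := key n.
have igT : mu.-integrable `[0, T] (EFin \o g).
  apply: (@integrableS _ _ _ mu _ _ _ (measurable_itv _) (measurable_itv _) _ k1).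
  by move=> x /=; rewrite !in_itv/= => /andP[-> xT]; exact: le_lt_trans Tn.
split=> // t /andP[t0 tT].
rewrite -Rintegral_itv_bndo_bndc; last first.
  apply: (@integrableS _ _ _ mu _ _ _ (measurable_itv _) (measurable_itv _) _ igT).
  by move=> x /=; rewrite !in_itv/= => /andP[-> xT]; rewrite (le_trans (ltW xT)).
rewrite k2 ?t0 ?(le_trans tT (ltW Tn))//.
by rewrite addrC subrK.
Qed.

Lemma lagrangianE (x v : R) :
  lagrangian x v = v ^+ 2 / 8 + (x ^+ 3 * v) / 6 + x ^+ 6 / 18.
Proof. by rewrite /lagrangian real_normK ?num_real//; field. Qed.

Lemma lagrangian_ge0 (x v : R) : 0 <= lagrangian x v.
Proof. by rewrite mulr_ge0// ?invr_ge0// sqr_ge0. Qed.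

Section Action.
Variables (gam g : R -> R) (T : R).
Hypothesis T_gt0 : 0 < T.
Hypothesis vel : is_velocity gam g T.

Let mD : measurable (`[0, T]%classic : set R).
Proof. exact: measurable_itv. Qed.

Let mgam : measurable_fun `[0, T] gam.
Proof. exact: path_measurable vel (ltW T_gt0). Qed.

Let mg : measurable_fun `[0, T] g.
Proof. by apply/measurable_EFinP; case: vel => /integrableP[]. Qed.

Lemma lagrangian_measurable :
  measurable_fun `[0, T] (fun s => lagrangian (gam s) (g s)).
Proof.
rewrite (_ : (fun s => _) = (fun s => g s ^+ 2 / 8 + (gam s ^+ 3 * g s) / 6 + gam s ^+ 6 / 18)).
  apply: measurable_funD; first apply: measurable_funD;
    (apply: measurable_funM; last exact: measurable_cst).
  - exact: measurable_funX.
  - by apply: measurable_funM => //; exact: measurable_funX.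
  - exact: measurable_funX.
by apply/funext => s; rewrite lagrangianE.
Qed.

Lemma path_power_integrable n :
  mu.-integrable `[0, T] (EFin \o (fun s => gam s ^+ n)).
Proof.
have [K K0 HK] := path_bounded vel (ltW T_gt0).
apply: measurable_bounded_integrable => //=.
- by rewrite lebesgue_measure_itv/= lte_fin T_gt0 ltry.
- exact: measurable_funX.
exists (K ^+ n); split; first exact: num_real.
move=> M KM x /=; rewrite in_itv/= => /HK xK; apply: le_trans (ltW KM).
by rewrite normrX lerXn2r ?nnegrE.
Qed.

Lemma lagrangian_integral :
  mu.-integrable `[0, T] (EFin \o (fun s => g s ^+ 2)) ->
  mu.-integrable `[0, T] (EFin \o (fun s => lagrangian (gam s) (g s))) /\
  \int[mu]_(s in `[0, T]) lagrangian (gam s) (g s) =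
    (\int[mu]_(s in `[0, T]) g s ^+ 2) / 8 +
    (\int[mu]_(s in `[0, T]) gam s ^+ 6) / 18 +
    (gam T ^+ 4 - gam 0 ^+ 4) / 24.
Proof.
move=> i2; have [i3 c3] := chain_rule4 vel T_gt0.
have i6 := path_power_integrable 6.
have j2 := integrable_RZ 8^-1 mD i2.
have j3 := integrable_RZ 6^-1 mD i3.
have j6 := integrable_RZ 18^-1 mD i6.
have j23 := integrable_RD mD j2 j3.
have -> : (fun s => lagrangian (gam s) (g s)) =
    (fun s => 8^-1 * g s ^+ 2 + 6^-1 * (gam s ^+ 3 * g s) + 18^-1 * gam s ^+ 6).
  by apply/funext => s; rewrite lagrangianE; field.
split; first exact: integrable_RD.
rewrite (@RintegralD _ _ _ mu _ _ _ mD j23 j6) (@RintegralD _ _ _ mu _ _ _ mD j2 j3).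
rewrite (@RintegralZl _ _ _ mu _ _ _ mD i2) (@RintegralZl _ _ _ mu _ _ _ mD i3).
rewrite (@RintegralZl _ _ _ mu _ _ _ mD i6) c3.
by field.
Qed.

(** Finite action puts the velocity in L^2: [16 L + x^6 - v^2 = (v + 4/3 x^3)^2 + x^6 / 9 >= 0], and
    the path is bounded on [[0, T]]. *)
Lemma lagrangian_sqr_integrable :
  (\int[mu]_(s in `[0%R, T]) (lagrangian (gam s) (g s))%:E < +oo)%E ->
  mu.-integrable `[0, T] (EFin \o (fun s => g s ^+ 2)).
Proof.
move=> fin; have i6 := path_power_integrable 6.
have iL : mu.-integrable `[0, T] (EFin \o (fun s => lagrangian (gam s) (g s))).
  apply/integrableP; split; first by apply/measurable_EFinP; exact: lagrangian_measurable.
  rewrite (_ : (fun x => _) = (fun x => (lagrangian (gam x) (g x))%:E))//.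
  by apply/funext => x /=; rewrite ger0_norm ?lagrangian_ge0.
have iD := integrable_RD mD (integrable_RZ 16 mD iL) (integrable_RZ 1 mD i6).
apply: (@le_integrable _ _ _ mu _ mD _ _ _ _ iD).
  by apply/measurable_EFinP; exact: measurable_funX.
move=> x _ /=; rewrite lee_fin ger0_norm ?sqr_ge0// (le_trans _ (ler_norm _))//.
rewrite lagrangianE; move: (g x) (gam x) => v y.
rewrite -subr_ge0.
rewrite (_ : _ - _ = (v + 4 / 3 * y ^+ 3) ^+ 2 + 9^-1 * y ^+ 6); last by field.
by rewrite addr_ge0 ?sqr_ge0// mulr_ge0// ?invr_ge0// exprn_even_ge0.
Qed.

End Action.

Section InfiniteHorizon.
Variables (gam g : R -> R).
Hypothesis vel : forall T, 0 <= T -> is_velocity gam g T.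
Let L s := (lagrangian (gam s) (g s))%:E.

Let itvE : \bigcup_n (`[0, n.+1%:R]%classic : set R) = `[0, +oo[%classic.
Proof.
apply/seteqP; split=> [x [n _]|x] /=; rewrite !in_itv/= ?andbT; first by case/andP.
move=> x0; exists (Num.truncn x) => //=; rewrite in_itv/= x0/=.
by apply: ltW; exact: truncnS_gt.
Qed.

Let mL n : measurable_fun (`[0, n.+1%:R]%classic : set R) L.
Proof.
by apply/measurable_EFinP; apply: lagrangian_measurable (vel _); rewrite ?ltr0n.
Qed.

Let mLoo : measurable_fun (`[0, +oo[%classic : set R) L.
Proof.
rewrite -itvE; apply/measurable_fun_bigcup => [n|]; first exact: measurable_itv.
exact: mL.
Qed.

Lemma action_le_oo T : (\int[mu]_(s in `[0%R, T]) L s <= \int[mu]_(s in `[0%R, +oo[) L s)%E.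
Proof.
apply: (@ge0_subset_integral _ _ _ mu _ _ (measurable_itv _) (measurable_itv _) _ mLoo).
- by move=> x _; rewrite lee_fin lagrangian_ge0.
- by move=> x /=; rewrite !in_itv/= andbT => /andP[].
Qed.

Lemma action_oo_le (c : \bar R) :
  (forall n : nat, \int[mu]_(s in `[0%R, n.+1%:R]) L s <= c)%E ->
  (\int[mu]_(s in `[0%R, +oo[) L s <= c)%E.
Proof.
pose F n : set R := `[0, n.+1%:R]%classic.
have F_homo m n : (m <= n)%N -> F m `<=` F n.
  move=> mn x; rewrite /F/= !in_itv/= => /andP[-> xm].
  by rewrite (le_trans xm)// ler_nat.
have L0 x : (0 <= L x)%E by rewrite lee_fin lagrangian_ge0.
move=> H; have cv : (\int[mu]_(s in F n) L s)%E @[n --> \oo] -->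
    (\int[mu]_(s in \bigcup_n F n) L s)%E.
  apply: ge0_nondecreasing_set_cvg_integral => //.
  - by move=> m n mn; apply/subsetPset; exact: F_homo.
  - by move=> n; exact: measurable_itv.
rewrite -itvE -(cvg_lim (@ereal_hausdorff R) cv).
apply: lime_le; last by apply: nearW => n; exact: H.
by apply/cvg_ex; eexists; exact: cv.
Qed.

End InfiniteHorizon.

End Velocity.

(** * Limits of ultrafilters of paths *)

Section DyadicCells.
Variable R : realType.
Notation mu := (@lebesgue_measure R).
Variables (T : R) (j : nat).
Hypothesis T_gt0 : 0 < T.
Let tau : R := T / 2 ^+ j.

Let tau_gt0 : 0 < tau. Proof. by rewrite divr_gt0// exprn_gt0. Qed.

Let NT : (2 ^ j)%:R * tau = T.
Proof. by rewrite natrX mulrC divfK// expf_neq0. Qed.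

Lemma dyadic_cell t : 0 <= t <= T ->
  exists2 i, (i < 2 ^ j)%N & i%:R * tau <= t <= i.+1%:R * tau.
Proof.
move=> /andP[t0]; rewrite le_eqVlt => /predU1P[->|tT].
  exists (2 ^ j).-1; rewrite prednK ?expn_gt0// NT lexx andbT.
  by rewrite -[leRHS]NT ler_pM2r// ler_nat leq_pred.
have /andP[i1 i2] : (Num.truncn (t / tau))%:R <= t / tau < (Num.truncn (t / tau)).+1%:R.
  by apply: truncn_itv; rewrite divr_ge0// ltW.
exists (Num.truncn (t / tau)); last by rewrite -ler_pdivlMr// i1 -ler_pdivrMr// ltW.
rewrite -(ltr_nat R) (le_lt_trans i1)// ltr_pdivrMr//.
by rewrite NT.
Qed.

Lemma dyadic_time_itv i : (i <= 2 ^ j)%N -> 0 <= i%:R * tau <= T.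
Proof.
by move=> ij; rewrite mulr_ge0 ?(ltW tau_gt0)//= -[leRHS]NT ler_pM2r// ler_nat.
Qed.

Lemma dyadic_riemann (f : R -> R) e : mu.-integrable `[0, T] (EFin \o f) ->
  (forall i t, (i < 2 ^ j)%N -> i%:R * tau <= t <= i.+1%:R * tau ->
    `|f t - f (i%:R * tau)| <= e) ->
  `|\int[mu]_(x in `[0, T]) f x - \sum_(i < 2 ^ j) tau * f (i%:R * tau)| <= e * T.
Proof.
move=> intf fe; pose Phi t := \int[mu]_(x in `[0, t]) f x.
have -> : \int[mu]_(x in `[0, T]) f x =
    \sum_(i < 2 ^ j) (Phi (i.+1%:R * tau) - Phi (i%:R * tau)).
  rewrite -(big_mkord xpredT (fun i => Phi (i.+1%:R * tau) - Phi (i%:R * tau))).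
  rewrite (telescope_sumr (fun i => Phi (i%:R * tau)))// NT mul0r /Phi set_itv1.
  by rewrite Rintegral_set1 subr0.
rewrite -sumrB (le_trans (ler_norm_sum _ _ _))//.
have -> : e * T = \sum_(i < 2 ^ j) e * tau.
  by rewrite sumr_const card_ord -mulr_natl mulrCA NT.
apply: ler_sum => i _.
have i1 : i%:R * tau <= i.+1%:R * tau by rewrite ler_pM2r// ler_nat.
have /andP[i0 _] := dyadic_time_itv (ltnW (ltn_ord i)).
have /andP[_ i2] := dyadic_time_itv (ltn_ord i).
rewrite /Phi -(@Rintegral_sub _ f 0 T)//.
have inti := integrable_itvS i0 i2 intf.
have len : i.+1%:R * tau - i%:R * tau = tau by rewrite -natr1; ring.
rewrite ler_norml; apply/andP; split.
- rewrite -subr_ge0; have := @Rintegral_le _ (cst (f (i%:R * tau) - e)) f _ _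
    (integrable_itv_cst _ _ _) inti.
  rewrite Rintegral_itv_cst// len => H.
  suff : (f (i%:R * tau) - e) * tau <= \int[mu]_(x in `[(i%:R * tau), (i.+1%:R * tau)]) f x.
    by rewrite mulrBl; lra.
  apply: H => x xi; have := fe _ _ (ltn_ord i) xi; rewrite ler_norml /=; lra.
- rewrite -subr_ge0; have := @Rintegral_le _ f (cst (f (i%:R * tau) + e)) _ _ inti
    (integrable_itv_cst _ _ _).
  rewrite Rintegral_itv_cst// len => H.
  suff : \int[mu]_(x in `[(i%:R * tau), (i.+1%:R * tau)]) f x <= (f (i%:R * tau) + e) * tau.
    by rewrite mulrDl; lra.
  apply: H => x xi; have := fe _ _ (ltn_ord i) xi; rewrite ler_norml /=; lra.
Qed.

Lemma dyadic_riemann_pow6 (f : R -> R) K e : 0 <= K ->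
  mu.-integrable `[0, T] (EFin \o (fun t => f t ^+ 6)) ->
  (forall t, 0 <= t <= T -> `|f t| <= K) ->
  (forall i t, (i < 2 ^ j)%N -> i%:R * tau <= t <= i.+1%:R * tau ->
    `|f t - f (i%:R * tau)| <= e) ->
  `|\int[mu]_(x in `[0, T]) f x ^+ 6 - \sum_(i < 2 ^ j) tau * f (i%:R * tau) ^+ 6| <=
    6 * K ^+ 5 * e * T.
Proof.
move=> K0 f6 fK fe; apply: dyadic_riemann f6 _ => i t ij it.
have i1 := dyadic_time_itv (ltnW ij).
have t0 : 0 <= t <= T.
  case/andP: it => i3 i4; case/andP: i1 => i1 _; case/andP: (dyadic_time_itv ij) => _ i2.
  by rewrite (le_trans i1 i3) (le_trans i4).
apply: le_trans (normB_exp 5 (fK _ t0) (fK _ i1)) _.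
by rewrite ler_wpM2l ?mulr_ge0 ?exprn_ge0//; exact: fe.
Qed.

End DyadicCells.

Section SkorohodConvergence.
Variable R : realType.
Implicit Types x y : skorohod R.

Lemma skorohod_nbhd_uniform x y (T e : R) : 0 < e ->
  (forall t, 0 <= t <= T -> `|y t - x t| < e) -> skorohod_nbhd x T e y.
Proof.
move=> e0 yx; exists id; split=> //; last by move=> t _; rewrite subrr normr0.
by split; [move=> s t _ _|rewrite image_id].
Qed.

Lemma skorohod_cvg (G : set_system (skorohod R)) x : Filter G ->
  (forall T e, 0 < e -> G (skorohod_nbhd x T e)) -> G --> x.
Proof.
move=> FG Gx A; rewrite nbhsE => -[B [oB Bx] BA].
have [T [e [e0 sB]]] := oB x Bx.
by apply: filterS (Gx T e e0) => y /sB/BA.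
Qed.

Lemma skorohod_open_nbhd (U : set (skorohod R)) x : open U -> U x ->
  exists T e, 0 < e /\ skorohod_nbhd x T e `<=` U.
Proof. by move=> oU; exact: oU. Qed.

End SkorohodConvergence.

Section FilterLimits.
Variables (R : realType) (S : Type) (G : set_system S).

Lemma ultrafilter_bounded_cvg (f : S -> R) (K : R) : UltraFilter G ->
  G [set y | `|f y| <= K] -> exists l : R, f y @[y --> G] --> l.
Proof.
move=> UG GK; have [p [_ cp]] : exists p,
    (`[- K, K]%classic : set R) p /\ cluster (f y @[y --> G]) p.
  have [|p [p1 p2]] := @segment_compact R (- K) K (f y @[y --> G]) (fmap_proper_filter _ _).
    by apply: filterS GK => y yK; rewrite /= in_itv/= -ler_norml; exact: yK.
  by exists p.
exists p => B pB.
have [//|GB] := in_ultra_setVsetC (f @^-1` B) UG.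
have [z [nBz Bz]] := cp (~` B) B GB pB.
by case: nBz.
Qed.

Context {PG : ProperFilter G}.

Lemma cvg_sum_ord n (f : nat -> S -> R) (l : nat -> R) :
  (forall i, (i < n)%N -> f i y @[y --> G] --> l i) ->
  (\sum_(i < n) f i y) @[y --> G] --> \sum_(i < n) l i.
Proof.
elim: n => [|n IH] fl.
  by rewrite big_ord0; under eq_fun do rewrite big_ord0; exact: cvg_cst.
rewrite big_ord_recr/=; under eq_fun do rewrite big_ord_recr/=.
by apply: cvgD; [apply: IH => i ni; apply: fl; rewrite ltnW|exact: fl].
Qed.

Lemma cvg_eventually_le (f : S -> R) l c : f y @[y --> G] --> l ->
  G [set y | f y <= c] -> l <= c.
Proof.
move=> fl fc; have <- := cvg_lim (@Rhausdorff R) fl.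
by apply: limr_le => //; apply/cvg_ex; exists l.
Qed.

End FilterLimits.

Section LimitPath.
Variables (R : realType) (G : set_system (skorohod R)) (I0 : R -> \bar R) (s : R).
Notation mu := (@lebesgue_measure R).
Hypothesis UG : UltraFilter G.
Hypothesis G_bounded : forall T, 0 < T -> exists K,
  G [set y | forall t, 0 <= t <= T -> `|y t| <= K].
Hypothesis G_regular : forall T delta, 0 < T -> 0 < delta -> exists j0,
  forall j, (j0 <= j)%N -> G [set y | ~ path_oscillates T j delta y].
Hypothesis G_action : forall T u v a delta, 0 < T -> 0 < delta ->
  (forall x, u <= x <= v -> (a%:E < I0 x)%E) -> exists j0, forall j, (j0 <= j)%N ->
  G [set y | u <= y 0 <= v -> path_action T j y <= s - a + delta].
Hypothesis I0_good : good_rate_function I0.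

Let PG : ProperFilter G. Proof. exact: ultra_proper. Qed.

(** [Num.max t 0] yields the extension constant on the negative half-line that [is_cadlag]
    requires. *)
Definition limit_path (t : R) : R :=
  lim ((fun y : skorohod R => y (Num.max t 0)) @ G).
Notation gam := limit_path.

Lemma limit_path_cvg t : 0 <= t -> (y : skorohod R) t @[y --> G] --> gam t.
Proof.
move=> t0; have t1 : 0 < t + 1 by lra.
have [K GK] := G_bounded t1.
have [l Hl] : exists l : R, (y : skorohod R) t @[y --> G] --> l.
  apply: (ultrafilter_bounded_cvg (K := K) UG); apply: filterS GK => y; apply.
  by rewrite t0 lerDl ler01.
rewrite /gam max_l// (cvg_lim (@Rhausdorff R) Hl).
exact: Hl.
Qed.

Lemma limit_path_max t : gam t = gam (Num.max t 0).
Proof. by rewrite /gam [Num.max (Num.max _ _) _]max_l// le_max lexx orbT. Qed.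

Lemma limit_path_regular T delta : 0 < T -> 0 < delta -> exists j0, forall j, (j0 <= j)%N ->
  forall i t, (i < 2 ^ j)%N -> i%:R * (T / 2 ^+ j) <= t <= i.+1%:R * (T / 2 ^+ j) ->
    `|gam t - gam (i%:R * (T / 2 ^+ j))| <= delta.
Proof.
move=> T0 d0; have [j0 Hj0] := G_regular T0 d0; exists j0 => j /Hj0 Gj i t ij it.
have i0 : 0 <= i%:R * (T / 2 ^+ j) by rewrite mulr_ge0// divr_ge0 ?exprn_ge0// ltW.
have t0 : 0 <= t by case/andP: it => + _; exact: le_trans.
apply: (@cvg_eventually_le _ _ G _ (fun y : skorohod R => `|y t - y (i%:R * (T / 2 ^+ j))|)).
  by apply: cvg_norm; apply: cvgB; exact: limit_path_cvg.
apply: filterS Gj => y /= yo; rewrite leNgt; apply/negP => yd.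
by apply: yo; exists i, t.
Qed.

Lemma limit_path_modulus T e : 0 < T -> 0 < e -> exists2 h, 0 < h &
  forall u v, 0 <= u -> u <= v -> v <= T -> v - u < h -> `|gam v - gam u| < e.
Proof.
(* Two times at distance less than [tau] lie in the same cell or in adjacent ones, so at most three
   oscillations of size [e / 4] add up. *)
move=> T0 e0; have d0 : 0 < e / 4 by lra.
have [j0 Hj0] := limit_path_regular T0 d0; have {Hj0} := Hj0 j0 (leqnn _).
set tau := T / 2 ^+ j0 => osc.
have tau0 : 0 < tau by rewrite divr_gt0// exprn_gt0.
exists tau => // u v u0 uv vT vu.
have [|i ij iu] := @dyadic_cell R T j0 T0 u; first by rewrite u0 (le_trans uv).
rewrite -/tau in iu.
have o1 := osc i u ij iu.
have [vi|iv] := leP v (i.+1%:R * tau).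
  have o2 : `|gam v - gam (i%:R * tau)| <= e / 4.
    by apply: osc; rewrite // vi andbT (le_trans _ uv)//; case/andP: iu.
  by move: o1 o2; rewrite !ler_norml ltr_norml; lra.
have ij1 : (i.+1 < 2 ^ j0)%N.
  rewrite -(ltr_nat R) -(ltr_pM2r tau0); apply: (lt_le_trans iv).
  by rewrite natrX [leRHS]mulrC /tau divfK// expf_neq0.
have o2 : `|gam v - gam (i.+1%:R * tau)| <= e / 4.
  apply: osc; rewrite // (ltW iv)/= -[i.+2%:R]natr1 mulrDl mul1r.
  by case/andP: iu => _ iu; lra.
have o3 : `|gam (i.+1%:R * tau) - gam (i%:R * tau)| <= e / 4.
  by apply: osc; rewrite // lexx ler_pM2r// ler_nat leqnSn.
by move: o1 o2 o3; rewrite !ler_norml ltr_norml; lra.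
Qed.

Lemma limit_path_continuous : continuous gam.
Proof.
move=> t; apply/cvgrPdist_lt => e e0.
pose T := Num.max t 0 + 1.
have mt0 (x : R) : 0 <= Num.max x 0 by rewrite le_max lexx orbT.
have T0 : 0 < T by have := mt0 t; rewrite /T; lra.
have [h h0 Hh] := limit_path_modulus T0 e0.
near=> u.
have tu : `|t - u| < Num.min h 1 by near: u; apply: cvgr_dist_lt => //; rewrite lt_min h0/=.
rewrite (limit_path_max t) (limit_path_max u).
have mm : `|Num.max t 0 - Num.max u 0| <= `|t - u|.
  rewrite /Num.max; case: ltP => ht; case: ltP => hu; rewrite ?subrr ?normr0//.
  - by rewrite sub0r normrN ger0_norm// ler_normr; apply/orP; right; lra.
  - by rewrite subr0 ger0_norm// ler_normr; apply/orP; left; lra.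
have {}mm := le_lt_trans mm tu; move: mm; rewrite lt_min => /andP[mh m1].
have uT : Num.max u 0 <= T by rewrite /T; move: m1; rewrite ltr_norml; lra.
have tT : Num.max t 0 <= T by rewrite /T; lra.
have [uv|/ltW uv] := leP (Num.max u 0) (Num.max t 0).
  by apply: Hh => //; move: mh; rewrite ltr_norml; lra.
by rewrite distrC; apply: Hh => //; move: mh; rewrite ltr_norml; lra.
Unshelve. all: by end_near.
Qed.

Lemma limit_path_cadlag : is_cadlag gam.
Proof.
split=> [t|t|t t0].
- by apply: cvg_at_right_filter; exact: limit_path_continuous.
- apply/cvg_ex; exists (gam t).
  by apply: cvg_at_left_filter; exact: limit_path_continuous.
- by rewrite (limit_path_max t) (limit_path_max 0) max_r ?ltW// max_l.
Qed.

Definition limit_skorohod : skorohod R := Skorohod limit_path_cadlag.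

Lemma limit_path_uniform T e : 0 < T -> 0 < e ->
  G [set y | forall t, 0 <= t <= T -> `|y t - gam t| < e].
Proof.
move=> T0 e0; have d0 : 0 < e / 4 by lra.
have [j1 Hj1] := limit_path_regular T0 d0.
have [j2 Hj2] := G_regular T0 d0.
pose j := maxn j1 j2.
have {Hj1} o1 := Hj1 j (leq_maxl _ _); have {Hj2} o2 := Hj2 j (leq_maxr _ _).
have G3 : \forall y \near G, forall i, i \in iota 0 (2 ^ j) ->
    `|(y : skorohod R) (i%:R * (T / 2 ^+ j)) - gam (i%:R * (T / 2 ^+ j))| < e / 4.
  apply: near_all_seq => i _.
  have i0 : 0 <= i%:R * (T / 2 ^+ j) by rewrite mulr_ge0// divr_ge0 ?exprn_ge0// ltW.
  have /cvgrPdist_lt/(_ _ d0) := limit_path_cvg i0.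
  by apply: filterS => y; rewrite distrC.
apply: filterS (filterI o2 G3) => y [/= yo yg] t tT.
have [i ij it] := dyadic_cell j T0 tT.
have g1 := o1 i t ij it.
have g3 : `|y (i%:R * (T / 2 ^+ j)) - gam (i%:R * (T / 2 ^+ j))| < e / 4.
  by apply: yg; rewrite mem_iota.
have g2 : `|y t - y (i%:R * (T / 2 ^+ j))| <= e / 4.
  by rewrite leNgt; apply/negP => yd; apply: yo; exists i, t.
by move: g1 g2 g3; rewrite !ler_norml !ltr_norml; lra.
Qed.

Lemma limit_skorohod_cvg : G --> limit_skorohod.
Proof.
apply: skorohod_cvg => T e e0; pose T' := Num.max T 1.
have T'0 : 0 < T' by rewrite lt_max ltr01 orbT.
apply: filterS (limit_path_uniform T'0 e0) => y ye.
apply: skorohod_nbhd_uniform => // t /andP[t0 tT]; apply: ye.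
by rewrite t0 le_max tT.
Qed.

Lemma limit_path_action T j : 0 < T ->
  path_action T j (y : skorohod R) @[y --> G] --> path_action T j gam.
Proof.
move=> T0; have i0 i : 0 <= i%:R * (T / 2 ^+ j).
  by rewrite mulr_ge0// divr_ge0 ?exprn_ge0// ltW.
have cX n t : 0 <= t -> (y : skorohod R) t ^+ n @[y --> G] --> gam t ^+ n.
  move=> t0; elim: n => [|n IH]; first by rewrite expr0; exact: cvg_cst.
  by rewrite exprS; under eq_fun do rewrite exprS; apply: cvgM => //; exact: limit_path_cvg.
rewrite /path_action; apply: cvgD; last first.
  apply: cvgM; last exact: cvg_cst.
  by apply: cvgB; apply: cX => //; exact: ltW.
pose F i (y : R -> R) := (y (i.+1%:R * (T / 2 ^+ j)) - y (i%:R * (T / 2 ^+ j))) ^+ 2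
     / (8 * (T / 2 ^+ j)) + T / 2 ^+ j * (y (i%:R * (T / 2 ^+ j)) ^+ 6 / 18).
apply: (@cvg_sum_ord _ _ G _ (2 ^ j) (fun i (y : skorohod R) => F i y) (fun i => F i gam)) => i _.
apply: cvgD.
  apply: cvgM; last exact: cvg_cst.
  by rewrite expr2; under eq_fun do rewrite expr2; apply: cvgM; apply: cvgB; exact: limit_path_cvg.
apply: cvgM; first exact: cvg_cst.
by apply: cvgM; [exact: cX|exact: cvg_cst].
Qed.

(** Lower semicontinuity of [I0]: its sublevel sets are compact, hence closed. *)
Lemma rate_gt_nbhd x a : (a%:E < I0 x)%E -> exists2 e, 0 < e &
  forall y, x - e <= y <= x + e -> (a%:E < I0 y)%E.
Proof.
have [I0_ge0 I0_compact] := I0_good.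
move=> ax; have [a0|a0] := ltP a 0.
  by exists 1 => // y _; apply: lt_le_trans (I0_ge0 y); rewrite lte_fin.
have cl : closed [set y | (I0 y <= a%:E)%E].
  by apply: compact_closed; [exact: Rhausdorff|exact: I0_compact].
have : nbhs x (~` [set y | (I0 y <= a%:E)%E]).
  apply: open_nbhs_nbhs; split; first exact: closed_openC.
  by apply/negP; rewrite -ltNge.
move=> /nbhs_ballP[e /= e0 He]; exists (e / 2); first by rewrite divr_gt0.
move=> y ye; have : ball x e y by rewrite /ball/= ltr_norml; lra.
by move=> /He/negP; rewrite -ltNge.
Qed.

Lemma limit_path_action_le T a delta : 0 < T -> 0 < delta -> (a%:E < I0 (gam 0))%E ->
  exists j0, forall j, (j0 <= j)%N -> path_action T j gam <= s - a + delta.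
Proof.
move=> T0 d0 /rate_gt_nbhd[e e0 He].
have [j0 Hj0] := G_action T0 d0 He; exists j0 => j /Hj0 Gj.
have C := @limit_path_action T j T0; apply: (cvg_eventually_le C).
have /cvgrPdist_lt/(_ _ e0) G0 := limit_path_cvg (lexx 0).
apply: filterS (filterI Gj G0) => y [/= yj y0]; apply: yj.
by move: y0; rewrite ltr_norml; lra.
Qed.

Lemma limit_path_within T : {within `[0, T], continuous gam}.
Proof. by apply: continuous_subspaceT; exact: limit_path_continuous. Qed.

Lemma limit_path_bounded T : 0 < T -> exists2 K, 0 <= K & forall t, 0 <= t <= T -> `|gam t| <= K.
Proof.
move=> T0; have [K GK] := G_bounded T0.
have K0 t : 0 <= t <= T -> `|gam t| <= K.
  move=> tT; have t0 : 0 <= t by case/andP: tT.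
  apply: (@cvg_eventually_le _ _ G _ (fun y : skorohod R => `|y t|)).
    by apply: cvg_norm; exact: limit_path_cvg.
  by apply: filterS GK => y; apply.
exists K => //; apply: le_trans (K0 0 _) => //.
by rewrite lexx ltW.
Qed.

Lemma limit_path_power_integrable T n : 0 < T ->
  mu.-integrable `[0, T] (EFin \o (fun t => gam t ^+ n)).
Proof.
move=> T0; apply: continuous_compact_integrable; first exact: segment_compact.
apply: continuous_subspaceT => t; elim: n => [|n IH].
  by rewrite (_ : (fun _ => _) = cst 1); [exact: cvg_cst|apply/funext => u; rewrite expr0].
rewrite (_ : (fun _ => _) = (fun u => gam u * gam u ^+ n)); last first.
  by apply/funext => u; rewrite exprS.
by apply: cvgM => //; exact: limit_path_continuous.
Qed.

Lemma limit_path_velocity T a delta : 0 < T -> 0 < delta -> (a%:E < I0 (gam 0))%E ->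
  exists g, [/\ is_velocity gam g T,
    mu.-integrable `[0, T] (EFin \o (fun t => g t ^+ 2)) &
    (\int[mu]_(t in `[0, T]) g t ^+ 2) / 8 + (\int[mu]_(t in `[0, T]) gam t ^+ 6) / 18 +
      (gam T ^+ 4 - gam 0 ^+ 4) / 24 <= s - a + delta].
Proof.
move=> T0 d0 aI0; set I6 := \int[mu]_(t in `[0, T]) gam t ^+ 6.
pose C := 8 * (s - a + delta - I6 / 18 - (gam T ^+ 4 - gam 0 ^+ 4) / 24).
suff [g [g1 g2 g3]] : exists g, [/\ is_velocity gam g T,
    mu.-integrable `[0, T] (EFin \o (fun t => g t ^+ 2)) &
    \int[mu]_(t in `[0, T]) g t ^+ 2 <= C].
  by exists g; split=> //; move: g3; rewrite /C; lra.
apply: energy_velocity => //; first exact: limit_path_within.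
have d20 : 0 < delta / 2 by lra.
have [K K0 HK] := limit_path_bounded T0.
have K5 : 0 <= K ^+ 5 by rewrite exprn_ge0.
(* The error of the Riemann sum of [x^6] is then at most [9 delta], that is [delta / 2] after
   division by 18; the other half of [delta] is spent in [limit_path_action_le]. *)
pose e6 := 9 * delta / T; pose d6 := e6 / (6 * K ^+ 5 + 1).
have e60 : 0 < e6 by rewrite !mulr_gt0// invr_gt0.
have d60 : 0 < d6 by rewrite divr_gt0// ltr_wpDl// mulr_ge0.
have [j1 Hj1] := limit_path_action_le T0 d20 aI0.
have [j2 Hj2] := limit_path_regular T0 d60.
have large j : (maxn j1 j2 <= j)%N -> energy T gam j <= C.
  rewrite geq_max => /andP[/Hj1 A1 /Hj2 A2].
  have := dyadic_riemann_pow6 T0 K0 (limit_path_power_integrable 6 T0) HK A2.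
  have : 6 * K ^+ 5 * d6 * T <= 9 * delta.
    have -> : 9 * delta = e6 * T by rewrite /e6 divfK// gt_eqF.
    rewrite ler_pM2r// /d6 mulrA ler_pdivrMr ?ltr_wpDl ?mulr_ge0//.
    by rewrite mulrC ler_pM2l// lerDl.
  rewrite energyE// -/I6; move: A1; rewrite path_actionE ler_norml /C.
  move: (\sum_(i < _) _) (\sum_(i < _) _) (6 * K ^+ 5 * d6 * T) => u v w.
  move=> H1 H2 /andP[H3 H4]; lra.
(* Dyadic energies increase with the level, so the bound at fine levels covers all levels. *)
move=> j; rewrite -energyE//.
apply: (@le_trans _ _ (energy T gam (maxn j (maxn j1 j2)))); last by apply: large; exact: leq_maxr.
by apply: energy_homo => //; exact: leq_maxl.
Qed.

Lemma limit_path_AC : Defs.AC gam.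
Proof.
move=> T T0; have T1 : 0 < T + 1 by lra.
(* The value -1 is admissible whatever [I0 (gam 0)] is, even before that value is known to be
   finite. *)
have a0 : ((-1)%:E < I0 (gam 0))%E.
  by apply: lt_le_trans (proj1 I0_good _); rewrite lte_fin; lra.
have [g [g1 _ _]] := limit_path_velocity T1 ltr01 a0.
by exists g; apply: (velocityS g1); lra.
Qed.

Lemma limit_path_rate : (cw_rate I0 limit_skorohod <= s%:E)%E.
Proof.
rewrite /cw_rate asboolT; last exact: limit_path_AC.
set v := velocity _; have vel := AC_velocity limit_path_AC.
have act a : (a%:E < I0 (gam 0))%E ->
    (\int[mu]_(t in `[0%R, +oo[) (lagrangian (gam t) (v t))%:E <= (s - a)%:E)%E.
  move=> aI0; apply: (action_oo_le vel) => n.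
  have n0 : (0 : R) < n.+1%:R by rewrite ltr0n.
  have bnd delta : 0 < delta ->
      mu.-integrable `[0, n.+1%:R] (EFin \o (fun t => lagrangian (gam t) (v t))) /\
      \int[mu]_(t in `[0, n.+1%:R]) lagrangian (gam t) (v t) <= s - a + delta.
    move=> d0; have [g [g1 g2 g3]] := limit_path_velocity n0 d0 aI0.
    have [v2 vE] := velocity_sqr_eq g1 (vel _ (ltW n0)) g2.
    have [i1 i2] := lagrangian_integral n0 (vel _ (ltW n0)) v2.
    by split=> //; rewrite i2 vE.
  have [i1 _] := bnd 1 ltr01.
  rewrite (EFin_Rintegral (measurable_itv _) i1) lee_fin.
  by apply/ler_addgt0Pr => e /bnd[].
have pos : (0 <= \int[mu]_(t in `[0%R, +oo[) (lagrangian (gam t) (v t))%:E)%E.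
  by apply: integral_ge0 => t _; rewrite lee_fin lagrangian_ge0.
move: act pos; move: (integral _ _ _) => A; change (limit_skorohod 0) with (gam 0).
have := proj1 I0_good (gam 0); case: (I0 (gam 0)) => [x||]//.
- move=> _ act A0.
  have Ale : (A <= (s - x)%:E)%E.
    apply/lee_addgt0Pr => e e0; have xe : ((x - e)%:E < x%:E)%E by rewrite lte_fin; lra.
    by have := act _ xe; rewrite -EFinD (_ : s - (x - e) = s - x + e)//; lra.
  by case: A A0 Ale {act} => [r||]//; rewrite -?EFinD !lee_fin; lra.
(* An infinite initial rate would bound the nonnegative action by -1. *)
- move=> _ act A0; have := act (s + 1) (ltry _).
  by move=> /(le_trans A0); rewrite lee_fin opprD addrA subrr sub0r oppr_ge0 ler10.
Qed.

End LimitPath.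

(** * The rate function *)

Section RateFunction.
Variables (R : realType) (I0 : R -> \bar R).
Notation mu := (@lebesgue_measure R).
Hypothesis I0_good : good_rate_function I0.

Lemma rate0_ge0 x : (0 <= I0 x)%E.
Proof. exact: (proj1 I0_good). Qed.

Lemma rate0_bounded (c : R) : exists2 K, 0 <= K & forall x, (I0 x <= c%:E)%E -> `|x| <= K.
Proof.
have c0 : 0 <= Num.max c 0 by rewrite le_max lexx orbT.
have /compact_bounded[M [_ HM]] := proj2 I0_good _ c0.
exists (`|M| + 1); first by rewrite addr_ge0.
move=> x xc; apply: HM; first by rewrite ltr_pwDr// ler_norm.
by rewrite /= (le_trans xc)// lee_fin le_max lexx.
Qed.

Lemma action_ge0 (gam g : R -> R) (D : set R) :
  (0 <= \int[mu]_(s in D) (lagrangian (gam s) (g s))%:E)%E.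
Proof. by apply: integral_ge0 => t _; rewrite lee_fin lagrangian_ge0. Qed.

Lemma cw_rate_ge0 (gam : skorohod R) : (0 <= cw_rate I0 gam)%E.
Proof.
rewrite /cw_rate; case: ifP => // _.
by apply: adde_ge0; [exact: rate0_ge0|exact: action_ge0].
Qed.

Lemma path_action_le (gam g : R -> R) T j K d : 0 < T -> 0 <= K -> is_velocity gam g T ->
  mu.-integrable `[0, T] (EFin \o (fun s => g s ^+ 2)) ->
  (forall t, 0 <= t <= T -> `|gam t| <= K) ->
  (forall i t, (i < 2 ^ j)%N -> i%:R * (T / 2 ^+ j) <= t <= i.+1%:R * (T / 2 ^+ j) ->
    `|gam t - gam (i%:R * (T / 2 ^+ j))| <= d) ->
  path_action T j gam <=
    \int[mu]_(s in `[0, T]) lagrangian (gam s) (g s) + K ^+ 5 * d * T / 3.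
Proof.
move=> T0 K0 vel g2 HK osc; have [_ ->] := lagrangian_integral T0 vel g2.
have en := dyadic_energy_le vel j T0 g2.
have riem := dyadic_riemann_pow6 T0 K0 (path_power_integrable T0 vel 6) HK osc.
rewrite path_actionE.
move: riem en; rewrite ler_norml => /andP[+ _].
rewrite (_ : 6 * K ^+ 5 * d * T = 6 * (K ^+ 5 * d * T)); last by ring.
move: (\sum_(i < _) _) (\sum_(i < _) _) (K ^+ 5 * d * T) => u v w; lra.
Qed.

Lemma cw_rate_leP (gam : skorohod R) (c : R) : (cw_rate I0 gam <= c%:E)%E ->
  exists x : R, [/\ I0 (gam 0) = x%:E, 0 <= x,
    forall T, 0 <= T -> is_velocity gam (velocity gam) T,
    forall T, 0 < T ->
      mu.-integrable `[0, T] (EFin \o (fun s => velocity gam s ^+ 2)) &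
    forall T, 0 < T ->
      \int[mu]_(s in `[0, T]) lagrangian (gam s) (velocity gam s) <= c - x].
Proof.
rewrite /cw_rate; case: ifPn => // /asboolP ACg; have vel := AC_velocity ACg.
set A := integral _ _ _ => IA.
have A0 : (0 <= A)%E by exact: action_ge0.
have I00 := rate0_ge0 (gam 0).
move: IA I00; case: (I0 (gam 0)) => [x||]//; last first.
  by case: A A0 => // r _.
case EA : A A0 => [r||]// r0; rewrite -EFinD !lee_fin => xr x0.
exists x; split=> //.
  move=> T T0; apply: (lagrangian_sqr_integrable T0 (vel _ (ltW T0))).
  by apply: le_lt_trans (action_le_oo vel T) _; rewrite -/A EA ltry.
move=> T T0; have g2 : mu.-integrable `[0, T] (EFin \o (fun s => velocity gam s ^+ 2)).
  apply: (lagrangian_sqr_integrable T0 (vel _ (ltW T0))).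
  by apply: le_lt_trans (action_le_oo vel T) _; rewrite -/A EA ltry.
have [iL _] := lagrangian_integral T0 (vel _ (ltW T0)) g2.
have := action_le_oo vel T; rewrite -/A EA (EFin_Rintegral (measurable_itv _) iL) lee_fin.
lra.
Qed.

(** In the expanded action all terms but the exact differential are nonnegative, so
    [gam t ^+ 4 <= gam 0 ^+ 4 + 24 c] at every time; [gam 0] lies in a sublevel set of [I0]. *)
Lemma cw_rate_bounded c : 0 <= c -> exists2 K, 0 <= K & forall gam : skorohod R,
  (cw_rate I0 gam <= c%:E)%E -> forall t, 0 <= t -> `|gam t| <= K.
Proof.
move=> c0; have [K0 K00 HK0] := rate0_bounded c.
have K04 : 0 <= K0 ^+ 4 by rewrite exprn_ge0.
pose K := K0 ^+ 4 + 24 * c + 1 + K0; have K1 : 1 <= K by rewrite /K; lra.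
exists K => [|gam gc t]; first by rewrite (le_trans _ K1).
have [x [I0x x0 vel g2 gL]] := cw_rate_leP gc.
have L1 : 0 <= \int[mu]_(s in `[0, 1]) lagrangian (gam s) (velocity gam s).
  by apply: Rintegral_ge0 => s _; exact: lagrangian_ge0.
have g0K : `|gam 0| <= K0 by apply: HK0; rewrite I0x lee_fin;
  have := le_trans L1 (gL 1 ltr01); rewrite subr_ge0.
rewrite le_eqVlt => /predU1P[<-|t0]; first by rewrite (le_trans g0K)// /K; lra.
have [_ E] := lagrangian_integral t0 (vel _ (ltW t0)) (g2 _ t0).
have := gL _ t0; rewrite E.
have p2 : 0 <= \int[mu]_(s in `[0, t]) velocity gam s ^+ 2.
  by apply: Rintegral_ge0 => s _; exact: sqr_ge0.
have p6 : 0 <= \int[mu]_(s in `[0, t]) gam s ^+ 6.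
  by apply: Rintegral_ge0 => s _; rewrite exprn_even_ge0.
have g04 : gam 0 ^+ 4 <= K0 ^+ 4.
  by rewrite (le_trans (ler_norm _))// normrX lerXn2r.
move=> H; rewrite leNgt; apply/negP => Kt.
have : K ^+ 4 < gam t ^+ 4.
  rewrite -[gam t ^+ 4]ger0_norm ?exprn_even_ge0// normrX ltrXn2r//.
  by rewrite (le_trans _ K1).
have : K <= K ^+ 4 by rewrite exprS ler_peMr ?exprn_ege1// (le_trans _ K1).
rewrite {1}/K; move: H p2 p6 g04 x0 c0 K00.
move: (Rintegral _ _ _) (Rintegral _ _ _) (gam t ^+ 4) (gam 0 ^+ 4) (K ^+ 4) (K0 ^+ 4) => *.
lra.
Qed.

(** The expanded action bounds the energy by [C], and by [energy_increment] the squared increment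
    over part of a cell is at most [C] times its length. *)
Lemma cw_rate_modulus c T d : 0 <= c -> 0 < T -> 0 < d -> exists j0, forall j, (j0 <= j)%N ->
  forall gam : skorohod R, (cw_rate I0 gam <= c%:E)%E ->
  forall i t, (i < 2 ^ j)%N -> i%:R * (T / 2 ^+ j) <= t <= i.+1%:R * (T / 2 ^+ j) ->
    `|gam t - gam (i%:R * (T / 2 ^+ j))| <= d.
Proof.
move=> c0 T0 d0; have [K K0 HK] := cw_rate_bounded c0.
have K4 : 0 <= K ^+ 4 by rewrite exprn_ge0.
pose C := 8 * c + K ^+ 4 / 3 + 1; have C0 : 0 < C by rewrite /C; lra.
have e0 : 0 < d ^+ 2 / C by rewrite divr_gt0 ?exprn_gt0.
have [j0 Hj0] := dyadic_step_small (ltW T0) e0; exists j0 => j /Hj0.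
rewrite ltr_pdivlMr// => tauC gam gc i t ij it.
have [x [I0x x0 vel g2 gL]] := cw_rate_leP gc.
have [_ E] := lagrangian_integral T0 (vel _ (ltW T0)) (g2 _ T0).
have p6 : 0 <= \int[mu]_(s in `[0, T]) gam s ^+ 6.
  by apply: Rintegral_ge0 => s _; rewrite exprn_even_ge0.
have g04 : gam 0 ^+ 4 <= K ^+ 4.
  by rewrite (le_trans (ler_norm _))// normrX lerXn2r// HK.
have gT4 : 0 <= gam T ^+ 4 by rewrite exprn_even_ge0.
have EC : \int[mu]_(s in `[0, T]) velocity gam s ^+ 2 <= C.
  move: p6 g04 gT4 x0 (gL _ T0); rewrite E /C.
  move: (Rintegral _ _ _) (Rintegral _ _ _) (gam T ^+ 4) (gam 0 ^+ 4) (K ^+ 4).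
  by clear; move=> *; lra.
have /andP[i0 _] := dyadic_time_itv T0 (ltnW ij).
have /andP[_ iT] := dyadic_time_itv T0 ij.
case/andP: it; rewrite le_eqVlt => /predU1P[<- _|it ti]; first by rewrite subrr normr0 ltW.
have := energy_increment (vel _ (ltW T0)) (g2 _ T0) i0 it (le_trans ti iT).
rewrite ler_pdivrMr ?subr_gt0// => en.
have sub : \int[mu]_(s in `[i%:R * (T / 2 ^+ j), t]) velocity gam s ^+ 2 <= C.
  apply: le_trans EC; rewrite -lee_fin.
  have i1 := g2 _ T0; have i2 := integrable_itvS i0 (le_trans ti iT) i1.
  rewrite -(EFin_Rintegral (measurable_itv _) i1) -(EFin_Rintegral (measurable_itv _) i2).
  apply: (@ge0_subset_integral _ _ _ mu _ _ (measurable_itv _) (measurable_itv _)).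
  - by case/integrableP: i1.
  - by move=> s _; rewrite lee_fin sqr_ge0.
  - move=> s /=; rewrite !in_itv/= => /andP[s1 s2].
    by rewrite (le_trans i0 s1) (le_trans s2)// (le_trans ti iT).
rewrite -(ler_pXn2r (n := 2))// ?nnegrE ?(ltW d0)// real_normK ?num_real//.
apply: (le_trans en); apply: le_trans (ltW tauC).
rewrite mulrC; apply: ler_pM => //; first by rewrite subr_ge0 ltW.
  by apply: Rintegral_ge0 => s _; exact: sqr_ge0.
by rewrite lerBlDl (le_trans ti)// -natr1 mulrDl mul1r.
Qed.

Lemma cw_rate_good : good_rate_function (cw_rate I0).
Proof.
split; first exact: cw_rate_ge0.
move=> c c0; rewrite compact_ultra => G UG GA.
have [K K0 HK] := cw_rate_bounded c0.
have PG : ProperFilter G by exact: ultra_proper.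
have Gb T : 0 < T -> exists K, G [set y | forall t, 0 <= t <= T -> `|y t| <= K].
  by move=> T0; exists K; apply: filterS GA => y /= yc t /andP[t0 _]; exact: HK.
have Gr T delta : 0 < T -> 0 < delta -> exists j0,
    forall j, (j0 <= j)%N -> G [set y | ~ path_oscillates T j delta y].
  move=> T0 d0; have [j0 Hj0] := cw_rate_modulus c0 T0 d0; exists j0 => j /Hj0 Hj.
  apply: filterS GA => y yc [i [t [ij it]]]; rewrite ltNge => /negP; apply.
  exact: Hj.
have Ga T u v a delta : 0 < T -> 0 < delta ->
    (forall x, u <= x <= v -> (a%:E < I0 x)%E) -> exists j0, forall j, (j0 <= j)%N ->
    G [set y | u <= y 0 <= v -> path_action T j y <= c - a + delta].
  move=> T0 d0 uva; have K5 : 0 <= K ^+ 5 by rewrite exprn_ge0.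
  pose e := 3 * delta / (T * (K ^+ 5 + 1)).
  have e0 : 0 < e by rewrite divr_gt0 ?mulr_gt0// ltr_wpDl.
  have [j0 Hj0] := cw_rate_modulus c0 T0 e0; exists j0 => j /Hj0 Hj.
  apply: filterS GA => y yc /uva.
  have [x [I0x x0 vel g2 gL]] := cw_rate_leP yc.
  rewrite I0x lte_fin => ax.
  have := path_action_le (j := j) T0 K0 (vel _ (ltW T0)) (g2 _ T0).
  move=> /(_ e (fun t tT => HK y yc t (proj1 (andP tT))) (Hj y yc)) H.
  apply: (le_trans H); have := gL _ T0 => HL.
  have : K ^+ 5 * e * T / 3 <= delta.
    have -> : delta = (K ^+ 5 + 1) * e * T / 3 by rewrite /e; field; lra.
    by rewrite !ler_pM2r ?invr_gt0// lerDl.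
  lra.
exists (limit_skorohod UG Gb Gr); split; first exact: limit_path_rate.
exact: limit_skorohod_cvg.
Qed.

End RateFunction.

(** * Large deviation bounds *)

Section LimitSuperior.
Variable R : realType.
Implicit Types (u : (\bar R)^nat) (l : \bar R).
Local Open Scope ereal_scope.

Lemma limn_esup_le u l : (\forall n \near \oo, u n <= l) -> limn_esup u <= l.
Proof.
move=> ul; rewrite /limn_esup /limf_esup.
apply: (@le_trans _ _ (ereal_sup (u @` [set n | u n <= l]))).
  by apply: ereal_inf_lbound; exists [set n | u n <= l].
by apply: ub_ereal_sup => _ [n /= un <-].
Qed.

Lemma limn_esup_lt u l : limn_esup u < l -> \forall n \near \oo, u n < l.
Proof.
move=> /ereal_inf_lt[_ [V VF <-] sV]; apply: filterS VF => n Vn.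
by apply: le_lt_trans sV; apply: ereal_sup_ubound; exists n.
Qed.

Lemma limn_einf_ge u l : (\forall n \near \oo, l <= u n) -> l <= limn_einf u.
Proof.
move=> lu; rewrite /limn_einf leeNr; apply: limn_esup_le.
by apply: filterS lu => n ln; rewrite leeN2.
Qed.

Lemma limn_einf_gt u l : l < limn_einf u -> \forall n \near \oo, l < u n.
Proof.
rewrite /limn_einf lteNr => /limn_esup_lt; apply: filterS => n.
by rewrite lteN2.
Qed.

Lemma le_real_lt (x y : \bar R) : (forall z : R, z%:E < x -> z%:E <= y) -> x <= y.
Proof.
case: x => [x||] H; last by rewrite leNye.
- by apply/lee_subgt0Pr => e e0; apply: H; rewrite lte_fin gtrDl oppr_lt0.
- suff -> : y = +oo by [].
  by apply/eqyP => A _; apply: H; exact: ltry.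
Qed.

End LimitSuperior.

Section LogarithmicRates.
Variables (R : realType) (d : nat -> measure_display).
Variables (Omega : forall n, measurableType (d n)).
Variables (P : forall n, probability (Omega n) R).
Variables (r : nat -> R).
Hypothesis r_gt0 : forall n, (0 < n)%N -> 0 < r n.
Variable B : forall n, set (Omega n).
Arguments B : clear implicits.
Hypothesis mB : forall n, (0 < n)%N -> measurable (B n).

Let near_gt0 : \forall n \near \oo, (0 < n)%N.
Proof. by exists 1%N. Qed.

Lemma log_rate_le (s q a : R) : 0 < s ->
  (s^-1%:E * lne q%:E <= (- a)%:E)%E = (q <= expR (- s * a)).
Proof.
move=> s0; have [q0|q0] := leP q 0.
  rewrite /lne q0 gt0_muleNy ?lte_fin ?invr_gt0// leNye.
  by apply/esym/(le_trans q0); exact: expR_ge0.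
rewrite lne_EFin// -EFinM lee_fin -ler_expR -[in RHS](lnK q0) ler_expR.
by rewrite ler_pdivrMl// mulrN mulNr ler_expR.
Qed.

Lemma log_rate_ge (s q a : R) : 0 < s ->
  ((- a)%:E <= s^-1%:E * lne q%:E)%E = (expR (- s * a) <= q).
Proof.
move=> s0; have [q0|q0] := leP q 0.
  rewrite /lne q0 gt0_muleNy ?lte_fin ?invr_gt0// leeNy_eq/=.
  by apply/esym/negbTE; rewrite -ltNge (le_lt_trans q0)// expR_gt0.
rewrite lne_EFin// -EFinM lee_fin -[in RHS](lnK q0) ler_expR.
by rewrite ler_pdivlMl// mulrN mulNr.
Qed.

Let lr n := ((r n)^-1%:E * lne (P n (B n)))%E.

Lemma log_rate_limsup (a : \bar R) :
  (forall a' : R, (a'%:E < a)%E -> \forall n \near \oo, pr (P n) (B n) <= expR (- r n * a')) ->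
  (limn_esup lr <= - a)%E.
Proof.
move=> H; rewrite leeNr; apply: le_real_lt => a' aa'.
rewrite leeNr -EFinN; apply: limn_esup_le; apply: filterS2 near_gt0 (H _ aa') => n n0.
by rewrite -log_rate_le ?r_gt0// -prE//; exact: mB.
Qed.

Lemma log_rate_eventually_le (a : \bar R) : (limn_esup lr <= - a)%E ->
  forall a' : R, (a'%:E < a)%E -> \forall n \near \oo, pr (P n) (B n) <= expR (- r n * a').
Proof.
move=> H a' aa'; have : (limn_esup lr < (- a')%:E)%E.
  by apply: (le_lt_trans H); rewrite EFinN lteN2.
move=> /limn_esup_lt; apply: filterS2 near_gt0 => n n0 /ltW.
by rewrite -log_rate_le ?r_gt0// -prE//; exact: mB.
Qed.

Lemma log_rate_liminf (c : R) :
  (forall c', c < c' -> \forall n \near \oo, expR (- r n * c') <= pr (P n) (B n)) ->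
  ((- c)%:E <= limn_einf lr)%E.
Proof.
move=> H; apply/lee_addgt0Pr => e e0.
rewrite -leeBlDr// -EFinB; apply: limn_einf_ge.
have ce : c < c + e by rewrite ltrDl.
apply: filterS2 near_gt0 (H _ ce) => n n0.
by rewrite -log_rate_ge ?r_gt0// -prE ?opprD//; exact: mB.
Qed.

Lemma log_rate_eventually_ge (c : R) : ((- c)%:E <= limn_einf lr)%E ->
  forall c', c < c' -> \forall n \near \oo, expR (- r n * c') <= pr (P n) (B n).
Proof.
move=> H c' cc'; have : ((- c')%:E < limn_einf lr)%E.
  by apply: lt_le_trans H; rewrite lte_fin ltrN2.
move=> /limn_einf_gt; apply: filterS2 near_gt0 => n n0 /ltW.
by rewrite -log_rate_ge ?r_gt0// -prE//; exact: mB.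
Qed.

End LogarithmicRates.

(** * Measurability of Skorohod-open sets *)

Section TimeChanges.
Variable R : realType.
Implicit Types (lam mu x y z : R -> R).

Lemma time_change_ge0 lam t : time_change lam -> 0 <= t -> 0 <= lam t.
Proof.
move=> [_ im] t0; have : (lam @` `[0, +oo[) (lam t) by exists t; rewrite //= in_itv/= t0.
by rewrite im /= in_itv/= andbT.
Qed.

Lemma time_change_lt lam s t : time_change lam -> 0 <= s -> s < t -> lam s < lam t.
Proof.
move=> [mono _] s0 st; apply: mono => //; rewrite in_itv/= andbT//.
by rewrite (le_trans s0)// ltW.
Qed.

Lemma time_change_ltE lam s t : time_change lam -> 0 <= s -> 0 <= t ->
  (lam s < lam t) = (s < t).
Proof.
move=> lamP s0 t0; apply/idP/idP; last exact: time_change_lt.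
rewrite ltNge [in X in _ -> X]ltNge; apply: contra; rewrite le_eqVlt => /predU1P[->//|ts].
by apply/ltW/time_change_lt.
Qed.

Lemma time_change_surj lam t : time_change lam -> 0 <= t -> exists2 s, 0 <= s & lam s = t.
Proof.
move=> [_ im] t0; have : (`[0, +oo[%classic : set R) t by rewrite /= in_itv/= t0.
by rewrite -im => -[s /=]; rewrite in_itv/= andbT => s0 <-; exists s.
Qed.

Lemma time_changeP lam : (forall s t, 0 <= s -> s < t -> lam s < lam t) ->
  (forall t, 0 <= t -> 0 <= lam t) ->
  (forall t, 0 <= t -> exists2 s, 0 <= s & lam s = t) -> time_change lam.
Proof.
move=> mono pos surj; split.
  by move=> s t; rewrite !in_itv/= !andbT => s0 _; exact: mono.
apply/seteqP; split=> [u [t /=]|t /=]; rewrite !in_itv/= !andbT.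
  by move=> t0 <-; exact: pos.
by move=> /surj[s s0 <-]; exists s => //=; rewrite in_itv/= s0.
Qed.

Lemma time_change_comp lam mu : time_change lam -> time_change mu ->
  time_change (mu \o lam).
Proof.
move=> lamP muP; apply: time_changeP => [s t s0 st|t t0|t t0] /=.
- by apply: time_change_lt; rewrite ?time_change_ge0//; exact: time_change_lt.
- by rewrite !time_change_ge0.
- have [u u0 <-] := time_change_surj muP t0.
  by have [s s0 <-] := time_change_surj lamP u0; exists s.
Qed.

Lemma time_change_inv lam : time_change lam ->
  exists2 mu, time_change mu & forall t, 0 <= t -> lam (mu t) = t.
Proof.
move=> lamP; have /choice[mu Hmu] : forall t, exists s, 0 <= t -> 0 <= s /\ lam s = t.
  move=> t; have [t0|t0] := leP 0 t; last by exists 0.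
  by have [s s0 st] := time_change_surj lamP t0; exists s.
have mu0 t : 0 <= t -> 0 <= mu t by move=> /Hmu[].
have lamK t : 0 <= t -> lam (mu t) = t by move=> /Hmu[].
exists mu => //; apply: time_changeP => // [s t s0 st|t t0].
  have t0 : 0 <= t by rewrite (le_trans s0)// ltW.
  by rewrite -(time_change_ltE lamP) ?mu0// !lamK.
exists (lam t); first exact: time_change_ge0.
have l0 := time_change_ge0 lamP t0.
case: (ltgtP (mu (lam t)) t) => // ht.
- by have := time_change_lt lamP (mu0 _ l0) ht; rewrite lamK// ltxx.
- by have := time_change_lt lamP t0 ht; rewrite lamK// ltxx.
Qed.

(** Changes the slope from 1 to [s] after [p]; composing two of these reshapes a time change on one
    interval and restores slope 1 beyond it. *)
Definition kink (p s u : R) := if u <= p then u else p + s * (u - p).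

Lemma kink_time_change p s : 0 <= p -> 0 < s -> time_change (kink p s).
Proof.
move=> p0 s0; apply: time_changeP => [u v u0 uv|t t0|t t0].
- rewrite /kink; case: (leP u p) => up; case: (leP v p) => vp //.
  + by rewrite (le_lt_trans up)// ltrDl mulr_gt0// subr_gt0.
  + by move: (lt_trans (le_lt_trans vp up) uv); rewrite ltxx.
  + by rewrite ltrD2l ltr_pM2l// ltrD2r.
- rewrite /kink; case: (leP t p) => // tp; rewrite addr_ge0// mulr_ge0 ?(ltW s0)//.
  by rewrite subr_ge0 ltW.
- have [tp|tp] := leP t p; first by exists t; rewrite // /kink tp.
  have sp : p < p + (t - p) / s by rewrite ltrDl divr_gt0// subr_gt0.
  exists (p + (t - p) / s); first by rewrite (le_trans p0)// ltW.
  by rewrite /kink leNgt sp/= addrAC subrr add0r mulrC divfK ?gt_eqF// addrC subrK.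
Qed.

(* The relation behind [skorohod_nbhd], for functions that need not be known
   to be cadlag. *)
Definition close_upto x (T e : R) y := exists lam : R -> R,
  [/\ time_change lam, forall t, 0 <= t -> `|lam t - t| < e
    & forall t, 0 <= t <= T -> `|y (lam t) - x t| < e].

(** The second comparison needs the longer horizon [T'] because the first time change may move
    [[0, T]] as far as [T + e]. *)
Lemma close_upto_trans x y z T T' e e' : T + e <= T' ->
  close_upto x T e y -> close_upto y T' e' z -> close_upto x T (e + e') z.
Proof.
move=> TT [lam [l1 l2 l3]] [mu [m1 m2 m3]]; exists (mu \o lam); split.
- exact: time_change_comp.
- move=> t t0 /=; have lt0 := time_change_ge0 l1 t0.
  rewrite (_ : _ - t = (lam t - t) + (mu (lam t) - lam t)); last by ring.
  by apply: le_lt_trans (ler_normD _ _) _; rewrite ltrD ?l2 ?m2.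
- move=> t /andP[t0 tT] /=; have lt0 := time_change_ge0 l1 t0.
  rewrite (_ : _ - x t = (y (lam t) - x t) + (z (mu (lam t)) - y (lam t))); last by ring.
  apply: le_lt_trans (ler_normD _ _) _; rewrite ltrD ?l3 ?t0 ?m3 ?lt0//=.
  have := l2 t t0; rewrite ltr_norml => /andP[_ lt]; lra.
Qed.

Lemma close_upto_sym x y T T' e : T + e <= T' ->
  close_upto x T' e y -> close_upto y T e x.
Proof.
move=> TT [lam [l1 l2 l3]]; have [mu m1 lamK] := time_change_inv l1.
have m2 t : 0 <= t -> `|mu t - t| < e.
  move=> t0; rewrite -{2}(lamK t t0) distrC; apply: l2; exact: time_change_ge0.
exists mu; split=> // t /andP[t0 tT]; rewrite distrC -{1}(lamK t t0); apply: l3.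
rewrite time_change_ge0//=; have := m2 t t0; rewrite ltr_norml => /andP[_ mt]; lra.
Qed.

Lemma grid_ceil (a : R) : 0 <= a -> exists N : nat, a <= N%:R < a + 1.
Proof.
move=> a0; have /andP[n1 n2] := truncn_itv a0; set n := Num.truncn a in n1 n2.
move: n1; rewrite le_eqVlt => /predU1P[<-|na].
  by exists n; rewrite lexx ltrDl ltr01.
by exists n.+1; rewrite ltW//= -natr1 ltrD2r.
Qed.

End TimeChanges.

Section Discretisation.
Variables (R : realType) (x : R -> R) (e : R).
Hypothesis x_right : forall t, x s @[s --> t^'+] --> x t.
Hypothesis x_left : forall t, cvg (x s @[s --> t^'-]).
Hypothesis e_gt0 : 0 < e.

Definition sampled (q : nat) (y : R -> R) (t : R) := y ((Num.truncn (q%:R * t))%:R / q%:R).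

(* From [a] on the time change is a translation, so that it can be extended
   cell by cell. *)
Definition sampled_upto (a : R) := \forall q \near \oo, exists lam : R -> R, exists N : nat,
  [/\ time_change lam, (forall t, a <= t -> lam t = N%:R / q%:R + (t - a)),
    a * q%:R <= N%:R < a * q%:R + 1,
    (forall t, 0 <= t -> 0 <= lam t - t <= q%:R^-1)
  & forall t, 0 <= t < a -> `|sampled q x (lam t) - x t| < e].

Lemma sampled_upto0 : sampled_upto 0.
Proof.
exists 1%N => // q /= q1; exists id, 0%N; split.
- by split; [move=> s t _ _|rewrite image_id].
- by move=> t _; rewrite mul0r add0r subr0.
- by rewrite mul0r add0r lexx ltr01.
- by move=> t _; rewrite subrr lexx invr_ge0 ler0n.
- by move=> t /andP[t0 /(le_lt_trans t0)]; rewrite ltxx.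
Qed.

(** The time change is made affine from [[a, b]] onto [[La, Lb]], the interval between the grid
    points at or just after [a] and [b]. Sampling at a time of [[La, Lb[] then reads [x] at a grid
    point of [[a, b[], where [x] oscillates by less than [e]. *)
Lemma sampled_upto_extend a b : 0 <= a -> a < b ->
  (forall s t, a <= s < b -> a <= t < b -> `|x s - x t| < e) ->
  sampled_upto a -> sampled_upto b.
Proof.
move=> a0 ab osc; have ba0 : 0 < b - a by rewrite subr_gt0.
have b0 : 0 <= b by lra.
have [q0 _ Hq0] : \forall q \near \oo, (b - a)^-1 < q%:R.
  exact: nbhs_infty_gtr.
have : \forall q \near \oo, (0 < q)%N /\ (b - a)^-1 < q%:R.
  by exists (maxn 1 q0) => // q /=; rewrite geq_max => /andP[q1 /Hq0].
apply: filterS2 => q [q1 qab] [lam [N [l1 l2 l3 l4 l5]]].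
have q0' : (0 : R) < q%:R by rewrite ltr0n.
have bq : 0 <= b * q%:R by rewrite mulr_ge0// ltW.
have [M /andP[M1 M2]] := grid_ceil bq; case/andP: l3 => N1 N2.
(* The mesh is smaller than [b - a], which separates the two grid points: [N < M]. *)
have abq : 1 < (b - a) * q%:R by rewrite -ltr_pdivrMl// mulr1.
have NM : N%:R < M%:R :> R by move: abq; rewrite mulrBl; lra.
pose La : R := N%:R / q%:R; pose Lb : R := M%:R / q%:R.
have LaLb : La < Lb by rewrite ltr_pM2r// invr_gt0.
have La0 : 0 <= La by rewrite divr_ge0// ltW.
have aLa : a <= La by rewrite ler_pdivlMr.
have bLb : b <= Lb by rewrite ler_pdivlMr.
have Laa : La <= a + q%:R^-1 by rewrite ler_pdivrMr// mulrDl mulVf ?gt_eqF// ltW.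
have Lbb : Lb <= b + q%:R^-1 by rewrite ler_pdivrMr// mulrDl mulVf ?gt_eqF// ltW.
pose s := (Lb - La) / (b - a).
have s0 : 0 < s by rewrite divr_gt0// subr_gt0.
have sE : s * (b - a) = Lb - La by rewrite /s divfK// gt_eqF.
(* [lam] has slope 1 after [a]; the inner kink gives it slope [s] from the level [La], the outer one
   restores slope 1 from the level [Lb]. *)
pose lam' := kink Lb s^-1 \o (kink La s \o lam).
have sV : s^-1 * (Lb - La) = b - a by rewrite -sE mulrA mulVf ?mul1r// gt_eqF.
have lama : lam a = La by rewrite l2// subrr addr0.
have lam1 t : 0 <= t -> t <= a -> lam' t = lam t.
  move=> t0 ta; have lt : lam t <= La.
    move: ta; rewrite le_eqVlt => /predU1P[->|ta]; first by rewrite lama.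
    by rewrite -lama; apply/ltW/time_change_lt.
  by rewrite /lam' /= /kink lt (le_trans lt (ltW LaLb)).
have lam2 t : a <= t <= b -> lam' t = La + s * (t - a).
  move=> /andP[]; rewrite le_eqVlt => /predU1P[<- _|at_ tb].
    by rewrite lam1// lama subrr mulr0 addr0.
  have lt : lam t = La + (t - a) by rewrite l2// ltW.
  have k1 : kink La s (lam t) = La + s * (t - a).
    by rewrite /kink lt leNgt ltrDl subr_gt0 at_/= addrAC subrr add0r.
  rewrite /lam' /= k1 /kink (_ : _ <= _)//.
  by rewrite -lerBrDl -sE ler_pM2l// lerD2r.
have lam3 t : b <= t -> lam' t = Lb + (t - b).
  rewrite le_eqVlt => /predU1P[<-|bt].
    by rewrite lam2 ?(ltW ab) ?lexx// sE subrr addr0 addrC subrK.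
  have at_ := lt_trans ab bt.
  have lt : lam t = La + (t - a) by rewrite l2// ltW.
  have k1 : kink La s (lam t) = La + s * (t - a).
    by rewrite /kink lt leNgt ltrDl subr_gt0 at_/= addrAC subrr add0r.
  have k2 : Lb < La + s * (t - a).
    by rewrite -ltrBlDl -sE ltr_pM2l// ltrD2r.
  rewrite /lam' /= k1 /kink leNgt k2/=; congr (_ + _).
  rewrite (_ : _ - Lb = s * (t - a) - (Lb - La)); last by ring.
  by rewrite mulrBr mulrA mulVf ?gt_eqF// mul1r sV; ring.
exists lam', M; split.
- apply: time_change_comp; first apply: time_change_comp => //.
  + exact: kink_time_change.
  + by apply: kink_time_change; rewrite ?invr_gt0// (le_trans La0)// ltW.
- by move=> t /lam3.
- by rewrite M1.
- move=> t t0; have [ta|at_] := leP t a; first by rewrite lam1// l4.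
  have [tb|bt] := leP t b; last by rewrite lam3 ?(ltW bt)//; apply/andP; split; lra.
  rewrite lam2 ?(ltW at_)//.
  (* On [[a, b]] the displacement is a convex combination of those at the two ends, both between 0
     and [1 / q]. *)
  have DE : (La + s * (t - a) - t) * (b - a) = (La - a) * (b - t) + (Lb - b) * (t - a).
    by rewrite mulrBl mulrDl (mulrAC s) sE; ring.
  rewrite -[X in X && _](pmulr_lge0 _ ba0) -[X in _ && X](ler_pM2r ba0) DE.
  have p1 : 0 <= (La - a) * (b - t) by rewrite mulr_ge0 ?subr_ge0.
  have p2 : 0 <= (Lb - b) * (t - a) by rewrite mulr_ge0 ?subr_ge0 ?(ltW at_).
  have p3 : (La - a) * (b - t) <= q%:R^-1 * (b - t).
    by rewrite ler_wpM2r ?subr_ge0// lerBlDl.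
  have p4 : (Lb - b) * (t - a) <= q%:R^-1 * (t - a).
    by rewrite ler_wpM2r ?subr_ge0 ?(ltW at_)// lerBlDl.
  rewrite addr_ge0//= (_ : q%:R^-1 * (b - a) = q%:R^-1 * (b - t) + q%:R^-1 * (t - a)); last by ring.
  exact: lerD.
- move=> t /andP[t0 tb]; have [ta|at_] := ltP t a.
    by rewrite lam1 ?(ltW ta)//; apply: l5; rewrite t0.
  rewrite lam2 ?at_ ?(ltW tb)// /sampled; set l := La + _.
  have l0 : La <= l by rewrite lerDl mulr_ge0 ?(ltW s0)// subr_ge0.
  have lb : l < Lb by rewrite -ltrBrDl -sE ltr_pM2l// ltrD2r.
  have ql0 : 0 <= q%:R * l by rewrite mulr_ge0// (le_trans La0).
  have NT : (N <= Num.truncn (q%:R * l))%N.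
    by rewrite truncn_ge_nat// mulrC -ler_pdivrMr.
  have TM : (Num.truncn (q%:R * l) < M)%N.
    by rewrite truncn_lt_nat// mulrC -ltr_pdivlMr.
  apply: osc; last by rewrite at_.
  apply/andP; split; first by rewrite (le_trans aLa)// ler_pM2r ?invr_gt0// ler_nat.
  (* As [M < b q + 1], a grid index below [M] stands for a time strictly before [b]. *)
  rewrite ltr_pdivrMr// -(ltrD2r 1); apply: le_lt_trans M2.
  by rewrite natr1 ler_nat.
Qed.

(** Continuous induction on the supremum [z] of the reachable times: the left limit at [z] shows
    that [z] is reached, and right continuity at [z] allows going beyond it. *)
Lemma sampled_upto_all (T : R) : 0 < T -> sampled_upto T.
Proof.
move=> T0; pose S := [set a | 0 <= a <= T /\ sampled_upto a].
have S0 : S 0 by split; [rewrite lexx ltW|exact: sampled_upto0].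
have ubS : ubound S T by move=> a [/andP[]].
have supS : has_sup S by split; [exists 0|exists T].
pose z := sup S.
have z0 : 0 <= z by apply: sup_upper_bound.
have zT : z <= T by apply: ge_sup => //; exists 0.
have e20 : 0 < e / 2 by rewrite divr_gt0.
have half (a b c : R) : `|a - c| < e / 2 -> `|b - c| < e / 2 -> `|a - b| < e.
  by rewrite !ltr_norml; lra.
have Qz : sampled_upto z.
  have [z00|z_gt0] := eqVneq z 0; first by rewrite z00; exact: sampled_upto0.
  have {z_gt0} z_gt0 : 0 < z by rewrite lt_neqAle eq_sym z_gt0.
  have [l Hl] : exists l : R, x s @[s --> z^'-] --> l.
    by apply/cvg_ex; exact: x_left.
  have : \forall s \near z^'-, `|x s - l| < e / 2.
    by have /cvgrPdist_lt/(_ _ e20) := Hl; apply: filterS => s; rewrite distrC.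
  rewrite /at_left /within /nbhs /= => -[h /= h0 Hh].
  have Hl' s : z - h < s < z -> `|x s - l| < e / 2.
    move=> /andP[s1 s2]; apply: Hh => //=.
    by rewrite ger0_norm; lra.
  have [a Sa az] : exists2 a, S a & z - h < a.
    by apply: sup_adherent => //.
  have az' : a <= z by apply: sup_upper_bound.
  case: Sa => /andP[a0 aT] Qa; move: az'; rewrite le_eqVlt => /predU1P[<- //|az'].
  apply: (sampled_upto_extend a0 az') => // s t /andP[s1 s2] /andP[t1 t2].
  by apply: (half _ _ l); apply: Hl'; rewrite ?s2 ?t2 andbT (lt_le_trans az).
have [zT'|Tz] := ltP z T; last by have <- : z = T by apply/eqP; rewrite eq_le zT.
have : \forall s \near z^'+, `|x s - x z| < e / 2.
  have /cvgrPdist_lt/(_ _ e20) : x s @[s --> z^'+] --> x z by exact: x_right.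
  by apply: filterS => s; rewrite distrC.
rewrite /at_right /within /nbhs /= => -[h /= h0 Hh].
have Hz s : z <= s < z + h -> `|x s - x z| < e / 2.
  move=> /andP[]; rewrite le_eqVlt => /predU1P[<- _|s1 s2]; first by rewrite subrr normr0.
  by apply: Hh => //=; rewrite distrC ger0_norm; lra.
pose b := Num.min T (z + h / 2).
have zb : z < b by rewrite lt_min zT'/= ltrDl divr_gt0.
have bh : b <= z + h / 2 by rewrite ge_min lexx orbT.
have Qb : sampled_upto b.
  apply: (sampled_upto_extend z0 zb) Qz => s t /andP[s1 s2] /andP[t1 t2].
  apply: (half _ _ (x z)); apply: Hz.
    by rewrite s1/=; lra.
  by rewrite t1/=; lra.
have : b <= z.
  apply: sup_upper_bound => //; split=> //.
  by rewrite ge_min lexx (le_trans z0 (ltW zb)).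
by rewrite leNgt zb.
Qed.

Lemma sampled_close T : 0 < T -> \forall q \near \oo, close_upto x T e (sampled q x).
Proof.
move=> T0; have T1 : 0 < T + 1 by lra.
have qe : \forall q \near \oo, e^-1 < q%:R by exact: nbhs_infty_gtr.
apply: filterS2 qe (sampled_upto_all T1) => q qe [lam [N [l1 _ _ l4 l5]]].
exists lam; split=> //.
  move=> t /l4/andP[h1 h2]; rewrite ger0_norm//; apply: (le_lt_trans h2).
  by rewrite -[ltRHS]invrK ltf_pV2// posrE ?invr_gt0// (lt_trans _ qe)// invr_gt0.
by move=> t /andP[t0 tT]; apply: l5; rewrite t0/=; lra.
Qed.

End Discretisation.

Section OpenPreimages.
Variables (R : realType) (d : measure_display) (Omega : measurableType d).
Variables (P : probability Omega R) (X : Omega -> skorohod R).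
Variables (E : seq R) (p : R -> R -> R -> R).
Hypothesis uE : uniq E.
Hypothesis X_markov : markov_process E P X p.

(** A quantitative interior of [U], with radius [1 / m] and horizon [m], defined on plain functions
    so that sampled paths can be tested directly. *)
Definition inner_part (U : set (skorohod R)) (m : nat) : set (R -> R) :=
  [set f | forall y : skorohod R, close_upto f m%:R m%:R^-1 y -> U y].

(** Up to time [m] the sampled path is a function of a finite skeleton with values in the finite set
    [E], and every event about such a skeleton is measurable, however complicated [G] is. *)
Lemma sampled_measurable (G : set (R -> R)) (m q : nat) : (0 < q)%N ->
  (forall f g, (forall t, 0 <= t <= m%:R -> f t = g t) -> G f -> G g) ->
  measurable [set w | G (sampled q (X w))].
Proof.
move=> q0 Gloc; pose N := (q * m)%N.
have q0' : (0 : R) < q%:R by rewrite ltr0n.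
have q_ge0 : (0 : R) <= q%:R^-1 by rewrite invr_ge0.
pose f (s : seq R) (t : R) := s`_(Num.truncn (q%:R * t)).
have := measurable_skeleton uE X_markov N (fun s => `[< G (f s) >]) (lexx 0) q_ge0 measurableT.
rewrite (_ : _ `&` _ = [set w | G (sampled q (X w))])//.
have agree w t : 0 <= t <= m%:R -> f (skeleton X 0 q%:R^-1 N w) t = sampled q (X w) t.
  move=> /andP[t0 tm]; rewrite /f nth_skeleton ?add0r//.
  rewrite -(ler_nat R) (le_trans (_ : _ <= q%:R * t)) ?truncn_le ?mulr_ge0 ?(ltW q0')//.
  by rewrite natrM ler_pM2l.
apply/seteqP; split=> w.
  by move=> [_ /asboolP]; apply: Gloc => t tm; rewrite agree.
move=> Gw; split=> //; apply/asboolP; apply: Gloc Gw => t tm; rewrite agree//.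
Qed.

Lemma inner_part_local (U : set (skorohod R)) m f g :
  (forall t, 0 <= t <= m%:R -> f t = g t) -> inner_part U m f -> inner_part U m g.
Proof.
move=> fg Uf y [lam [l1 l2 l3]]; apply: Uf; exists lam; split=> // t tm.
by rewrite fg// l3.
Qed.

(** A path is Skorohod-close to all its fine samples. If it is in [U], a whole neighbourhood of
    these samples is in [U] by [close_upto_trans]; conversely one fine sample in the inner part puts
    the path itself in [U] by [close_upto_sym]. *)
Lemma open_preimage_sampled (U : set (skorohod R)) : open U ->
  X @^-1` U = \bigcup_m \bigcup_q0 \bigcap_q
    [set w | inner_part U m.+1 (sampled (q0 + q).+1 (X w))].
Proof.
move=> oU; apply/seteqP; split=> w.
  move=> /(skorohod_open_nbhd oU)[T0 [e [e0 sU]]].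
  have e20 : 0 < e / 2 by rewrite divr_gt0.
  pose T := Num.max T0 0 + 1.
  have T0T : T0 <= T by rewrite /T (le_trans (_ : T0 <= Num.max T0 0)) ?le_max ?lexx// lerDl.
  have Tgt0 : 0 < T.
    by rewrite /T (le_lt_trans (_ : 0 <= Num.max T0 0)) ?le_max ?lexx ?orbT// ltrDl.
  have [xr xl _] := path_cadlag (X w).
  have [q0 _ Hq0] := sampled_close xr xl e20 Tgt0.
  (* Both requirements on the index: the horizon [m.+1] exceeds [T + e / 2] and the radius
     [1 / m.+1] is at most [e / 2]. *)
  pose B := Num.max (T + e / 2) (2 / e).
  pose m := Num.truncn B.
  have Bm : B < m.+1%:R by exact: truncnS_gt.
  exists m => //; exists q0 => // q _ y /= yc; apply: sU.
  have m1 : T + e / 2 <= m.+1%:R by rewrite (le_trans _ (ltW Bm))// le_max lexx.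
  have m2 : m.+1%:R^-1 <= e / 2.
    rewrite -[leRHS]invrK lef_pV2 ?posrE ?invr_gt0 ?ltr0n// invf_div.
    by rewrite (le_trans _ (ltW Bm))// le_max lexx orbT.
  have [|lam [l1 l2 l3]] := close_upto_trans m1 (Hq0 (q0 + q).+1 _) yc.
    by rewrite /= leqW// leq_addr.
  have ee : e / 2 + m.+1%:R^-1 <= e by rewrite [leRHS]splitr lerD2l.
  exists lam; split=> // t.
    by move=> /l2 h; apply: lt_le_trans h ee.
  move=> /andP[t0 tT]; apply: lt_le_trans ee; apply: l3.
  by rewrite t0 (le_trans tT).
move=> [m _ [q0 _ H]].
have e0 : (0 : R) < m.+1%:R^-1 by rewrite invr_gt0.
have T0 : (0 : R) < m.+1%:R + m.+1%:R^-1 by rewrite addr_gt0.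
have [xr xl _] := path_cadlag (X w).
have [q1 _ Hq1] := sampled_close xr xl e0 T0.
apply: (H q1 I); apply: close_upto_sym (lexx _) _; apply: Hq1 => /=.
by rewrite leqW// leq_addl.
Qed.

Lemma open_preimage_measurable (U : set (skorohod R)) : open U -> measurable (X @^-1` U).
Proof.
move=> /open_preimage_sampled ->; apply: bigcupT_measurable => m.
apply: bigcupT_measurable => q0; apply: bigcapT_measurable => q.
by apply: (@sampled_measurable _ m.+1) => //; exact: inner_part_local.
Qed.

Lemma skorohod_measurable (B : set (skorohod R)) : <<s @open (skorohod R) >> B ->
  measurable (X @^-1` B).
Proof.
apply: (@smallest_sub _ (sigma_algebra setT) _ [set B | measurable (X @^-1` B)]).
  split=> /=.
  - by rewrite preimage_set0.
  - by move=> A mA; rewrite setTD -preimage_setC; exact: measurableC.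
  - by move=> F mF; rewrite preimage_bigcup; exact: bigcupT_measurable.
by move=> U /= oU; exact: open_preimage_measurable.
Qed.

End OpenPreimages.

(** * The large deviation principle *)

Section PathLargeDeviations.
Variables (R : realType) (d : nat -> measure_display).
Variables (Omega : forall n, measurableType (d n)).
Variables (P : forall n, probability (Omega n) R).
Variables (X : forall n, Omega n -> skorohod R) (r : nat -> R).
Arguments X : clear implicits.
Variables (E : nat -> seq R) (k : nat -> R -> R -> R -> R).
Hypothesis r_gt0 : forall n, (0 < n)%N -> 0 < r n.
Hypothesis r_infty : r n @[n --> \oo] --> +oo.
Hypothesis uE : forall n, (0 < n)%N -> uniq (E n).
Hypothesis k_trans : forall n, (0 < n)%N -> transition_function (E n) (k n).
Hypothesis X_markov : forall n, (0 < n)%N -> markov_process (E n) (P n) (X n) (k n).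
Hypothesis k_step : one_step_bounds E k r.
Variable I0 : R -> \bar R.
Hypothesis I0_good : good_rate_function I0.
Hypothesis LDP0 : LDP P (fun n w => X n w 0) r I0.

Lemma near_positive : \forall n \near \oo, (0 < n)%N.
Proof. by exists 1%N. Qed.

Lemma initial_open_measurable n (U : set R) : (0 < n)%N -> open U ->
  measurable [set w | U (X n w 0)].
Proof.
by move=> n0 oU; have [mX _ _] := LDP0; apply: (mX n n0); exact: sub_sigma_algebra.
Qed.

Lemma initial_closed_measurable n (C : set R) : (0 < n)%N -> closed C ->
  measurable [set w | C (X n w 0)].
Proof.
move=> n0 /closed_openC oC; rewrite (_ : [set w | _] = ~` [set w | (~` C) (X n w 0)]).
  by apply: measurableC; exact: initial_open_measurable.
by apply/seteqP; split=> w /=; rewrite notK.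
Qed.

Lemma initial_upper (C : set R) (a a' : R) : closed C -> (forall x, C x -> (a%:E <= I0 x)%E) ->
  a' < a -> \forall n \near \oo, pr (P n) [set w | C (X n w 0)] <= expR (- r n * a').
Proof.
move=> cC CI aa; have [_ up _] := LDP0.
apply: (log_rate_eventually_le r_gt0 _ (up C cC)) => [n n0|].
  exact: initial_closed_measurable.
apply: (@lt_le_trans _ _ a%:E); first by rewrite lte_fin.
by apply: le_ereal_inf_tmp => _ [x Cx <-]; exact: CI.
Qed.

Lemma initial_lower (x rho c c' : R) : 0 < rho -> (I0 x <= c%:E)%E -> c < c' ->
  \forall n \near \oo, expR (- r n * c') <= pr (P n) [set w | `|X n w 0 - x| <= rho].
Proof.
move=> rho0 Ixc cc; have [_ _ lo] := LDP0.
have oB : open (ball x rho) by exact: ball_open.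
have low : ((- c)%:E <= limn_einf (fun n =>
    (r n)^-1%:E * lne (P n [set w | ball x rho (X n w 0%R)])))%E.
  apply: le_trans (lo _ oB); rewrite EFinN leeN2; apply: le_trans Ixc.
  by apply: ereal_inf_lbound; exists x => //; exact: ballxx.
have H := log_rate_eventually_ge r_gt0 _ low cc.
have {}H := H (fun n n0 => initial_open_measurable n0 oB).
apply: filterS2 near_positive H => n n0; move/le_trans; apply; apply: pr_le.
- exact: initial_open_measurable.
- apply: (@initial_closed_measurable n [set y | `|y - x| <= rho]) => //.
  rewrite (_ : [set y | _] = `[x - rho, x + rho]%classic); first exact: itv_closed.
  by apply/seteqP; split=> y /=; rewrite in_itv/= ler_distl.
- by move=> w /=; rewrite /ball/= distrC => /ltW.
Qed.

Lemma initial_tight s : exists K1 : R, exp_negligible P X r s [set y | K1 < `|y 0|].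
Proof.
have [K K0 HK] := rate0_bounded I0_good s; exists (K + 1) => s' ss.
have cC : closed [set x : R | K + 1 <= `|x|].
  apply: (@closed_comp _ _ (fun x : R => `|x|) [set y | K + 1 <= y]); last exact: closed_ge.
  by move=> x _; exact: norm_continuous.
have H := @initial_upper _ s s' cC.
have {}H : \forall n \near \oo, pr (P n) [set w | K + 1 <= `|X n w 0|] <= expR (- r n * s').
  apply: H (ss) => x /= Kx; rewrite leNgt; apply/negP => /ltW/HK xK; lra.
apply: filterS2 near_positive H => n n0 pn.
exists [set w | K + 1 <= `|X n w 0|]; first by split=> //; exact: (initial_closed_measurable n0 cC).
by move=> w /=; exact: ltW.
Qed.

Section Upper.
Variables (s : R) (A : set (skorohod R)).
Hypothesis A_closed : closed A.
Hypothesis A_rate : forall y, A y -> (s%:E < cw_rate I0 y)%E.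

(** The filter generated by [A] and the complements of the negligible sets; it is improper exactly
    when [A] is negligible. *)
Definition upper_filter : set_system (skorohod R) :=
  [set C | exp_negligible P X r s (A `\` C)].

Lemma upper_filter_proper : ~ exp_negligible P X r s A -> ProperFilter upper_filter.
Proof.
move=> nA; apply: Build_ProperFilter; first by rewrite /upper_filter/= setD0.
split.
- by rewrite /upper_filter/= setDT; exact: exp_negligible0.
- move=> C D nC nD; rewrite /upper_filter/= setDIr.
  exact: (exp_negligibleU r_infty nC nD).
- move=> C D CD; apply: exp_negligibleS => y [Ay nDy]; split=> // Cy.
  by apply: nDy; exact: CD.
Qed.

Lemma path_upper : exp_negligible P X r s A.
Proof.
apply: contrapT => /upper_filter_proper PF.
have [G [UG FG]] := ultraFilterLemma PF.
have PG : ProperFilter G by exact: ultra_proper.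
have GN B : exp_negligible P X r s B -> G (~` B).
  move=> nB; apply: FG; apply: exp_negligibleS nB => y [_] /=.
  by move/contrapT.
have GA : G A by apply: FG; rewrite /upper_filter/= setDv; exact: exp_negligible0.
have [K K0 HK] := containment_negligible r_gt0 r_infty uE k_trans X_markov k_step (initial_tight s).
have bnd T : 0 < T -> G [set y | forall t, 0 <= t <= T -> `|y t| <= K].
  move=> T0; apply: filterS (GN _ (HK T T0)) => y /= ny t tT.
  by rewrite leNgt; apply/negP => Kt; apply: ny; exists t.
have Gb T : 0 < T -> exists K, G [set y | forall t, 0 <= t <= T -> `|y t| <= K].
  by move=> T0; exists K; exact: bnd.
have Gr T delta : 0 < T -> 0 < delta -> exists j0,
    forall j, (j0 <= j)%N -> G [set y | ~ path_oscillates T j delta y].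
  move=> T0 d0.
  have [j0 Hj0] := oscillation_negligible r_gt0 r_infty uE k_trans X_markov k_step s T0 K0 d0.
  exists j0 => j /Hj0/GN Gj; apply: filterS (filterI Gj (bnd T T0)) => y [/= ny yK] yo.
  exact: ny.
have Ga T u v a delta : 0 < T -> 0 < delta ->
    (forall x, u <= x <= v -> (a%:E < I0 x)%E) -> exists j0, forall j, (j0 <= j)%N ->
    G [set y | u <= y 0 <= v -> path_action T j y <= s - a + delta].
  move=> T0 d0 uva; have K5 : 0 <= K ^+ 5 by rewrite exprn_ge0.
  have dd0 : 0 < delta / (4 * T * (K ^+ 5 + 1)) by rewrite divr_gt0 ?mulr_gt0// ltr_wpDl.
  have [j0 Hj0] := Gr T _ T0 dd0; exists j0 => j /Hj0 Gj.
  have I0u a' : a' < a -> \forall n \near \oo,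
      pr (P n) [set w | u <= X n w 0 <= v] <= expR (- r n * a').
    move=> aa; have H : \forall n \near \oo,
        pr (P n) [set w | `[u, v]%classic (X n w 0)] <= expR (- r n * a').
      apply: (@initial_upper _ a a' (@itv_closed _ _ u v)) => // x.
      by rewrite /= in_itv/= => /uva/ltW.
    apply: filterS H => n; apply: le_trans; rewrite le_eqVlt; apply/orP; left; apply/eqP.
    by congr (pr _ _); apply/seteqP; split=> w /=; rewrite in_itv.
  have /GN Gn := action_negligible r_gt0 r_infty uE k_trans X_markov k_step (s := s) j T0 K0 d0 I0u.
  apply: filterS (filterI Gn (filterI Gj (bnd T T0))) => y [/= n1 [n2 n3]] yuv.
  by rewrite leNgt; apply/negP => yact; apply: n1; split.
have cv := @limit_skorohod_cvg _ _ UG Gb Gr.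
have rate := limit_path_rate UG Gb Gr Ga I0_good.
have Alim : A (limit_skorohod UG Gb Gr).
  apply: contrapT => nA.
  have : nbhs (limit_skorohod UG Gb Gr) (~` A).
    by apply: open_nbhs_nbhs; split=> //; exact: closed_openC.
  move=> /cv GC; have G0 : G set0 by rewrite -(setICr A); exact: filterI.
  exact: (@filter_not_empty _ G PG G0).
by have := lt_le_trans (A_rate Alim) rate; rewrite ltxx.
Qed.

End Upper.

Section Lower.
Variables (U : set (skorohod R)) (gam : skorohod R) (c c' : R).
Hypothesis mU : forall n, (0 < n)%N -> measurable (X n @^-1` U).
Hypothesis U_open : open U.
Hypothesis U_gam : U gam.
Hypothesis gam_rate : (cw_rate I0 gam <= c%:E)%E.
Hypothesis c_lt : c < c'.

Lemma path_lower : \forall n \near \oo, expR (- r n * c') <= pr (P n) (X n @^-1` U).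
Proof.
(* Final bookkeeping: [A1] is the action of [gam] on [[0, T]], [A2] its discretisation, [A3] and
   [A5] errors due to the oscillation of [gam] on the cells. The two terms [ep / 12] are lost at the
   start and in the tube. *)
have fin (A1 A2 A3 A4 A5 ep x : R) : A2 <= A1 + A3 / 3 -> A1 <= c - x -> A5 <= A4 ->
    A3 + A4 <= ep -> 0 < ep -> x + ep / 12 + (A2 + A5 / 3 + ep / 12) <= c + ep by lra.
have [T0 [e [e0 sU]]] := skorohod_open_nbhd U_open U_gam.
pose T := Num.max T0 0 + 1.
have T0T : T0 < T by rewrite /T (le_lt_trans (_ : T0 <= Num.max T0 0)) ?le_max ?lexx// ltrDl.
have Tgt0 : 0 < T.
  by rewrite /T (le_lt_trans (_ : 0 <= Num.max T0 0)) ?le_max ?lexx ?orbT// ltrDl.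
have [x [I0x x0 vel g2 gL]] := cw_rate_leP I0_good gam_rate.
have [K K0 HK] := path_bounded (vel T (ltW Tgt0)) (ltW Tgt0).
pose eps := c' - c; have eps0 : 0 < eps by rewrite subr_gt0.
pose M := T * (K ^+ 5 + (K + 2) ^+ 5).
have K5 : 0 <= K ^+ 5 by rewrite exprn_ge0.
have K25 : 0 <= (K + 2) ^+ 5 by rewrite exprn_ge0// addr_ge0.
have M0 : 0 <= M by rewrite mulr_ge0 ?(ltW Tgt0)// addr_ge0.
(* [om] bounds the oscillation of [gam] on a cell. At most [e / 4], it fits with the tube width into
   the [e]-neighbourhood; at most 1, it gives the radius [K + 2]; the last bound keeps the
   discretisation errors, gathered in [M], below [eps]. *)
pose om := Num.min (Num.min 1 (e / 4)) (eps / (M + 1)).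
have om0 : 0 < om by rewrite !lt_min ltr01 !divr_gt0// ltr_wpDl.
have om1 : om <= 1 by rewrite !ge_min lexx.
have ome : om <= e / 4 by rewrite !ge_min lexx orbT.
have omM : om * M <= eps.
  apply: (@le_trans _ _ (om * (M + 1))); first by rewrite ler_pM2l// lerDl.
  by rewrite -ler_pdivlMr ?ltr_wpDl// ge_min lexx orbT.
have [j Hj] := dyadic_modulus (vel T (ltW Tgt0)) Tgt0 om0; have {Hj} osc := Hj j (leqnn _).
set tau := T / 2 ^+ j in osc.
have tau0 : 0 < tau by rewrite divr_gt0// exprn_gt0.
pose g i := gam (i%:R * tau).
have gK i : (i <= 2 ^ j)%N -> `|g i| <= K.
  by move=> ij; apply: HK; exact: dyadic_time_itv.
have gom i : (i < 2 ^ j)%N -> `|g i.+1 - g i| <= om.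
  by move=> ij; apply/ltW/osc; rewrite // lexx ler_pM2r// ler_nat leqnSn.
have e40 : 0 < e / 4 by rewrite divr_gt0.
have eps3 : 0 < eps / 12 by rewrite divr_gt0.
have [rho rho0 Hrho] := tube_lower_bound r_gt0 r_infty uE k_trans X_markov k_step
  Tgt0 eps3 e40 (ltW om0) gK gom.
have I0c : (I0 (gam 0%R) <= x%:E)%E by rewrite I0x.
have xeps : x < x + eps / 12 by rewrite ltrDl.
have low := initial_lower rho0 I0c xeps.
apply: filterS3 near_positive low Hrho => n n0 p0 [Good [mG pG HG]].
have GU : Good `<=` X n @^-1` U.
  move=> w Gw; apply: sU; apply: skorohod_nbhd_uniform => // t /andP[t0 tT0].
  have tT : t < T by exact: le_lt_trans tT0 T0T.
  have /andP[i1 i2] : (Num.truncn (t / tau))%:R <= t / tau < (Num.truncn (t / tau)).+1%:R.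
    by apply: truncn_itv; rewrite divr_ge0// ltW.
  set i := Num.truncn (t / tau) in i1 i2.
  have ij : (i < 2 ^ j)%N.
    rewrite -(ltr_nat R) (le_lt_trans i1)// ltr_pdivrMr// natrX mulrC /tau divfK//.
  rewrite ler_pdivlMr// in i1; rewrite ltr_pdivrMr// in i2.
  have h1 : `|X n w t - g i| <= e / 4 + om by apply: HG; rewrite // i1 i2.
  have h2 : `|gam t - g i| < om by apply: osc; rewrite // i1 ltW.
  move: h1 h2 ome; rewrite ler_norml !ltr_norml /g.
  by clear -e0; move: (X n w t) (gam t) (gam _) e0 => y1 y2 y3 *; lra.
apply: (@le_trans _ _ (pr (P n) Good)); last exact: (pr_le _ mG (mU n0) GU).
apply: (le_trans _ pG); set ct := _ + eps / 12.
apply: (@le_trans _ _ (expR (- r n * (x + eps / 12)) * expR (- r n * ct))).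
  rewrite -expRD -mulrDr ler_expR !mulNr lerN2 ler_pM2l ?r_gt0//.
  have act := path_action_le (j := j) Tgt0 K0 (vel T (ltW Tgt0)) (g2 T Tgt0) HK
    (fun i t ij it => ltW (osc i t ij it)).
  have gE : path_action T j gam = \sum_(i < 2 ^ j) ((g i.+1 - g i) ^+ 2 / (8 * tau) +
      tau * (g i ^+ 6 / 18)) + (g (2 ^ j)%N ^+ 4 - g 0%N ^+ 4) / 24.
    by rewrite /path_action /g dyadic_lastE mul0r.
  rewrite gE in act; rewrite /ct; have gT := gL T Tgt0.
  have om5 : T * (K + om + 1) ^+ 5 * om <= T * (K + 2) ^+ 5 * om.
    rewrite ler_pM2r// ler_pM2l// lerXn2r ?nnegrE ?addr_ge0 ?(ltW om0)//.
    by rewrite -addrA lerD2l lerD2r.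
  have MM : om * M = K ^+ 5 * om * T + T * (K + 2) ^+ 5 * om by rewrite /M; ring.
  rewrite MM in omM.
  move: act gT om5 omM eps0; rewrite (_ : c' = c + eps); last by rewrite /eps; ring.
  move: (Rintegral _ _ _) (_ + _ / 24) (K ^+ 5 * om * T) (T * (K + 2) ^+ 5 * om)
    (T * (K + om + 1) ^+ 5 * om) (eps) => A1 A2 A3 A4 A5 ep.
  exact: fin.
rewrite ler_wpM2r ?expR_ge0//.
by move: p0; rewrite /g mul0r.
Qed.

End Lower.

Lemma path_LDP : LDP P X r (cw_rate I0).
Proof.
have mX n B : (0 < n)%N -> <<s @open (skorohod R) >> B -> measurable (X n @^-1` B).
  by move=> n0; exact: (skorohod_measurable (uE n0) (X_markov n0)).
have mO n U : (0 < n)%N -> open U -> measurable (X n @^-1` U).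
  by move=> n0 oU; apply: mX n0 _; exact: sub_sigma_algebra.
split=> [n n0 B|A cA|U oU]; first exact: mX.
- have mA n : (0 < n)%N -> measurable (X n @^-1` A).
    move=> n0; rewrite -[A]setCK preimage_setC; apply: measurableC.
    exact: mO n _ n0 (closed_openC cA).
  apply: (log_rate_limsup r_gt0 mA) => a' aI.
  have [s as_ sI] : exists2 s : R, a' < s & (s%:E < ereal_inf [set cw_rate I0 x | x in A])%E.
    move: aI; case: (ereal_inf _) => [c||]//; last by exists (a' + 1); rewrite ?ltrDl ?ltry.
    by rewrite lte_fin => ac; exists ((a' + c) / 2); rewrite ?lte_fin ?midf_lt.
  have neg : exp_negligible P X r s A.
    apply: (path_upper cA) => y Ay.
    by apply: (lt_le_trans sI); apply: ereal_inf_lbound; exists y.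
  apply: filterS2 near_positive (neg a' as_) => n n0 [Bad [mB pB] AB].
  by apply: le_trans pB; exact: (pr_le _ (mA n n0) mB AB).
- rewrite leeNl; apply: le_ereal_inf_tmp => _ [gam Ugam <-].
  have := cw_rate_ge0 I0_good gam; case Eg : (cw_rate I0 gam) => [c||]// _; last by rewrite leey.
  rewrite leeNl -EFinN; apply: (log_rate_liminf r_gt0 (fun n n0 => mO n U n0 oU)) => c' cc.
  by apply: (path_lower (fun n n0 => mO n U n0 oU) oU Ugam _ cc); rewrite Eg.
Qed.

End PathLargeDeviations.

Theorem theorem2p4 (R : realType)
  (d : nat -> measure_display)
  (Omega : forall n, measurableType (d n))
  (P : forall n, probability (Omega n) R)
  (m : forall n, Omega n -> skorohod R)
  (m_markov : forall n, (0 < n)%N ->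
    markov_process_with_generator (cw_state R n) (P n) (m n)
      (@cw_generator R n))
  (b : nat -> R)
  (b_gt0 : forall n, (0 < n)%N -> 0 < b n)
  (b_infty : b n @[n --> \oo] --> +oo)
  (b4n : b n ^+ 4 / n%:R @[n --> \oo] --> (0 : R))
  (I0 : R -> \bar R)
  (I0_good : good_rate_function I0)
  (LDP0 : LDP P (fun n w => b n * m n w 0) (fun n => n%:R / b n ^+ 4) I0) :
  good_rate_function (cw_rate I0) /\
  LDP P (fun n w => rescale (b n) (m n w)) (fun n => n%:R / b n ^+ 4)
    (cw_rate I0).
Proof.
split; first exact: cw_rate_good.
have /choice[p Hp] : forall n, exists p, (0 < n)%N ->
    [/\ transition_function (cw_state R n) p,
        has_generator (cw_state R n) p (@cw_generator R n)
      & markov_process (cw_state R n) (P n) (m n) p].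
  move=> n; have [n0|] := boolP (0 < n)%N; last by exists (fun _ _ _ => 0).
  by have [p Hp] := m_markov n n0; exists p.
have r_gt0 n : (0 < n)%N -> 0 < n%:R / b n ^+ 4.
  by move=> n0; rewrite divr_gt0 ?ltr0n// exprn_gt0// b_gt0.
apply: (@path_LDP R d Omega P (fun n w => rescale (b n) (m n w)) _
  (fun n => cw_states n (b n)) (fun n => cw_kernel (b n) (p n))) => //.
- apply/gtr0_cvgV0; first by exists 1%N => // n n1; exact: r_gt0.
  rewrite (_ : unstable.inv_fun _ = (fun n => b n ^+ 4 / n%:R))//.
  by apply/funext => n; rewrite /unstable.inv_fun invf_div.
- by move=> n n0; apply: uniq_cw_states => //; exact: b_gt0.
- by move=> n n0; apply: cw_kernel_transition (b_gt0 n n0) _; have [] := Hp n n0.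
- by move=> n n0; apply: cw_rescale_markov (b_gt0 n n0) _; have [] := Hp n n0.
- by apply: cw_one_step => // n n0; have [] := Hp n n0.
- rewrite (_ : (fun n w => _) = (fun n w => b n * m n w 0))//.
  by apply: functional_extensionality_dep => n; apply/funext => w /=; rewrite mulr0.
Qed.
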